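(* Let $(n_i)_{i\ge 1}$ be a strictly increasing sequence of natural numbers with $n_i\mid n_{i+1}$ for every $i$. Let $\Gamma:=\mathbb{Z}\rtimes\mathbb{Z}_2$ be the infinite dihedral group, let $\Gamma_i:=n_i\mathbb{Z}\rtimes\mathbb{Z}_2$ for $i\geq 1$, let $\Gamma\curvearrowright X=\varprojlim\Gamma/\Gamma_i$ be the associated odometer, and let $G$ be its transformation groupoid. Then $G$ is a counterexample to the HK conjecture; that is, $G$ is a second countable, étale, minimal, essentially principal groupoid with unit space homeomorphic to the Cantor set, and it is not the case that $$K_*(C^*_r(G))\simeq\bigoplus_{k\geq 0}H_{2k+*}(G)\quad\text{for both } *=0 \text{ and } *=1.$$
   Context: $\mathbb{Z}_2=\{0,1\}$ acts on $\mathbb{Z}$ by multiplication by $-1$, so the product in $\mathbb{Z}\rtimes\mathbb{Z}_2$ is $(m,a)(n,b)=(m+(-1)^a n,a+b)$; $n\mathbb{Z}\rtimes\mathbb{Z}_2$ is the subgroup $\{(m,a):n\mid m\}$. Odometer: given a group $\Gamma$ and a sequence $(\Gamma_i)_{i\geq 1}$ of finite index subgroups with $\Gamma_{i+1}\subsetneq\Gamma_i$ for all $i$, let $p_i\colon\Gamma/\Gamma_{i+1}\to\Gamma/\Gamma_i$, $p_i(\gamma\Gamma_{i+1})=\gamma\Gamma_i$, and let $X=\varprojlim(\Gamma/\Gamma_i,p_i)\subset\prod_i\Gamma/\Gamma_i$ with the topology inherited from the product of finite discrete spaces. The group $\Gamma$ acts on $X$ by $\gamma(x_i)=(\gamma x_i)$;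 this action is called an odometer. Transformation groupoid: for an action of a (discrete) group $\Gamma$ on a compact, totally disconnected, Hausdorff space $X$, it is $G=\Gamma\times X$ with the product topology; the product $(h,y)(g,x)$ is defined iff $y=gx$, and then $(h,gx)(g,x)=(hg,x)$; $(g,x)^{-1}=(g^{-1},gx)$. The unit space $G^{(0)}$ is identified with $X$, with source $s(g,x)=x$ and range $r(g,x)=gx$. $C^*_r(G)$ is the reduced groupoid C*-algebra, and $C^*_r(G)\simeq C(X)\rtimes_r\Gamma$. A groupoid $G$ is étale if $r,s$ are local homeomorphisms onto $G^{(0)}$; minimal if for every $x\in G^{(0)}$ the orbit $r(s^{-1}(x))$ is dense in $G^{(0)}$; essentially principal if the interior of $\{g\in G:r(g)=s(g)\}$ equals $G^{(0)}$. A groupoid is ample if it is locally compact, Hausdorff, étale, with totally disconnected unit space. Homology of an ample groupoid $G$: for $n\ge 1$ let $G^{(n)}\subset G^n$ be the space of composable $n$-tuples $(g_1,\dots,g_n)$ (the product $g_1\cdots g_n$ is defined). For $n\geq 2$, let $d_0,\dots,d_n\colon G^{(n)}\to G^{(n-1)}$ be $d_0(g_1,\dots,g_n)=(g_2,\dots,g_n)$, $d_i(g_1,\dots,g_n)=(g_1,\dots,g_ig_{i+1},\dots,g_n)$ for $1\le i\le n-1$, $d_n(g_1,\dots,g_n)=(g_1,\dots,g_{n-1})$; for $n=1$, $d_0=s$, $d_1=r$. A local homeomorphism $\pi\colon Y\to Z$ induces $\pi_*\colon C_c(Y,\mathbb{Z})\to C_c(Z,\mathbb{Z})$, $\pi_*(f)(z)=\sum_{y\in\pi^{-1}(z)}f(y)$.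 Put $\delta_n=\sum_{i=0}^n(-1)^i (d_i)_*\colon C_c(G^{(n)},\mathbb{Z})\to C_c(G^{(n-1)},\mathbb{Z})$ for $n\ge1$ and $\delta_0=0$ on $C_c(G^{(0)},\mathbb{Z})$. Then $H_n(G)=\ker\delta_n/\mathrm{Im}\,\delta_{n+1}$. For a transformation groupoid, $H_*(G)\simeq H_*(\Gamma,C(X,\mathbb{Z}))$ (group homology, with the $\Gamma$-module structure $(\gamma f)(x)=f(\gamma^{-1}x)$). The HK conjecture (Matui) predicts that for every second countable, étale, minimal, essentially principal groupoid $G$ with unit space homeomorphic to the Cantor set, $K_*(C^*_r(G))\simeq\bigoplus_{k\geq 0}H_{2k+*}(G)$ for $*=0,1$. *)

(* Defs.v *)
From HB Require Import structures.
From mathcomp Require Import all_boot all_order all_algebra finmap.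
From mathcomp Require Import all_classical all_reals all_analysis.
From mathcomp Require Import complex freeg ring lra zify.
From mathcomp Require summability.

Set Implicit Arguments.
Unset Strict Implicit.
Unset Printing Implicit Defensive.

Import Order.TTheory GRing.Theory Num.Theory numFieldNormedType.Exports.

Local Open Scope classical_set_scope.
Local Open Scope ring_scope.

Definition zmod_iso (V W : zmodType) : Prop :=
  exists f : {additive V -> W}, bijective f.

Section Span.
Variables (V : zmodType) (S : set V).

(* The subgroup of [V] generated by [S]. *)
Definition zspan : {pred V} :=
  fun v => `[< forall W : set V, S `<=` W -> zmod_closed (mem W) -> W v >].

Lemma zspan_zmod_closed : zmod_closed zspan.
Proof.
split=> [|u v /asboolP zu /asboolP zv]; apply/asboolP => W SW Wcl.
  by have /set_mem := Wcl.1.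
by have /set_mem := Wcl.2 u v (mem_set (zu W SW Wcl)) (mem_set (zv W SW Wcl)).
Qed.

HB.instance Definition _ := GRing.isZmodClosed.Build V zspan zspan_zmod_closed.
End Span.

(* Grothendieck group of the semigroup [S / eqv], whose addition is given as the
   relation [plus p q r] for r = p + q: the abelian group generated by the
   elements of [S], with [<< p >> = << q >>] when [eqv p q] and
   [<< r >> = << p >> + << q >>] when [plus p q r]. *)
Definition grothendieck (S : choiceType) (eqv : S -> S -> Prop)
    (plus : S -> S -> S -> Prop) : zmodType :=
  Quotient.quot (zspan ([set x : {freeg S} | exists p q, eqv p q /\ x = << p >> - << q >>]
    `|` [set x | exists p q r, plus p q r /\ x = << r >> - (<< p >> + << q >>)])).

Section DirectSum.
Variable V : nat -> zmodType.

Definition dprod : Type := forall k, V k.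
HB.instance Definition _ := gen_eqMixin dprod.
HB.instance Definition _ := gen_choiceMixin dprod.

Let add (u v : dprod) : dprod := fun k => u k + v k.
Let opp (u : dprod) : dprod := fun k => - u k.
Let zero : dprod := fun k => 0.
Let addA : associative add.
Proof. by move=> u v w; apply: functional_extensionality_dep => k; exact: addrA. Qed.
Let addC : commutative add.
Proof. by move=> u v; apply: functional_extensionality_dep => k; exact: addrC. Qed.
Let add0 : left_id zero add.
Proof. by move=> u; apply: functional_extensionality_dep => k; exact: add0r. Qed.
Let addN : left_inverse zero opp add.
Proof. by move=> u; apply: functional_extensionality_dep => k; exact: addNr. Qed.
HB.instance Definition _ := GRing.isZmodule.Build dprod addA addC add0 addN.

Definition fin_supp : {pred dprod} :=
  fun v => `[< exists N, forall k, (N <= k)%N -> v k = 0 >].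

Lemma fin_supp_zmod_closed : zmod_closed fin_supp.
Proof.
split=> [|u v /asboolP[M uM] /asboolP[N vN]]; apply/asboolP; first by exists 0%N.
exists (maxn M N) => k; rewrite geq_max => /andP[Mk Nk].
by rewrite [LHS](_ : _ = u k - v k)// uM// vN// subr0.
Qed.
HB.instance Definition _ := GRing.isZmodClosed.Build dprod fin_supp fin_supp_zmod_closed.

(* [dprod] is the full product of the [V k], [dsum] the subgroup of the families
   with finitely many nonzero terms. *)
Record dsum := Dsum { dsum_val :> dprod; _ : dsum_val \in fin_supp }.
HB.instance Definition _ := [isSub for dsum_val].
HB.instance Definition _ := [Choice of dsum by <:].
HB.instance Definition _ := [SubChoice_isSubZmodule of dsum by <:].
End DirectSum.

Definition homeomorphic (X Y : topologicalType) : Prop :=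
  exists (f : X -> Y) (g : Y -> X),
    [/\ continuous f, continuous g, cancel f g & cancel g f].

(* Every point has an open neighbourhood [U] with open image such that [f]
   restricts to a homeomorphism from [U] onto [f @` U]. *)
Definition local_homeo (X Y : topologicalType) (f : X -> Y) : Prop :=
  forall x, exists U : set X, [/\ open U, U x, open (f @` U) &
    exists g : Y -> X, [/\ {within U, continuous f}, {within f @` U, continuous g} &
      {in U, cancel f g}]].

Definition locally_injective (X : topologicalType) (Y : Type) (f : X -> Y) : Prop :=
  forall x : X, exists2 U : set X, nbhs x U & {in U &, injective f}.

Lemma local_homeo_inj (X Y : topologicalType) (f : X -> Y) :
  local_homeo f -> locally_injective f.
Proof.
move=> fl x; have [U [oU Ux _ [g [_ _ fg]]]] := fl x.
exists U; first exact: open_nbhs_nbhs.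
by move=> y z yU zU fyz; rewrite -(fg y)// -(fg z)// fyz.
Qed.

Definition supp (Y : topologicalType) (V : zmodType) (f : Y -> V) : set Y :=
  closure [set y | f y != 0].

(* C_c(Y, Z), with Z discrete. *)
Definition CcZ (Y : topologicalType) : {pred Y -> int} := fun f =>
  `[< continuous (f : Y -> discrete_topology int) /\ compact (supp f) >].

Lemma CcZ_zmod_closed (Y : topologicalType) : zmod_closed (@CcZ Y).
Proof.
split=> [|f g /asboolP[fc fK] /asboolP[gc gK]]; apply/asboolP; split.
- exact: cst_continuous.
- rewrite /supp [X in closure X](_ : _ = set0) ?closure0; first exact: compact0.
  by apply/seteqP; split=> // y /=; rewrite eqxx.
- move=> y; apply/(@discrete_cvg (discrete_topology int)).
  have /(@discrete_cvg (discrete_topology int)) fy := fc y.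
  have /(@discrete_cvg (discrete_topology int)) gy := gc y.
  change (nbhs y [set z | (f - g) z = (f - g) y]).
  have {}fy : nbhs y [set z | f z = f y] by exact: fy.
  have {}gy : nbhs y [set z | g z = g y] by exact: gy.
  apply: filterS2 fy gy => z /= fz gz.
  by rewrite [LHS](_ : _ = f z - g z)// fz gz.
- apply: (@subclosed_compact _ _ (supp f `|` supp g)).
  + exact: closed_closure.
  + exact: compactU.
  + rewrite /supp -closureU; apply: closureS => y /= h.
    by case: (eqVneq (f y) 0) => [f0|]; [right; apply: contraNneq h => g0;
      rewrite [(f - g) y](_ : _ = f y - g y)// f0 g0 subr0|left].
Qed.
HB.instance Definition _ (Y : topologicalType) :=
  GRing.isZmodClosed.Build (Y -> int) (@CcZ Y) (@CcZ_zmod_closed Y).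

(* [pi_*]; when [pi] is a local homeomorphism and [f] has compact support, the
   sum over each fibre is finite, see [finite_fiber]. *)
Definition pushforward (Y Z : topologicalType) (pi : Y -> Z) (f : Y -> int) : Z -> int :=
  fun z => \sum_(y \in pi @^-1` [set z]) f y.

Lemma finite_fiber (Y Z : topologicalType) (pi : Y -> Z) (f : Y -> int) z :
  locally_injective pi -> f \in @CcZ Y ->
  finite_set (pi @^-1` [set z] `&` [set y | f y != 0]).
Proof.
move=> pil /asboolP[_ /compact_near_coveringP fK].
have H : forall y : Y, exists U : set Y, nbhs y U /\ {in U &, injective pi}.
  by move=> y; have [U nU Uinj] := pil y; exists U.
have [U UP] := boolp.choice H.
have totF := @summability.totally_filter Y.
have [] := fK _ summability.totally (fun (F : {fset Y}) y => exists2 i, i \in F & U i y).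
  move=> y _; exists (U y, [set F : {fset Y} | y \in F]) => /=.
    split; first by have [] := UP y.
    by exists [fset y]%fset => //= F /fsubsetP; apply; rewrite inE.
  by move=> [u F] [/= Uu Fy]; exists y.
move=> F _ /(_ F (fsubset_refl F)) FU.
pose h i := [set y | pi y = z /\ U i y].
apply: (@sub_finite_set _ _ (\bigcup_(i in [set i | i \in F]) h i)).
  move=> y [pyz /subset_closure/FU[i Fi Uiy]]; by exists i.
apply: bigcup_finite; first exact: finite_fset.
move=> i _; have [_ Uinj] := UP i.
have [->|/set0P[y [py Uy]]] := eqVneq (h i) set0; first exact: finite_set0.
apply: (@sub_finite_set _ _ [set y]); last exact: finite_set1.
by move=> u [pu Uu]; apply: Uinj; rewrite ?inE// pu.
Qed.

Lemma pushforwardB (Y Z : topologicalType) (pi : Y -> Z) (f g : Y -> int) :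
  locally_injective pi -> f \in @CcZ Y -> g \in @CcZ Y ->
  pushforward pi (f - g) = pushforward pi f - pushforward pi g.
Proof.
move=> pil fC gC; apply/funext => z.
rewrite [RHS](_ : _ = pushforward pi f z - pushforward pi g z)// /pushforward.
set D := _ @^-1` _.

pose E := [set y | f y != 0] `|` [set y | g y != 0].
have widen (k : Y -> int) : (forall y, k y != 0 -> E y) ->
    \sum_(y \in D) k y = \sum_(y \in D `&` E) k y.
  move=> kE; apply/esym/fsbig_widen; first by move=> y [].
  by move=> y [Dy nDEy]/=; apply: contra_notP nDEy => /eqP/kE.
have wf := widen f (fun _ fy => or_introl fy).
have wg := widen g (fun _ gy => or_intror gy).
have wfg : \sum_(y \in D) (f - g) y = \sum_(y \in D `&` E) (f - g) y.
  apply: widen => y ky; apply: contrapT => /not_orP[/negP/negPn/eqP f0 /negP/negPn/eqP g0].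
  by move: ky; rewrite [(f - g) y](_ : _ = f y - g y)// f0 g0 subr0 eqxx.
rewrite wfg wf wg.
have finE : finite_set (D `&` E).
  by rewrite /E setIUr finite_setU; split; exact: finite_fiber.
by rewrite !fsbig_finite//= -sumrB.
Qed.

(* Topological groupoids, with G^(0) given as a separate space embedded in the
   arrows by [gid].  [gmul] is total, but its value (g, h) |-> gh is only
   meaningful, and only constrained, when [src g = rng h]. *)
Record groupoid := Groupoid {
  arrow : topologicalType;
  unit_space : topologicalType;
  src : arrow -> unit_space;
  rng : arrow -> unit_space;
  gid : unit_space -> arrow;
  gmul : arrow -> arrow -> arrow;
  ginv : arrow -> arrow;
  src_gid : forall x, src (gid x) = x;
  rng_gid : forall x, rng (gid x) = x;
  src_gmul : forall g h, src g = rng h -> src (gmul g h) = src h;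
  rng_gmul : forall g h, src g = rng h -> rng (gmul g h) = rng g;
  gmulA : forall g h k, src g = rng h -> src h = rng k ->
    gmul g (gmul h k) = gmul (gmul g h) k;
  gmul_idl : forall g, gmul (gid (rng g)) g = g;
  gmul_idr : forall g, gmul g (gid (src g)) = g;
  src_ginv : forall g, src (ginv g) = rng g;
  rng_ginv : forall g, rng (ginv g) = src g;
  gmul_invl : forall g, gmul (ginv g) g = gid (src g);
  gmul_invr : forall g, gmul g (ginv g) = gid (rng g);
  src_continuous : continuous src;
  rng_continuous : continuous rng;
  gid_continuous : continuous gid;
  ginv_continuous : continuous ginv;
  gmul_continuous :
    {within [set p | src p.1 = rng p.2], continuous (fun p => gmul p.1 p.2)} }.

Definition etale (G : groupoid) : Prop :=
  local_homeo (@src G) /\ local_homeo (@rng G).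

Definition minimal (G : groupoid) : Prop :=
  forall x : unit_space G, dense (@rng G @` (@src G @^-1` [set x])).

Definition essentially_principal (G : groupoid) : Prop :=
  interior [set g : arrow G | rng g = src g] = range (@gid G).

Record etale_groupoid := EtaleGroupoid {
  etale_groupoid_groupoid :> groupoid;
  etaleP : etale etale_groupoid_groupoid }.

Section Homology.
Variable G : etale_groupoid.

(* The tuple (g_1, ..., g_n) is encoded as a function on 'I_n, so with indices
   shifted by one. *)
Definition composable n : set (prod_topology (fun _ : 'I_n => arrow G)) :=
  [set g | forall i j : 'I_n, (j = i.+1 :> nat) -> src (g i) = rng (g j)].

Definition nerve n : topologicalType :=
  if n is m.+1 then set_type (@composable m.+1) else unit_space G.

(* Since the indices are shifted by one, the product g_i g_(i+1) sits at the index
   [j] such that [j.+1 = i]; the extreme faces [i = 0] and [i = n.+2] only use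
   the last and the first case, respectively. *)
Definition face_fun n (i : nat) (g : 'I_n.+2 -> arrow G) : 'I_n.+1 -> arrow G :=
  fun j => if (j.+1 < i)%N then g (fintype.lift ord_max j)
           else if j.+1 == i then gmul (g (fintype.lift ord_max j)) (g (fintype.lift ord0 j))
           else g (fintype.lift ord0 j).

Lemma face_fun_composable n i g :
  g \in @composable n.+2 -> @face_fun n i g \in @composable n.+1.
Proof.
move=> /set_mem gC; apply/mem_set => j k jk.
have gj : src (g (fintype.lift ord_max j)) = rng (g (fintype.lift ord0 j)).
  by apply: gC; rewrite /= /bump [(n < _)%N]ltnNge -[(_ <= n)%N]ltnS ltn_ord.
have gk : src (g (fintype.lift ord_max k)) = rng (g (fintype.lift ord0 k)).
  by apply: gC; rewrite /= /bump [(n < _)%N]ltnNge -[(_ <= n)%N]ltnS ltn_ord.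
have e : fintype.lift ord_max k = fintype.lift ord0 j.
  by apply: val_inj; rewrite /= /bump [(n < _)%N]ltnNge -[(_ <= n)%N]ltnS ltn_ord /= jk.
rewrite /face_fun; case: (ltngtP j.+1 i) => ji.
- have -> : src (g (fintype.lift ord_max j)) = rng (g (fintype.lift ord_max k)) by rewrite e.
  case: (ltngtP k.+1 i) => ki //; last by rewrite rng_gmul.
  by move: ji ki; rewrite jk => a b; exfalso; lia.
- have -> : (k.+1 < i)%N = false by rewrite jk; lia.
  have -> : (k.+1 == i)%N = false by rewrite jk; lia.
  by rewrite -e.
- have -> : (k.+1 < i)%N = false by rewrite jk; lia.
  have -> : (k.+1 == i)%N = false by rewrite jk; lia.
  by rewrite src_gmul// -e.
Qed.

Definition face n (i : 'I_n.+2) : nerve n.+1 -> nerve n :=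
  match n return 'I_n.+2 -> nerve n.+1 -> nerve n with
  | 0 => fun i g => if i == 0%N :> nat then src (\val g ord0) else rng (\val g ord0)
  | m.+1 => fun i g => SigSub (face_fun_composable i (valP g))
  end i.

Lemma arrow_locally_injective (g : arrow G) : exists2 U : set (arrow G), nbhs g U &
  {in U &, injective (@src G)} /\ {in U &, injective (@rng G)}.
Proof.
have [sl rl] := etaleP G.
have [U gU Us] := local_homeo_inj sl g; have [V gV Vr] := local_homeo_inj rl g.
exists (U `&` V); first exact: filterI.
by split=> h k /set_mem[Uh Vh] /set_mem[Uk Vk]; [apply: Us|apply: Vr]; exact: mem_set.
Qed.

Lemma nerve_nbhs n (g : nerve n.+1) (W : 'I_n.+1 -> set (arrow G)) :
  (forall j, nbhs (\val g j) (W j)) ->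
  nbhs g [set h : nerve n.+1 | forall j, W j (\val h j)].
Proof.
move=> gW.
apply: (@filter_forall _ _ (fun j (h : nerve n.+1) => W j (\val h j)) (nbhs g)) => j.
have c1 : continuous (\val : set_type (@composable n.+1) -> _) by exact: initial_continuous.
have c2 := @proj_continuous _ (fun _ : 'I_n.+1 => arrow G) j (\val g).
exact: (c1 g _ (c2 _ (gW j))).
Qed.

Lemma face_locally_injective n i : locally_injective (@face n i).
Proof.
move=> g.
have H j : exists U : set (arrow G), [/\ nbhs (\val g j) U,
    {in U &, injective (@src G)} & {in U &, injective (@rng G)}].
  by have [U gU [Us Ur]] := arrow_locally_injective (\val g j); exists U.
have [W WP] := boolp.choice H.
exists [set h : nerve n.+1 | forall j, W j (\val h j)].
  by apply: nerve_nbhs => j; have [] := WP j.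
have Ws j : {in W j &, injective (@src G)} by have [] := WP j.
have Wr j : {in W j &, injective (@rng G)} by have [] := WP j.
move=> h k /set_mem hW /set_mem kW.
have {hW} hW j : \val h j \in W j by exact/mem_set/hW.
have {kW} kW j : \val k j \in W j by exact/mem_set/kW.
case: n i g h k H W WP Ws Wr hW kW => [|n] i g h k _ W _ Ws Wr hW kW.
  move=> /= hk; apply: val_inj; apply/funext => j; have -> : j = ord0 by exact: ord1.
  move: hk; by case: ifP => _ e; [apply: (Ws _ _ _ (hW ord0) (kW ord0))|apply: (Wr _ _ _ (hW ord0) (kW ord0))].
move=> /(congr1 (fun x => \val x)) /= hk.
have {}hk j : face_fun i (\val h) j = face_fun i (\val k) j by rewrite hk.
have hC (a b : 'I_n.+2) : b = a.+1 :> nat -> src (\val h a) = rng (\val h b).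
  by have /set_mem := valP h; exact.
have kC (a b : 'I_n.+2) : b = a.+1 :> nat -> src (\val k a) = rng (\val k b).
  by have /set_mem := valP k; exact.
have lo (a : 'I_n.+2) : (a.+1 < i)%N -> \val h a = \val k a.
  move=> ai; have an : (a < n.+1)%N by have := ltn_ord i; lia.
  have := hk (Ordinal an); rewrite /face_fun /= ai.
  by rewrite (_ : fintype.lift _ _ = a)//; apply: val_inj; rewrite /= /bump; lia.
have hi (a : 'I_n.+2) : (i < a)%N -> \val h a = \val k a.
  move=> ia; have an : (a.-1 < n.+1)%N by have := ltn_ord a; lia.
  have := hk (Ordinal an); rewrite /face_fun /=.
  have -> : (a.-1.+1 < i)%N = false by lia.
  have -> : (a.-1.+1 == i)%N = false by lia.
  by rewrite (_ : fintype.lift _ _ = a)//; apply: val_inj; rewrite /= /bump; lia.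
have mid (a b : 'I_n.+2) : a.+1 = i :> nat -> b = i :> nat ->
    \val h a = \val k a /\ \val h b = \val k b.
  move=> ai bi; have an : (a < n.+1)%N by have := ltn_ord b; lia.
  have := hk (Ordinal an); rewrite /face_fun /= ai ltnn eqxx.
  have -> : fintype.lift ord_max (Ordinal an) = a.
    by apply: val_inj; rewrite /= /bump; lia.
  have -> : fintype.lift ord0 (Ordinal an) = b.
    by apply: val_inj; rewrite /= /bump; lia.
  have ab : b = a.+1 :> nat by lia.
  move=> e; split.
    apply: (Wr a _ _ (hW a) (kW a)).
    exact: (etrans (esym (rng_gmul (hC _ _ ab))) (etrans (congr1 _ e) (rng_gmul (kC _ _ ab)))).
  apply: (Ws b _ _ (hW b) (kW b)).
  exact: (etrans (esym (src_gmul (hC _ _ ab))) (etrans (congr1 _ e) (src_gmul (kC _ _ ab)))).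
apply: val_inj; apply/funext => j.
have [ji|ji|ji] := ltngtP j i; last 2 first.
- exact: hi.
- move: ji; case: (posnP j) => [j0 ji|j0 ji].
    have jn : (j.+1 < n.+2)%N by rewrite j0.
    have e := hi (Ordinal jn) (ltac:(rewrite /=; lia)).
    by apply: (Ws j _ _ (hW j) (kW j)); rewrite (hC _ (Ordinal jn))// (kC _ (Ordinal jn))// e.
  have jn : (j.-1 < n.+2)%N by have := ltn_ord j; lia.
  by have [] := mid (Ordinal jn) j (ltac:(rewrite /=; lia)) ji.
have [ji'|ji'|ji'] := ltngtP j.+1 i; [exact: lo|by exfalso; lia|].
case: (ltnP i n.+2) => iN.
  by have [] := mid j (Ordinal iN) ji' (erefl _).
have jn : (j.-1 < n.+2)%N by have := ltn_ord j; lia.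
have j0 : (0 < j)%N by have := ltn_ord i; lia.
have e := lo (Ordinal jn) (ltac:(rewrite /=; lia)).
have jj : j = j.-1.+1 :> nat by lia.
by apply: (Wr j _ _ (hW j) (kW j)); rewrite -(hC (Ordinal jn))// -(kC (Ordinal jn))// e.
Qed.

(* [delta n] is defined on all functions but is only used on C_c(G^(n), Z). *)
Definition delta n : (nerve n -> int) -> (nerve n.-1 -> int) :=
  match n with
  | 0 => fun _ => 0
  | m.+1 => fun f z => \sum_(i < m.+2) (-1) ^+ i * pushforward (face i) f z
  end.

Lemma deltaB n (f g : nerve n -> int) :
  f \in @CcZ (nerve n) -> g \in @CcZ (nerve n) -> delta (f - g) = delta f - delta g.
Proof.
case: n f g => [|n] f g fC gC /=; first by rewrite subr0.
apply/funext => z; rewrite [RHS](_ : _ = delta f z - delta g z)// -sumrB.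
apply: eq_bigr => i _; rewrite -mulrBr pushforwardB//.
exact: face_locally_injective.
Qed.

Lemma delta0 n : delta (0 : nerve n -> int) = 0.
Proof.
have := @deltaB n 0 0 (rpred0 _) (rpred0 _).
by rewrite !subrr.
Qed.

Definition cycle n : {pred nerve n -> int} :=
  fun f => (f \in @CcZ (nerve n)) && `[< delta f = 0 >].
Lemma cycle_zmod_closed n : zmod_closed (@cycle n).
Proof.
split=> [|f g /andP[fC /asboolP f0] /andP[gC /asboolP g0]]; apply/andP; split.
- exact: rpred0.
- by apply/asboolP; exact: delta0.
- exact: rpredB.
- by apply/asboolP; rewrite deltaB// f0 g0 subr0.
Qed.
HB.instance Definition _ n :=
  GRing.isZmodClosed.Build (nerve n -> int) (@cycle n) (@cycle_zmod_closed n).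

Record ker_delta n := KerDelta { ker_val :> nerve n -> int; _ : ker_val \in @cycle n }.
HB.instance Definition _ n := [isSub for @ker_val n].
HB.instance Definition _ n := [Choice of ker_delta n by <:].
HB.instance Definition _ n := [SubChoice_isSubZmodule of ker_delta n by <:].

(* The image of delta_(n+1), as a subgroup of [ker_delta n]. *)
Definition im_delta n : {pred ker_delta n} := fun f =>
  `[< exists2 h : nerve n.+1 -> int, h \in @CcZ (nerve n.+1) & delta h = f >].
Lemma im_delta_zmod_closed n : zmod_closed (@im_delta n).
Proof.
split=> [|f g /asboolP[h hC hf] /asboolP[k kC kg]]; apply/asboolP.
  by exists 0; [exact: rpred0|exact: delta0].
by exists (h - k); [exact: rpredB|rewrite deltaB// hf kg].
Qed.
HB.instance Definition _ n :=
  GRing.isZmodClosed.Build (ker_delta n) (@im_delta n) (@im_delta_zmod_closed n).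

Definition homology n : zmodType := Quotient.quot (@im_delta n).
End Homology.

Section TransformationGroupoid.
Variables (Gam : groupType) (X : topologicalType).

Record action := Action {
  act :> Gam -> X -> X;
  act1 : forall x, act 1%g x = x;
  actM : forall g h x, act (g * h)%g x = act g (act h x);
  act_continuous : forall g, continuous (act g) }.

Variable a : action.

Definition tarrow : topologicalType := (discrete_topology Gam * X)%type.
Definition tsrc (p : tarrow) : X := p.2.
Definition trng (p : tarrow) : X := a p.1 p.2.
Definition tid (x : X) : tarrow := (1%g, x).
Definition tmul (p q : tarrow) : tarrow := ((p.1 * q.1)%g, q.2).
Definition tinv (p : tarrow) : tarrow := (p.1^-1%g, a p.1 p.2).

Lemma tarrow_cvg (Y : topologicalType) (f : Y -> tarrow) (y : Y) :
  (\forall z \near y, (f z).1 = (f y).1) ->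
  {for y, continuous (fun z => (f z).2)} -> {for y, continuous f}.
Proof.
move=> f1 f2.
have f1' : {for y, continuous (fun z => (f z).1)}.
  by apply/(@discrete_cvg (discrete_topology Gam)).
rewrite /continuous_at (_ : f = fun z => ((f z).1, (f z).2)); last first.
  by apply/funext => z; case: (f z).
exact: (cvg_pair f1' f2).
Qed.

Lemma near_fst (p : tarrow) : \forall q \near p, q.1 = p.1.
Proof.
have : {for p, continuous (fst : tarrow -> discrete_topology Gam)} by exact: cvg_fst.
by move/(@discrete_cvg (discrete_topology Gam)).
Qed.

Lemma trng_continuous : continuous trng.
Proof.
move=> p; rewrite /continuous_at.
have h : {for p, continuous (fun q : tarrow => a p.1 q.2)}.
  apply: (@continuous_comp _ _ _ (snd : tarrow -> X) (a p.1)).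
    exact: cvg_snd.
  exact: act_continuous.
apply: cvg_trans h; apply: near_eq_cvg.
by apply: filterS (near_fst p) => q; rewrite /trng => ->.
Qed.

Lemma tinv_continuous : continuous tinv.
Proof.
move=> p; apply: tarrow_cvg; last exact: trng_continuous.
by apply: filterS (near_fst p) => q /= ->.
Qed.

Lemma tid_continuous : continuous tid.
Proof. by move=> x; apply: tarrow_cvg; [exact: nearW|exact: cvg_id]. Qed.

Lemma tmul_continuous : continuous (fun p : tarrow * tarrow => tmul p.1 p.2).
Proof.
move=> [p q]; apply: tarrow_cvg => /=.
  have hp : \forall z \near (p, q), z.1.1 = p.1 by exact: (cvg_fst (near_fst p)).
  have hq : \forall z \near (p, q), z.2.1 = q.1 by exact: (cvg_snd (near_fst q)).
  by apply: filterS2 hp hq => z -> ->.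
apply: (@continuous_comp _ _ _ (snd : tarrow * tarrow -> tarrow) (snd : tarrow -> X)).
  exact: cvg_snd.
exact: cvg_snd.
Qed.

Definition transformation_groupoid : groupoid.
Proof.
refine (@Groupoid tarrow X tsrc trng tid tmul tinv _ _ _ _ _ _ _ _ _ _ _ _ _ _ _ _).
- by [].
- by move=> x; rewrite /trng /= act1.
- by [].
- by move=> [g x] [h y] /= xy; rewrite /trng /= actM -[a h y]xy.
- by move=> [g x] [h y] [k z] _ _; rewrite /tmul /= mulgA.
- by move=> [g x]; rewrite /tmul /= mul1g.
- by move=> [g x]; rewrite /tmul /= mulg1.
- by [].
- by move=> [g x]; rewrite /trng /tsrc /= -actM mulVg act1.
- by move=> [g x]; rewrite /tmul /tid /= mulVg.
- by move=> [g x]; rewrite /tmul /tid /= mulgV.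
- by move=> p; exact: cvg_snd.
- exact: trng_continuous.
- exact: tid_continuous.
- exact: tinv_continuous.
- exact/continuous_subspaceT/tmul_continuous.
Defined.

Lemma transformation_groupoid_etale : etale transformation_groupoid.
Proof.
pose U g : set tarrow := [set p : tarrow | p.1 = g].
have oU g : open (U g) by rewrite openE => p /= <-; exact: near_fst.
have gy (g : Gam) (h : X -> X) : continuous h -> continuous (fun y => (g, h y) : tarrow).
  by move=> hc y; apply: tarrow_cvg; [exact: nearW|exact: hc].
split=> -[g x]; exists (U g); split.
- exact: (oU g).
- by [].
- rewrite [X in open X](_ : _ = setT); first exact: openT.
  by apply/seteqP; split=> // y _; exists (g, y).
- exists (fun y => (g, y)); split.
  + by apply: continuous_subspaceT => p; exact: cvg_snd.
  + by apply: continuous_subspaceT; apply: (gy g id) => y; exact: cvg_id.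
  + by move=> [h y] /set_mem; rewrite /U /= => ->.
- exact: (oU g).
- by [].
- rewrite [X in open X](_ : _ = setT); first exact: openT.
  apply/seteqP; split=> // y _; exists (g, a g^-1%g y) => //.
  by rewrite /= /trng /= -actM mulgV act1.
- exists (fun y => (g, a g^-1%g y)); split.
  + exact/continuous_subspaceT/trng_continuous.
  + by apply: continuous_subspaceT; apply: gy; exact: act_continuous.
  + by move=> [h y] /set_mem; rewrite /U /= /trng /= => ->; rewrite -actM mulVg act1.
Qed.

Definition transformation_etale_groupoid : etale_groupoid :=
  EtaleGroupoid transformation_groupoid_etale.

End TransformationGroupoid.

Lemma prod_continuous (I : Type) (Y : topologicalType) (T : I -> topologicalType)
    (f : Y -> prod_topology T) :
  (forall i, continuous (fun y => f y i)) -> continuous f.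
Proof.
move=> fc y; apply/cvg_sup => i.
exact: (@continuous_comp_initial (prod_topology T) Y (T i) (fun g => g i) f (fc i)).
Qed.

Section Odometer.
Variables (Gam : groupType) (H : nat -> set Gam).

Definition lcoset (g : Gam) (A : set Gam) : set Gam := [set (g * h)%g | h in A].

Definition cosets (A : set Gam) : set (set Gam) := range (lcoset ^~ A).

(* The inverse limit of the left coset spaces; the bonding map sends
   g H_(i+1) to g H_i.  The sequence [H] is meant to be a strictly decreasing
   sequence of finite index subgroups, indexed from 0. *)
Definition odometer : set (prod_topology (fun i => discrete_topology (cosets (H i)))) :=
  [set x | forall i, exists g : Gam,
    \val (x i.+1) = lcoset g (H i.+1) /\ \val (x i) = lcoset g (H i)].

Lemma lcosetM g h A : lcoset (g * h)%g A = lcoset g (lcoset h A).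
Proof.
apply/seteqP; split=> [_ [k Ak <-]|_ [_ [k Ak <-] <-]].
  by exists (h * k)%g; [exists k|rewrite mulgA].
by exists k => //; rewrite mulgA.
Qed.

Lemma lcoset1 A : lcoset 1%g A = A.
Proof.
by apply/seteqP; split=> [_ [k Ak <-]|k Ak]; [rewrite mul1g|exists k => //; rewrite mul1g].
Qed.

Lemma lcoset_cosets g A (C : cosets A) : lcoset g (\val C) \in cosets A.
Proof.
have /set_mem[h _ hC] := valP C; apply/mem_set; exists (g * h)%g => //.
by rewrite lcosetM; exact: congr1 hC.
Qed.

Definition coset_act g A (C : cosets A) : cosets A := SigSub (lcoset_cosets g C).

Lemma odometer_act_subproof g (x : odometer) :
  (fun i => coset_act g (\val x i)) \in odometer.
Proof.
apply/mem_set => i; have /set_mem/(_ i)[h [h1 h2]] := valP x.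
exists (g * h)%g; rewrite !lcosetM; split; [exact: (congr1 (lcoset g) h1)|exact: (congr1 (lcoset g) h2)].
Qed.

Definition odometer_act g (x : odometer) : odometer :=
  SigSub (odometer_act_subproof g x).

Lemma odometer_act1 x : odometer_act 1%g x = x.
Proof.
apply: val_inj; apply: functional_extensionality_dep => i; apply: val_inj.
exact: lcoset1.
Qed.

Lemma odometer_actM g h x : odometer_act (g * h)%g x = odometer_act g (odometer_act h x).
Proof.
apply: val_inj; apply: functional_extensionality_dep => i; apply: val_inj.
exact: lcosetM.
Qed.

Lemma odometer_act_continuous g : continuous (odometer_act g).
Proof.
apply: continuous_comp_initial; apply: prod_continuous => i.
pose c (C : discrete_topology (cosets (H i))) : discrete_topology (cosets (H i)) :=
  coset_act g C.
have cc : continuous c.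
  move=> C; apply/(@discrete_cvg (discrete_topology (cosets (H i)))).
  have CS : [set C] `<=` [set D | c D = c C] by move=> _ ->.
  exact: (filterS CS (discrete_set1 C)).
move=> x; apply: (@continuous_comp _ _ _ (fun x : odometer => \val x i) c); last exact: cc.
apply: (@continuous_comp _ _ _ (\val : odometer -> prod_topology _) (fun x => x i)).
  exact: initial_continuous.
exact: (@proj_continuous _ (fun i => discrete_topology (cosets (H i)))).
Qed.

Definition odometer_action : action Gam odometer :=
  Action odometer_act1 odometer_actM odometer_act_continuous.
End Odometer.

(* The semidirect product Z >< Z/2, with Z/2 written as [bool]. *)
Definition dihedral : Type := (int * bool)%type.
HB.instance Definition _ := Choice.on dihedral.

Section Dihedral.
Implicit Types u v w : dihedral.

Let mul u v : dihedral := (u.1 + (-1) ^+ u.2 * v.1, u.2 (+) v.2).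
Let one : dihedral := (0, false).
Let inv u : dihedral := (- ((-1) ^+ u.2 * u.1), u.2).

Let mulA : associative mul.
Proof.
move=> [m a] [n b] [p c]; rewrite /mul /=; congr (_, _); last by rewrite addbA.
by rewrite mulrDr addrA signr_addb mulrA.
Qed.
Let mul1 : left_id one mul.
Proof. by move=> [m a]; rewrite /mul /= mul1r add0r. Qed.
Let mulr1 : right_id one mul.
Proof. by move=> [m a]; rewrite /mul /= mulr0 addr0 addbF. Qed.
Let mulV : left_inverse one inv mul.
Proof. by move=> [m a]; rewrite /mul /= addbb; congr (_, _); case: a; rewrite ?expr0 ?expr1; ring. Qed.
Let mulrV : right_inverse one inv mul.
Proof. by move=> [m a]; rewrite /mul /= addbb; congr (_, _); case: a; rewrite ?expr0 ?expr1; ring. Qed.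
HB.instance Definition _ := isGroup.Build dihedral mulA mul1 mulr1 mulV mulrV.
End Dihedral.

Definition dihedral_sub (n : nat) : set dihedral := [set u | (n%:Z %| u.1)%Z].

Definition Cx (R : realType) : numClosedFieldType := R[i].

Section BoundedOperators.
Variables (R : realType) (I : choiceType).
Local Notation C := (Cx R).

(* Squared l^2 norm. *)
Definition normsq (x : I -> C) : \bar R :=
  (\esum_(i in [set: I]) ((Normc.normc (x i)) ^+ 2)%:E)%E.

Definition square_summable : {pred I -> C} := fun x => `[< (normsq x < +oo)%E >].


Lemma normsq_ge0 x : (0 <= normsq x)%E.
Proof. by apply: esum_ge0 => i _; rewrite lee_fin sqr_ge0. Qed.

Lemma normsqD (x y : I -> C) :
  (normsq (x + y)%R <= (normsq x + normsq x) + (normsq y + normsq y))%E.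
Proof.
rewrite /normsq -!esumD; do ?[by move=> i _; rewrite ?adde_ge0// lee_fin sqr_ge0].
apply: le_esum => i _; rewrite -!EFinD lee_fin.
have h := le_normcD (x i) (y i).
have h0 : 0 <= Normc.normc (x i + y i) :> R by case: (x i + y i) => a b; exact: sqrtr_ge0.
apply: (@le_trans _ _ ((Normc.normc (x i) + Normc.normc (y i)) ^+ 2)).
  by rewrite ler_pXn2r// nnegrE (le_trans h0).
rewrite -subr_ge0 [X in 0 <= X](_ : _ = (Normc.normc (x i) - Normc.normc (y i)) ^+ 2) ?sqr_ge0//.
ring.
Qed.

Lemma normsqZ (c : C) (x : I -> C) :
  (normsq (c *: x)%R <= (Normc.normc c ^+ 2)%:E * normsq x)%E.
Proof.

apply: ge_ereal_sup => _ [X [finX _]] <-.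
under eq_fsbigr do rewrite [(_ *: _) _]/(c * _) Normc.normcM exprMn EFinM.
rewrite -ge0_mule_fsumr; last by move=> i; rewrite lee_fin sqr_ge0.
rewrite lee_wpmul2l ?lee_fin ?sqr_ge0//.
by apply: ereal_sup_ubound; exists X.
Qed.

Lemma square_summable_submod_closed : submod_closed square_summable.
Proof.
split=> [|c x y /asboolP xoo /asboolP yoo]; apply/asboolP.
  by rewrite /normsq esum1 ?ltry// => i _; rewrite Normc.normc0 expr0n.
have zoo : (normsq (c *: x)%R < +oo)%E.
  apply: (le_lt_trans (normsqZ c x)).
  by rewrite lte_mul_pinfty ?lee_fin ?sqr_ge0.
by apply: (le_lt_trans (normsqD _ _)); rewrite !lte_add_pinfty.
Qed.
HB.instance Definition _ :=
  GRing.isSubmodClosed.Build C (I -> C) square_summable square_summable_submod_closed.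

Record l2 := L2 { l2_val :> I -> C; _ : l2_val \in square_summable }.
HB.instance Definition _ := [isSub for l2_val].
HB.instance Definition _ := [Choice of l2 by <:].
HB.instance Definition _ := [SubChoice_isSubLmodule of l2 by <:].

Definition l2norm (x : l2) : R := Num.sqrt (fine (normsq x)).

(* The sum is the limit of the net of sums over finite subsets of [I]. *)
Definition inner (x y : l2) : C :=
  summability.sum (fun i => x i * (y i)^* : C^o).

Lemma l2normB x y : l2norm (x - y) <= 2 * (l2norm x + l2norm y).
Proof.
have fin (z : l2) : normsq z \is a fin_num.
  by case: z => z /= /asboolP zoo; rewrite ge0_fin_numE ?normsq_ge0.
have h : fine (normsq (x - y)) <= 2 * (fine (normsq x) + fine (normsq y)).
  have := normsqD (l2_val x) (l2_val (- y)).
  rewrite [X in (_ <= _ + (X + X))%E](_ : _ = normsq y); last first.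
    by apply: eq_esum => i _; rewrite normcN.
  rewrite -[X in (X <= _)%E]fineK//; last exact: (fin (x - y)).
  rewrite -[normsq x]fineK// -[normsq y]fineK// -!EFinD lee_fin.
  by move=> /le_trans; apply; lra.
have x0 : 0 <= fine (normsq x) by rewrite fine_ge0 ?normsq_ge0.
have y0 : 0 <= fine (normsq y) by rewrite fine_ge0 ?normsq_ge0.
rewrite /l2norm -(@ler_pXn2r _ 2)// ?nnegrE ?sqrtr_ge0 ?mulr_ge0 ?addr_ge0 ?sqrtr_ge0//.
rewrite sqr_sqrtr ?fine_ge0 ?normsq_ge0// (le_trans h)//.
have := sqr_sqrtr x0; have := sqr_sqrtr y0.
have := sqrtr_ge0 (fine (normsq x)); have := sqrtr_ge0 (fine (normsq y)).
move: (Num.sqrt _) (Num.sqrt _) => a b; nra.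
Qed.

Definition bounded_linear : {pred l2 -> l2} := fun T =>
  `[< linear T /\ exists M : R, forall x, l2norm (T x) <= M * l2norm x >].

Lemma bounded_linear_zmod_closed : zmod_closed bounded_linear.
Proof.
split=> [|T S /asboolP[Tlin [M TM]] /asboolP[Slin [N SN]]]; apply/asboolP.
  split=> [c x y|]; first by rewrite scaler0 addr0.
  exists 0 => x; rewrite mul0r /l2norm /normsq esum1 ?sqrtr0//.
  by move=> i _; rewrite Normc.normc0 expr0n.
split=> [c x y|].
  rewrite [LHS](_ : _ = T (c *: x + y) - S (c *: x + y))// Tlin Slin.
  by rewrite [(T - S) x](_ : _ = T x - S x)// [(T - S) y](_ : _ = T y - S y)// scalerBr opprD addrACA.
exists (2 * (M + N)) => x; rewrite [(T - S) x](_ : _ = T x - S x)//.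
rewrite (le_trans (l2normB _ _))// -mulrA ler_wpM2l// mulrDl lerD//.
Qed.
HB.instance Definition _ :=
  GRing.isZmodClosed.Build (l2 -> l2) bounded_linear bounded_linear_zmod_closed.

(* B(l^2(I)); its ring structure has composition as the product. *)
Record bop := Bop { bop_val :> l2 -> l2; _ : bop_val \in bounded_linear }.
HB.instance Definition _ := [isSub for bop_val].
HB.instance Definition _ := [Choice of bop by <:].
HB.instance Definition _ := [SubChoice_isSubZmodule of bop by <:].

Lemma bop1_subproof : (id : l2 -> l2) \in bounded_linear.
Proof. by apply/asboolP; split=> //; exists 1 => x; rewrite mul1r. Qed.

Lemma bopM_subproof (T S : bop) : (T \o S) \in bounded_linear.
Proof.
have /asboolP[Tlin [M TM]] := valP T; have /asboolP[Slin [N SN]] := valP S.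
apply/asboolP; split=> [c x y /=|]; first by rewrite Slin Tlin.
exists (`|M| * N) => x /=; rewrite -mulrA (le_trans (TM _))//.
apply: (@le_trans _ _ (`|M| * l2norm (S x))); last by rewrite ler_wpM2l.
by rewrite ler_wpM2r ?sqrtr_ge0 ?ler_norm.
Qed.

Let bmul (T S : bop) : bop := Bop (bopM_subproof T S).

Let bop_linear (T : bop) : linear T.
Proof. by have /asboolP[] := valP T. Qed.

Let bmulA : associative bmul. Proof. by move=> T S U; exact: val_inj. Qed.
Let bmul1l : left_id (Bop bop1_subproof) bmul.
Proof. by move=> T; exact: val_inj. Qed.
Let bmul1r : right_id (Bop bop1_subproof) bmul.
Proof. by move=> T; exact: val_inj. Qed.
Let bmulDl : left_distributive bmul +%R.
Proof. by move=> T S U; exact: val_inj. Qed.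
Let bmulDr : right_distributive bmul +%R.
Proof.
move=> T S U; apply: val_inj; apply/funext => x /=.
by have := bop_linear T 1 (S x) (U x); rewrite !scale1r.
Qed.
HB.instance Definition _ :=
  GRing.Zmodule_isPzRing.Build bop bmulA bmul1l bmul1r bmulDl bmulDr.

Definition opnorm (T : bop) : R :=
  sup [set l2norm (T x) | x in [set x | l2norm x <= 1]].

(* The Hilbert space adjoint: the operator [S] below exists and is unique for
   every bounded [T], so the default value 0 is never used. *)
Definition adj (T : bop) : bop :=
  xget 0 [set S : bop | forall x y : l2, inner (T x) y = inner x (S y)].
End BoundedOperators.


(* [A] is meant to be a norm-closed *-subalgebra of [B(l^2(I))] that contains
   the identity operator. *)
Section KTheory.
Variables (R : realType) (I : choiceType) (A : set (bop R I)).
Local Notation B := (bop R I).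

Definition adjmx m n (M : 'M[B]_(m, n)) : 'M[B]_(n, m) := map_mx (@adj R I) M^T.

Definition mx_over m n (M : 'M[B]_(m, n)) : Prop := forall i j, A (M i j).

Definition oplus m n (p : 'M[B]_m) (q : 'M[B]_n) : 'M[B]_(m + n) :=
  block_mx p 0 0 q.

Definition is_projection n (p : 'M[B]_n) : Prop :=
  [/\ mx_over p, adjmx p = p & p *m p = p].

Definition is_unitary n (u : 'M[B]_n) : Prop :=
  [/\ mx_over u, adjmx u *m u = 1%:M & u *m adjmx u = 1%:M].

(* P_oo(A) and U_oo(A): disjoint unions over the matrix size [n]. *)
Definition projections : set {n : nat & 'M[B]_n} :=
  [set p | is_projection (projT2 p)].

Definition unitaries : set {n : nat & 'M[B]_n} :=
  [set u | is_unitary (projT2 u)].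

Definition direct_sum (S : set {n : nat & 'M[B]_n}) (p q r : S) : Prop :=
  \val r = existT _ _ (oplus (projT2 (\val p)) (projT2 (\val q))).

Definition murray_von_neumann (p q : projections) : Prop :=
  exists v : 'M[B]_(projT1 (\val q), projT1 (\val p)),
    [/\ mx_over v, adjmx v *m v = projT2 (\val p)
      & v *m adjmx v = projT2 (\val q)].

(* Norm-continuity in M_n(A) is the same as norm-continuity of the entries. *)
Definition homotopic n (u v : 'M[B]_n) : Prop :=
  exists w : R -> 'M[B]_n,
    [/\ w 0 = u, w 1 = v, forall t, 0 <= t <= 1 -> is_unitary (w t) &
      forall (i j : 'I_n) s, 0 <= s <= 1 ->
        opnorm (w t i j - w s i j) @[t --> within `[0, 1] (nbhs s)] --> (0 : R)].

Definition stably_homotopic (u v : unitaries) : Prop :=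
  exists (a b : nat) (e : (projT1 (\val u) + a = projT1 (\val v) + b)%N),
    homotopic (castmx (e, e) (oplus (projT2 (\val u)) (1%:M : 'M[B]_a)))
              (oplus (projT2 (\val v)) (1%:M : 'M[B]_b)).

Definition K0 : zmodType :=
  grothendieck murray_von_neumann (@direct_sum projections).

(* U_oo(A) modulo [stably_homotopic], with [u] + [v] = [u (+) v], is already an
   abelian group, hence is its own Grothendieck group. *)
Definition K1 : zmodType :=
  grothendieck stably_homotopic (@direct_sum unitaries).

End KTheory.

Section ReducedAlgebra.
Variables (R : realType) (G : groupoid).

Definition CcC (f : arrow G -> Cx R) : Prop := continuous f /\ compact (supp f).

(* [T] is the operator of left convolution by [f] on
   l^2(G) = \bigoplus_x l^2(s^-1(x)), that is, the sum over the units x of the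
   regular representations of C_c(G) on l^2(s^-1(x)).  For [f] in C_c(G) the sum
   below has only finitely many nonzero terms. *)
Definition regular_rep (f : arrow G -> Cx R) (T : bop R (arrow G)) : Prop :=
  forall (xi : l2 R (arrow G)) (g : arrow G),
    T xi g = \sum_(h \in [set h | src h = src g]) f (gmul g (ginv h)) * xi h.

(* The reduced norm of [f] is the operator norm of its image, so C*_r(G) is the
   closure of the image of C_c(G) in B(l^2(G)). *)
Definition Cstar_red : set (bop R (arrow G)) :=
  [set T | forall e : R, 0 < e ->
    exists f S, [/\ CcC f, regular_rep f S & opnorm (T - S) < e]].

End ReducedAlgebra.

Definition HK_property (R : realType) (G : etale_groupoid) : Prop :=
  zmod_iso (K0 (@Cstar_red R G)) (dsum (fun k => homology G (2 * k))) /\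
  zmod_iso (K1 (@Cstar_red R G)) (dsum (fun k => homology G (2 * k + 1))).

(* Main.v *)
From HB Require Import structures.
Require Import Defs.
From mathcomp Require Import all_boot all_order all_algebra finmap.
From mathcomp Require Import all_classical all_reals all_analysis.
From mathcomp Require Import complex freeg ring lra zify.
From mathcomp Require summability.

Set Implicit Arguments.
Unset Strict Implicit.
Unset Printing Implicit Defensive.

Import Order.TTheory GRing.Theory Num.Theory numFieldNormedType.Exports.

Local Open Scope classical_set_scope.
Local Open Scope ring_scope.

(** The K0-group of the reduced C*-algebra of the odometer groupoid G has rank
    at least two, while the direct sum of the even homology groups of G has rank
    at most one. An isomorphism between them would carry two independent classes
    to two classes that satisfy a nontrivial integer relation.

    Homology. A compactly supported function on the nerve factors through the
    i-th level for some i, so that it comes from the bar complex of the dihedral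
    group acting on Z/n_i ([CcZ_chain_fun], [delta_chain_fun]). The Cayley graph
    of the dihedral group for two generating reflections is a line. The path in
    it from 1 to g, each edge being taken as itself minus its reverse, is a
    chain with boundary 2(g - 1) that depends on g like a 1-cocycle
    ([dihedral_path_boundary], [dihedral_path_cocycle]). Substituting this path
    for the first vertex of a bar simplex gives a chain homotopy between 2 and 0
    in degrees at least 2 ([bar_homotopyP]), so that the homology in these
    degrees is killed by 2 ([homology_double]). In degree 0, summing over the
    translations by 0, ..., n_i - 1 shows that some positive multiple of every
    class is a multiple of the class of the constant function 1
    ([homology0_rank]).

    K-theory. Let s be the reflection k |-> - k. The projections 1 and (1 + s)/2
    have independent classes in K0 ([K0_rank_two]). They are separated by two
    traces, defined on the convolution operators whose coefficients depend on a
    finite level of X only; these operators are dense in the C*-algebra and form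
    an increasing union of unital *-algebras. The first trace averages the
    restriction of the symbol to the units over Z/n_m ([mean_trace]) and takes
    the values 1 and 1/2. The second one is the sum over all integers k of the
    symbol at the reflection about k and at its fixed point k
    ([reflection_trace]); it takes the values 0 and 1/2. It is bounded on each
    level, by a constant that grows with the level ([reflection_trace_le]): the
    matrix entries from translations to reflections form Toeplitz patterns, and
    a Foelner argument compares the sum along a residue class with a single
    inner product.

    A trace with a bound on each level, which may depend on the level, yields an
    invariant of an idempotent matrix p over the C*-algebra. Let b be an
    approximation of p by a matrix of finite level and let b_m be the m-th
    iterate of x |-> 3x^2 - 2x^3 at b, which has the same level as b and is
    idempotent up to an error of order 2^-m. For two approximations b and c, the
    matrices b_m and c_m are conjugate up to such an error under a matrix 1 - r,
    where r has norm at most 1/2, hence their traces differ by O(2^-m)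
    ([trace_compare]). So the sequence of the traces of the b_m is well defined
    modulo geometrically decaying sequences. It is invariant under Murray-von
    Neumann equivalence, because for matrices w and v of finite level the
    iterates at wv and at vw can be written as wx and xw with the same x
    ([iter_smooth_swap]), and it is additive under direct sums.

    The topological properties of G are read off from the cylinder sets of X,
    each of which contains an integer ([level_basis], [level_ex]). *)

(** * The odometer of the infinite dihedral group *)

Lemma continuous_discreteP (Y : topologicalType) (T : choiceType)
    (f : Y -> discrete_topology T) (x : Y) :
  {for x, continuous f} <-> (\forall y \near x, f y = f x).
Proof. by split=> [/(@discrete_cvg (discrete_topology T))|h]; [exact|exact/discrete_cvg]. Qed.

(** All elements of the dihedral group with translation part congruent to [m]
    modulo [n]: the general left coset of [dihedral_sub n], whatever the
    representative. *)
Definition residue_class (n : nat) (m : int) : set dihedral :=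
  [set u | (n%:Z %| u.1 - m)%Z].

Lemma lcoset_dihedral_sub n g : lcoset g (dihedral_sub n) = residue_class n g.1.
Proof.
apply/seteqP; split=> [_ [[k b] kn <-]|[k b] /= kn].
  by rewrite /residue_class /= addrAC subrr add0r; exact: dvdz_mull.
exists ((-1) ^+ g.2 * (k - g.1), g.2 (+) b).
  by rewrite /dihedral_sub /=; exact: dvdz_mull.
case: g kn => [m a] /= kn; congr (_, _); last by rewrite addKb.
by rewrite mulrA -signr_addb addbb mul1r addrC subrK.
Qed.

Lemma residue_classP n m m' :
  residue_class n m = residue_class n m' <-> (n%:Z %| m - m')%Z.
Proof.
split=> [e|nm].
  have : residue_class n m (m, false) by rewrite /residue_class /= subrr dvdz0.
  by rewrite e.
apply/seteqP; split=> -[k b]; rewrite /residue_class /= => h.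
  by rewrite (_ : k - m' = (k - m) + (m - m')); [exact: rpredD|ring].
by rewrite (_ : k - m = (k - m') - (m - m')); [exact: rpredB|ring].
Qed.

Section DihedralOdometer.
Variable n : nat -> nat.
Hypothesis n_incr : forall i : nat, (n i < n i.+1)%N.
Hypothesis n_dvd : forall i : nat, (n i %| n i.+1)%N.

Local Notation H := (fun i => dihedral_sub (n i)).
Local Notation X := (@odometer dihedral H).

Lemma n_gt0 i : (0 < n i)%N.
Proof.
case: i => [|i]; last exact: leq_ltn_trans (n_incr i).
rewrite lt0n; apply/eqP => n0; have := n_dvd 0; have := n_incr 0.
by rewrite n0 dvd0n => /[swap] /eqP ->.
Qed.

Lemma n_geq i : (i <= n i)%N.
Proof. by elim: i => // i IH; exact: leq_ltn_trans (n_incr i). Qed.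

(** Holds because the [n i] are unbounded. *)
Lemma n_dvd_eq0 (m : int) : (forall i, ((n i)%:Z %| m)%Z) -> m = 0.
Proof.
move=> h; have := h (absz m).+1; rewrite dvdzE /= => /dvdn_leq.
have := n_geq (absz m).+1; case: (posnP (absz m)) => [|m0 h1 /(_ isT) h2].
  by move/eqP; rewrite absz_eq0 => /eqP.
by have := leq_trans h1 h2; rewrite ltnn.
Qed.

(** The i-th coordinate of [x], as a subset of the dihedral group, so that
    values for different points are compared without dependent types. *)
Definition level i (x : X) : set dihedral := \val (\val x i).

Lemma level_inj (x y : X) : (forall i, level i x = level i y) -> x = y.
Proof.
move=> xy; apply: val_inj; apply: functional_extensionality_dep => i.
apply: val_inj; exact: xy.
Qed.

Lemma residue_cosets i (k : int) :
  residue_class (n i) k \in cosets (dihedral_sub (n i)).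
Proof. by apply/mem_set; exists (k, false) => //; rewrite lcoset_dihedral_sub. Qed.

Definition int_coset i (k : int) : cosets (dihedral_sub (n i)) :=
  SigSub (residue_cosets i k).

Lemma int_point_subproof (k : int) : (fun i => int_coset i k) \in X.
Proof. by apply/mem_set => i; exists (k, false); rewrite !lcoset_dihedral_sub. Qed.

(** The image of an integer in the inverse limit of the Z/n_i. *)
Definition int_point (k : int) : X := SigSub (int_point_subproof k).

Lemma level_int_point i k : level i (int_point k) = residue_class (n i) k.
Proof. by []. Qed.

(** A coset is determined by the translation part of any of its elements. *)
Lemma level_ex i (x : X) : exists k, level i x = level i (int_point k).
Proof.
rewrite /level; have /set_mem[[k b] _ /= <-] := valP (\val x i).
by exists k; rewrite lcoset_dihedral_sub.
Qed.

Lemma level_le i j (x y : X) : (i <= j)%N -> level j x = level j y -> level i x = level i y.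
Proof.
move/subnK <-; elim: (_ - _)%N => // k IH; rewrite addSn => e; apply: IH; move: e.
have /set_mem/(_ (k + i)%N)[g [gx1 gx0]] := valP x.
have /set_mem/(_ (k + i)%N)[h [hy1 hy0]] := valP y.
have -> : level (k + i).+1 x = residue_class (n (k + i).+1) g.1.
  by rewrite -lcoset_dihedral_sub; exact: gx1.
have -> : level (k + i).+1 y = residue_class (n (k + i).+1) h.1.
  by rewrite -lcoset_dihedral_sub; exact: hy1.
have -> : level (k + i) x = residue_class (n (k + i)) g.1.
  by rewrite -lcoset_dihedral_sub; exact: gx0.
have -> : level (k + i) y = residue_class (n (k + i)) h.1.
  by rewrite -lcoset_dihedral_sub; exact: hy0.
move=> /residue_classP d; apply/residue_classP.
by apply: dvdz_trans d; rewrite dvdzE /=; exact: n_dvd.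
Qed.

Local Notation PX := (prod_topology (fun i => discrete_topology (cosets (H i)))).
Local Notation act := (@odometer_action dihedral H).

(** The affine action of the dihedral group on the integers, for which
    [int_point] is equivariant. *)
Definition int_act (g : dihedral) (k : int) : int := g.1 + (-1) ^+ g.2 * k.

Lemma int_actM g h k : int_act (g * h)%g k = int_act g (int_act h k).
Proof.
by case: g h => [a b] [c d]; rewrite /int_act /= mulrDr addrA signr_addb mulrA.
Qed.

Lemma int_act1 k : int_act 1%g k = k.
Proof. by rewrite /int_act /= add0r mul1r. Qed.

Lemma level_act i g x : level i (act g x) = lcoset g (level i x).
Proof. by []. Qed.

Lemma act_int_point g k : act g (int_point k) = int_point (int_act g k).
Proof.
apply: level_inj => i; rewrite level_act !level_int_point.
rewrite -(lcoset_dihedral_sub _ (k, false)) -lcosetM lcoset_dihedral_sub.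
by case: g.
Qed.

Lemma level_act_eq i g x y : level i x = level i y -> level i (act g x) = level i (act g y).
Proof. by rewrite !level_act => ->. Qed.

Lemma coord_continuous i :
  continuous (fun y : X => \val y i : discrete_topology (cosets (H i))).
Proof.
move=> x; apply: (@continuous_comp _ _ _ (\val : X -> PX) (fun x => x i)).
  exact: (@initial_continuous _ PX (\val : X -> PX)).
exact: (@proj_continuous _ (fun i => discrete_topology (cosets (H i)))).
Qed.

Lemma near_coord i (x : PX) : \forall y \near x, y i = x i.
Proof.
apply: (continuous_discreteP (fun y : PX => y i) x).1.
exact: (@proj_continuous _ (fun i => discrete_topology (cosets (H i)))).
Qed.

Lemma level_cst i (x : X) : \forall y \near x, level i y = level i x.
Proof.
have /continuous_discreteP h := @coord_continuous i x.
by apply: filterS h => y /= e; exact: (congr1 (fun C => \val C) e).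
Qed.

(** The product topology is generated by the coordinates, and each coordinate
    determines the previous ones. *)
Lemma level_basis (x : X) (U : set X) : nbhs x U ->
  exists i, forall y, level i y = level i x -> U y.
Proof.
rewrite nbhsE => -[W [[V oV VW] Wx] WU].
pose F : set_system PX := [set A : set PX |
  exists i, forall y : X, level i y = level i x -> A (\val y)].
have FF : Filter F.
  split; first by exists 0%N.
  - move=> A B [i iA] [j jB]; exists (maxn i j) => y e; split.
      by apply: iA; exact: level_le (leq_maxl _ _) e.
    by apply: jB; exact: level_le (leq_maxr _ _) e.
  - by move=> A B AB [i iA]; exists i => y /iA/AB.
have Fx : F --> (\val x : PX).
  apply/cvg_sup => i A; rewrite nbhsE => -[B [[C _ CB] Bx] BA].
  exists i => y e; apply: BA; move: Bx; rewrite -CB /=.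
  suff -> : \val x i = \val y i by [].
  by apply: val_inj.
have [i iV] : F V.
  apply: Fx; apply: open_nbhs_nbhs; split => //.
  by have : (\val @^-1` V) x by rewrite VW.
exists i => y /iV; by rewrite -[V _]/((\val @^-1` V) y) VW => /WU.
Qed.

Lemma cosets_finite i : finite_set [set: discrete_topology (cosets (H i))].
Proof.
apply: (@sub_finite_set _ _ ((fun k : nat => int_coset i k%:Z) @` `I_(n i))); last first.
  by apply: finite_image; exact: finite_II.
move=> C _; have /set_mem[[k b] _ /= kC] := valP C.
have ni0 : (n i)%:Z != 0 by have := n_gt0 i; lia.
exists (absz (k %% (n i)%:Z)%Z) => /=.
  by have := ltz_mod k ni0; have := modz_ge0 k ni0; lia.
apply: val_inj; rewrite /= -kC lcoset_dihedral_sub.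
apply/residue_classP => /=; rewrite gez0_abs ?modz_ge0//.
by rewrite -opprB rpredN {1}(divz_eq k (n i)%:Z) addrK dvdz_mull.
Qed.

(** X is closed in the product of the finite coset spaces, which is compact by
    the theorem of Tychonoff. *)
Lemma odometer_compact : compact [set: X].
Proof.
have cP := tychonoff (fun i => finite_compact (cosets_finite i)).
set P := [set f | _] in cP.
have clX : closed (X : set PX).
  rewrite closedE => x nx i; apply: contrapT => nex; apply: nx.
  have hl j : \forall y \near (x : PX), y j = x j := near_coord j x.
  have Fx := nbhs_filter (x : PX).
  apply: filterS2 (hl i.+1) (hl i) => y y1 y0 /(_ i)[g [g1 g0]]; apply: nex.
  by exists g; rewrite -y1 -y0.
have cX : compact (X : set PX).
  by apply: (subclosed_compact clX cP) => x _ i.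
move=> F PF _.
have GP : ProperFilter (\val @ F) by exact: fmap_proper_filter.
have [|x [Xx cx]] := cX (\val @ F) GP.
  have FT : F [set: X] by exact: filterT.
  have S : [set: X] `<=` (fun y : X => (\val y : PX)) @^-1` X.
    by move=> -[y yX] _; exact: (set_mem yX).
  exact: (filterS S FT).
exists (SigSub (mem_set Xx)); split => // A B FA /level_basis[i iB].
have [||u [Au]] := cx ((fun y : X => (\val y : PX)) @` A) [set y | y i = x i].
- have S : A `<=` (fun y : X => (\val y : PX)) @^-1` ((fun y : X => (\val y : PX)) @` A).
    by move=> y Ay; exists y.
  exact: (filterS S FA).
- exact: near_coord.
- move: Au => [y Ay <-] /= yx; exists y; split => //; apply: iB.
  exact: (congr1 (fun C => \val C) yx).
Qed.

(** By compactness, one level serves for an entire neighbourhood assignment. *)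
Lemma uniform_level (U : X -> set X) :
  (forall x, nbhs x (U x)) ->
  exists i, forall x, exists x', forall y, level i y = level i x -> U x' y.
Proof.
move=> xU.
have /compact_near_coveringP cX := odometer_compact.
have [|i _ /(_ i (leqnn _)) iP] := cX _ (\oo)
    (fun i x => exists x', forall y, level i y = level i x -> U x' y) _; last first.
  by exists i => x; exact: iP.
move=> x _; have [j jU] := level_basis (xU x).
exists ([set y | level j y = level j x], [set i | (j <= i)%N]) => /=.
  by split; [exact: level_cst|exists j].
move=> [y i] [/= yx ji]; exists x => z zy; apply: jU.
by rewrite -yx; exact: level_le zy.
Qed.

Lemma locally_constant_level (T : choiceType) (f : X -> discrete_topology T) :
  continuous f -> exists i, forall x y, level i x = level i y -> f x = f y.
Proof.
move=> fc; have [|i iP] := @uniform_level (fun x => [set y | f y = f x]).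
  by move=> x; have /continuous_discreteP := fc x.
by exists i => x y xy; have [z zP] := iP y; rewrite (zP x)// (zP y).
Qed.

Lemma odometer_hausdorff : hausdorff_space X.
Proof.
move=> x y cl; apply: level_inj => i.
by have [z [/= <- <-]] := cl _ _ (level_cst i x) (level_cst i y).
Qed.

Lemma odometer_zero_dimensional : zero_dimensional X.
Proof.
move=> x y /eqP xy; have [i ixy] : exists i, level i x <> level i y.
  by apply: contrapT => /forallNP h; apply: xy; apply: level_inj => i; apply: contrapT; exact: h.
exists [set z | level i z = level i x]; split => //; last by move=> /= e; exact: ixy.
split; first by rewrite openE => z /= <-; exact: level_cst.
by rewrite closedE => z nz; apply: contrapT => zx; apply: nz; apply: filterS (level_cst i z) => u /= ->.
Qed.

(** An isolated point would be represented by two integers whose difference is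
    some [n i]. *)
Lemma odometer_perfect : perfect_set [set: X].
Proof.
apply/perfectTP => x o1; have /level_basis[i iP] : nbhs x [set x].
  by apply: open_nbhs_nbhs; split.
have [k kx] := level_ex i x.
have e1 := iP _ (esym kx).
have e2 : int_point (k + (n i)%:Z) = x.
  by apply: iP; rewrite kx !level_int_point; apply/residue_classP; rewrite addrC addKr dvdzz.
have : (n i)%:Z = 0.
  apply: n_dvd_eq0 => j; have := e2; rewrite -e1 => /(congr1 (level j)).
  by rewrite !level_int_point => /residue_classP; rewrite addrC addKr.
by have := n_gt0 i; lia.
Qed.

Lemma odometer_cantor_like : cantor_like X.
Proof.
split; [exact: odometer_perfect|exact: odometer_compact|exact: odometer_hausdorff|].
exact: odometer_zero_dimensional.
Qed.
End DihedralOdometer.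

(** * Topology and dynamics of the groupoid *)

(** The pointed structure required by [homeomorphism_cantor_like] is packed for an
    arbitrary pseudometric space, where unification has no concrete structure
    to unfold. *)
Lemma cantor_like_homeomorphic (R : realType) (P : pseudoMetricType R) (A : set P) (a : A) :
  cantor_like A -> homeomorphic A cantor_space.
Proof.
pose Xp := HB.pack_for (pseudoPMetricType R) (set_type A) (isPointed.Build (set_type A) a).
move=> cl; have [f [fc fclosed]] := @homeomorphism_cantor_like R Xp cl.
have : bijective f by rewrite -setTT_bijective; exact: bij.
case=> g gK fK; exists g, f; split => //.
apply/continuous_closedP => B cB.
suff -> : g @^-1` B = f @` B by exact: fclosed.
apply/seteqP; split=> [x Bx|_ [z Bz <-]]; first by exists (g x).
by rewrite /preimage /= gK.
Qed.

Lemma cantor_like_homeomorphic_prod (R : realType) (T : nat -> choiceType)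
    (A : set (prod_topology (fun i => discrete_topology (T i)))) (a : A) :
  cantor_like A -> homeomorphic A cantor_space.
Proof.
exact: (@cantor_like_homeomorphic R
  (prod_topology (fun i => discrete_topology (T i))) A a).
Qed.

Section DihedralGroupoid.
Variable n : nat -> nat.
Hypothesis n_incr : forall i : nat, (n i < n i.+1)%N.
Hypothesis n_dvd : forall i : nat, (n i %| n i.+1)%N.

Local Notation H := (fun i => dihedral_sub (n i)).
Local Notation X := (@odometer dihedral H).
Local Notation act := (@odometer_action dihedral H).
Local Notation G := (transformation_etale_groupoid act).
Local Notation level_le := (level_le n_dvd).
Local Notation level_basis := (level_basis n_dvd).

Lemma near_arrow (p : arrow G) i :
  \forall q \near p, q.1 = p.1 /\ level i q.2 = level i p.2.
Proof.
apply: filterI; first exact: (@near_fst dihedral X p).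
have c : {for p, continuous (snd : tarrow dihedral X -> X)} by exact: cvg_snd.
exact: (c _ (level_cst i p.2)).
Qed.

Lemma arrow_basis (p : arrow G) (U : set (arrow G)) : nbhs p U ->
  exists i, forall q, q.1 = p.1 -> level i q.2 = level i p.2 -> U q.
Proof.
case: p => g x [[V W] /= [Vg Wx] VWU]; have [i iW] := level_basis Wx.
exists i => -[h y] /= hg yx; apply: VWU; split => /=; last exact: iW.
by rewrite hg; exact: nbhs_singleton Vg.
Qed.

(** Translations act transitively on each level. *)
Lemma dihedral_minimal : minimal G.
Proof.
move=> x U [y Uy] oU.
have [i iU] := level_basis (open_nbhs_nbhs (conj oU Uy)).
have [k xk] := level_ex i x; have [l yl] := level_ex i y.
pose g : dihedral := (l - k, false).
have lg : level i (act g x) = level i y.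
  rewrite yl -(level_act_eq g (esym xk)) act_int_point //.
  by congr (level i (int_point _ _)); rewrite /int_act /= mul1r subrK.
exists (act g x); split; first exact: iU.
by exists ((g, x) : arrow G).
Qed.

(** An arrow [(g, x)] in the interior of the isotropy fixes a whole residue
    class of integers, but an affine map other than the identity fixes at most
    one integer. *)
Lemma dihedral_essentially_principal : essentially_principal G.
Proof.
apply/seteqP; split=> [[g x]|_ [x _ <-]]; last first.
  have S : [set q : arrow G | q.1 = 1%g] `<=` [set g : arrow G | rng g = src g].
    by move=> [h y] /= ->; exact: (act1 act).
  exact: (filterS S (@near_fst dihedral X (1%g, x))).
move=> /arrow_basis[i iP]; suff -> : g = 1%g by exists x.
have fx k : level i (int_point n k) = level i x -> int_act g k = k.
  move=> kx; have gk := iP (g, int_point n k) erefl kx.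
  apply/eqP; rewrite -subr_eq0; apply/eqP; apply: (n_dvd_eq0 n_incr) => j.
  apply/residue_classP; rewrite -!(level_int_point n) -act_int_point//.
  exact: congr1 gk.
have [k xk] := level_ex i x.
have e1 := fx k (esym xk).
have e2 : int_act g (k + (n i)%:Z) = k + (n i)%:Z.
  apply: fx; rewrite xk !level_int_point; apply/residue_classP.
  by rewrite addrC addKr dvdzz.
have ni := n_gt0 n_incr n_dvd i.
move: g e1 e2 {iP fx} => [m [|]]; rewrite /int_act /= ?expr1 ?expr0.
  by move=> e1 e2; exfalso; lia.
by rewrite mul1r => e1 _; congr (_, _); lia.
Qed.

(** The basis consists of the sets given by an element of the group and a coset
    of some level, so that it is countable. *)
Lemma dihedral_second_countable : @second_countable (arrow G).
Proof.
pose B (t : int * bool * nat * int) : set (arrow G) :=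
  [set q | q.1 = t.1.1 /\ level t.1.2 q.2 = residue_class (n t.1.2) t.2].
exists (range B); first exact: card_le_trans (card_image_le _ _) (countableP _).
split=> [_ [[[g i] k] _ <-]|p U].
  rewrite openE => p [/= pg pk]; apply: filterS (near_arrow p i) => q [q1 q2].
  by split; [exact: etrans q1 pg|exact: etrans q2 pk].
move=> pU; have [i iU] := arrow_basis pU.
have [k pk] := level_ex i p.2.
exists (B (p.1, i, k)); last by move=> q [/= q1 q2]; apply: iU => //; rewrite q2 pk.
by split; [exists (p.1, i, k)|split].
Qed.

Lemma unit_space_cantor (R : realType) : homeomorphic (unit_space G) cantor_space.
Proof.
apply: (@cantor_like_homeomorphic_prod R (fun i => cosets (H i)) X (int_point n 0)).
exact: odometer_cantor_like.
Qed.
End DihedralGroupoid.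

(** * A chain homotopy on the bar complex *)

Definition gen (K : choiceType) (x : K) : {freeg K} := << x >>.

Section ZLift.
Variables (K : choiceType) (V : zmodType).
Implicit Types (f : K -> V) (D : {freeg K}).

(** The extension of [f] by additivity to the free abelian group. *)
Definition zlift f D : V := \sum_(x <- dom D) f x *~ coeff x D.

Lemma zliftE f D (r : seq K) : uniq r -> {subset dom D <= r} ->
  zlift f D = \sum_(x <- r) f x *~ coeff x D.
Proof.
move=> ur sr; rewrite [RHS](bigID (mem (dom D))) /= [X in _ = _ + X]big1 ?addr0.
  rewrite -big_filter; apply: perm_big; apply: uniq_perm.
  - exact: uniq_dom.
  - exact: filter_uniq.
  - by move=> x; rewrite mem_filter; case: (boolP (x \in dom D)) => //= /sr ->.
by move=> x xD; rewrite coeff_outdom.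
Qed.

Lemma zlift_is_additive f : zmod_morphism (zlift f).
Proof.
move=> D E; pose r := undup (dom (D - E) ++ dom D ++ dom E).
rewrite !(@zliftE _ _ r) ?undup_uniq//; try by move=> x xD; rewrite mem_undup !mem_cat xD ?orbT.
by rewrite -sumrB; apply: eq_bigr => x _; rewrite coeffB mulrzBr.
Qed.
HB.instance Definition _ f :=
  GRing.isZmodMorphism.Build {freeg K} V (zlift f) (zlift_is_additive f).

Lemma zliftU f x : zlift f (gen x) = f x.
Proof. by rewrite /zlift domU1 big_seq1 coeffU eqxx mulr1. Qed.

Lemma freeg_sumz D : D = \sum_(x <- dom D) gen x *~ coeff x D.
Proof.
rewrite -{1}(freeg_sumE D); apply: eq_bigr => x _.
by rewrite /gen freegU_mulz intz.
Qed.

Lemma freeg_ext (F E : {additive {freeg K} -> V}) :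
  (forall x, F (gen x) = E (gen x)) -> F =1 E.
Proof.
by move=> FE D; rewrite (freeg_sumz D) !raddf_sum; apply: eq_bigr => x _; rewrite !raddfMz FE.
Qed.
End ZLift.

Section BarComplex.
Variables (Gam : groupType) (Y : choiceType) (a : Gam -> Y -> Y).

(** A pair [(g_1 :: ... :: g_m, y)] is the bar simplex with source [y]: the
    chain y, g_m y, g_(m-1) g_m y, and so on. *)
Definition simplex : choiceType := (seq Gam * Y)%type.
Local Notation edge := (Gam * Gam : Type)%type.
Local Notation sgen := (@gen simplex).

Fixpoint bar_face (i : nat) (l : seq Gam) (y : Y) : simplex :=
  match l, i with
  | [::], _ => ([::], y)
  | _ :: l', 0 => (l', y)
  | [:: g], _.+1 => ([::], a g y)
  | g :: (h :: l'') as l', i'.+1 =>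
      if i' is 0 then ((g * h)%g :: l'', y)
      else let r := bar_face i' l' y in (g :: r.1, r.2)
  end.

Lemma bar_faceS i g h l y : bar_face i.+2 (g :: h :: l) y =
  (g :: (bar_face i.+1 (h :: l) y).1, (bar_face i.+1 (h :: l) y).2).
Proof. by []. Qed.
Arguments bar_face : simpl never.

Definition bar_boundary (w : simplex) : {freeg simplex} :=
  \sum_(i < (size w.1).+1) sgen (bar_face i w.1 w.2) *~ (-1) ^+ i.

Local Notation bar_d := (zlift bar_boundary).

Lemma bar_boundary_cons g h l y :
  bar_boundary (g :: h :: l, y) = sgen (h :: l, y) - sgen ((g * h)%g :: l, y)
    + \sum_(i < (size l).+1) sgen ((g :: (bar_face i.+1 (h :: l) y).1,
                                 (bar_face i.+1 (h :: l) y).2)) *~ (-1) ^+ i.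
Proof.
rewrite /bar_boundary big_ord_recl big_ord_recl expr0 expr1 mulr1z mulrN1z addrA.
congr (_ + _); apply: eq_bigr => i _; rewrite bar_faceS.
by rewrite !exprS !mulN1r opprK.
Qed.

(* A 1-chain [P g] is a combination of ordered pairs of vertices; it plays the role
   of twice a path from 1 to [g]. *)
Variable P : Gam -> {freeg Gam * Gam}.
Hypothesis P_boundary : forall g,
  zlift (fun e : Gam * Gam => gen e.2 - gen e.1 : {freeg Gam}) (P g) =
  (gen g - gen 1%g) *+ 2.
Hypothesis P_cocycle : forall g h,
  P (g * h)%g = P g + zlift (fun e : Gam * Gam => gen ((g * e.1)%g, (g * e.2)%g)) (P h).

Definition path_insert (w : simplex) : {freeg simplex} :=
  if w is (g :: l, y) then
    zlift (fun e : Gam * Gam => sgen ((e.1^-1 * e.2)%g :: (e.2^-1 * g)%g :: l, y)) (P g)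
  else 0.

Arguments path_insert : simpl never.

Definition bar_homotopy (w : simplex) : {freeg simplex} :=
  sgen (1%g :: 1%g :: behead w.1, w.2) *+ 2 - path_insert w.

Local Notation bar_h := (zlift bar_homotopy).

Lemma zlift_comp (K L : choiceType) (V : zmodType) (f : L -> V) (k : K -> {freeg L}) D :
  zlift f (zlift k D) = zlift (fun x => zlift f (k x)) D.
Proof.
apply: (@freeg_ext _ _ (zlift f \o zlift k) (zlift (fun x => zlift f (k x)))) => x /=.
by rewrite !zliftU.
Qed.

Lemma zliftD (K : choiceType) (V : zmodType) (f k : K -> V) D :
  zlift f D + zlift k D = zlift (fun x => f x + k x) D.
Proof. by rewrite /zlift -big_split; apply: eq_bigr => x _; rewrite mulrzDl. Qed.

Lemma zliftN (K : choiceType) (V : zmodType) (f : K -> V) D :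
  - zlift f D = zlift (fun x => - f x) D.
Proof. by rewrite /zlift -sumrN; apply: eq_bigr => x _; rewrite mulNrz. Qed.

Lemma zlift_sumz (K : choiceType) (V : zmodType) m (f : 'I_m -> K -> V) (c : 'I_m -> int) D :
  \sum_i zlift (f i) D *~ c i = zlift (fun x => \sum_i f i x *~ c i) D.
Proof.
rewrite /zlift; under eq_bigr do rewrite mulrz_suml.
rewrite exchange_big; apply: eq_bigr => x _; rewrite mulrz_suml; apply: eq_bigr => i _.
by rewrite -!mulrzA mulrC.
Qed.

Lemma path_insertM g h l y :
  path_insert ((g * h)%g :: l, y) = path_insert (h :: l, y) + zlift (fun e : Gam * Gam =>
    sgen ((e.1^-1 * e.2)%g :: (e.2^-1 * g * h)%g :: l, y)) (P g).
Proof.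
rewrite /path_insert P_cocycle raddfD /= zlift_comp addrC; congr (_ + _).
  congr zlift; apply/funext => e; rewrite zliftU /=.
  by rewrite !invgM !mulgA !mulgVK.
by congr zlift; apply/funext => e; rewrite mulgA.
Qed.

(** The edges of the path replace the first vertex, and the first two faces add
    up to the boundary of the path. Removing the old second vertex leaves the
    path to it in front of the old third one; by the cocycle property it is the
    difference of the paths from the first and from the second vertex to the
    third. *)
Lemma bar_boundary_path_insert g h l y :
  bar_d (path_insert (g :: h :: l, y)) =
    (sgen (1%g :: h :: l, y) - sgen (g :: h :: l, y)) *+ 2
    + (path_insert ((g * h)%g :: l, y) - path_insert (h :: l, y))
    - \sum_(i < (size l).+1) path_insert (g :: (bar_face i.+1 (h :: l) y).1,
                                 (bar_face i.+1 (h :: l) y).2) *~ (-1) ^+ i.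
Proof.
have -> : (sgen (1%g :: h :: l, y) - sgen (g :: h :: l, y) : {freeg simplex}) *+ 2 =
    zlift (fun e : Gam * Gam => sgen ((e.2^-1 * g)%g :: h :: l, y) -
                                sgen ((e.1^-1 * g)%g :: h :: l, y)) (P g).
  have := congr1 (zlift (fun u : Gam => sgen ((u^-1 * g)%g :: h :: l, y) : {freeg simplex}))
    (P_boundary g).
  rewrite zlift_comp raddfMn raddfB /= !zliftU mulVg invg1 mul1g => <-.
  by congr zlift; apply/funext => e; rewrite raddfB /= !zliftU.
rewrite path_insertM addrC [_ + zlift _ _]addrC addrK addrA.
rewrite /path_insert zlift_comp zlift_sumz zliftN !zliftD; congr zlift.
apply/funext => e; rewrite zliftU bar_boundary_cons /=.
rewrite mulgA mulgK [in RHS]addrAC [RHS]addrC; congr (_ + _); rewrite [RHS]addrC.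
rewrite big_ord_recl expr0 mulr1z; congr (_ + _); rewrite -sumrN.
by apply: eq_bigr => i _; rewrite bar_faceS exprS mulN1r mulrNz.
Qed.

(** The faces that remove the third or a later vertex commute with the insertion
    of a path, and the degenerate simplex accounts for the end of the path. *)
Lemma bar_homotopyP w : (1 < size w.1)%N ->
  bar_d (bar_homotopy w) + bar_h (bar_boundary w) = sgen w *+ 2.
Proof.
case: w => [[|g [|h l]] y] // _.
rewrite {1}/bar_homotopy raddfB raddfMn /= zliftU.
rewrite bar_boundary_path_insert [in bar_h _]bar_boundary_cons.
rewrite (raddfD bar_h) (raddfB bar_h) /= !zliftU.
pose F i := sgen (1%g :: 1%g :: (bar_face i.+1 (h :: l) y).1,
                  (bar_face i.+1 (h :: l) y).2) : {freeg simplex}.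
pose S1 := \sum_(i < (size l).+1) F i *~ (-1) ^+ i.
pose S2 := \sum_(i < (size l).+1) path_insert
  (g :: (bar_face i.+1 (h :: l) y).1, (bar_face i.+1 (h :: l) y).2) *~ (-1) ^+ i.
have -> : bar_boundary (1%g :: 1%g :: h :: l, y) = sgen (1%g :: h :: l, y) - S1.
  rewrite bar_boundary_cons mulg1 subrr add0r big_ord_recl expr0 mulr1z; congr (_ + _).
    by rewrite /bar_face /= mul1g.
  by rewrite -sumrN; apply: eq_bigr => i _; rewrite bar_faceS exprS mulN1r mulrNz.
rewrite (_ : bar_h (\sum_i _) = S1 *+ 2 - S2); last first.
  rewrite (raddf_sum bar_h) /= -sumrMnl -sumrB; apply: eq_bigr => i _.
  by rewrite raddfMz /= zliftU mulrzBl !mulr2n mulrzDl.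
rewrite -/S2 /bar_homotopy /=.
move: (path_insert _) (path_insert _) S1 S2 => p1 p2 S1 S2.
move: (sgen _) (sgen _) (sgen _) => A B C; apply/eqP/freeg_eqP => z.
by rewrite !(coeffMn, coeffD, coeffB, coeffN); ring.
Qed.
End BarComplex.
Arguments bar_face : simpl never.
Arguments path_insert : simpl never.

(** * Paths in the Cayley graph of the dihedral group *)

Lemma int_ind_step (P : int -> Prop) :
  P 0 -> (forall k, P k <-> P (k + 1)) -> forall k, P k.
Proof.
move=> P0 PS; case=> m; elim: m => [|m IH] //.
- by rewrite -addn1 PoszD; exact: (PS _).1.
- exact: (PS _).2.
- by apply: (PS _).2; rewrite (_ : Negz m.+1 + 1 = Negz m)// !NegzE; lia.
Qed.

(** The discrete primitive of [e] that vanishes at 0, also for negative [k]. *)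
Definition int_sum (V : zmodType) (e : int -> V) (k : int) : V :=
  match k with
  | Posz m => \sum_(i < m) e i%:Z
  | Negz m => - \sum_(i < m.+1) e (- i.+1%:Z)
  end.

Lemma int_sumS (V : zmodType) (e : int -> V) k : int_sum e (k + 1) = int_sum e k + e k.
Proof.
case: k => [m|[|m]].
- by rewrite -PoszD addn1 /= big_ord_recr.
- by rewrite /= big_ord0 big_ord1 addNr.
rewrite (_ : Negz m.+1 + 1 = Negz m); last by rewrite !NegzE; lia.
by rewrite /= [in RHS]big_ord_recr opprD /= NegzE addrNK.
Qed.

(* The dihedral group acts simply transitively on the vertices of its Cayley
   graph for the generators (0, 1) and (1, 1), which is a line: [vertex]
   enumerates the line and [position] is its inverse. *)
Definition position (g : dihedral) : int := 2 * g.1 - g.2%:Z.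

Definition vertex (k : int) : dihedral :=
  if (2 %| k)%Z then ((k %/ 2)%Z, false) else (((k + 1) %/ 2)%Z, true).

Lemma positionK : cancel position vertex.
Proof.
by move=> [m [|]]; rewrite /position /vertex /=; case: ifP => h; congr (_, _); lia.
Qed.

Lemma vertexK : cancel vertex position.
Proof. by move=> k; rewrite /position /vertex; case: ifP => /= h; lia. Qed.

(** The action of the dihedral group on its Cayley graph, in terms of
    positions. *)
Definition line_act (g : dihedral) (k : int) : int :=
  2 * g.1 + (if g.2 then - 1 - k else k).

Lemma mul_vertex g k : (g * vertex k)%g = vertex (line_act g k).
Proof.
rewrite -[LHS]positionK; congr vertex; rewrite /line_act -{2 3}(vertexK k).
by case: g (vertex k) => [m [|]] [p [|]]; rewrite /position /= ?expr1 ?expr0; lia.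
Qed.

(** An edge minus its reverse; the antisymmetry makes the choice of directions
    compatible with reflections, at the price of the factor 2 in the
    boundary. *)
Definition edge_cycle (k : int) : {freeg dihedral * dihedral} :=
  gen (vertex k, vertex (k + 1)) - gen (vertex (k + 1), vertex k).

Definition dihedral_path (g : dihedral) : {freeg dihedral * dihedral} :=
  int_sum edge_cycle (position g).

Lemma dihedral_path_boundary g :
  zlift (fun e : dihedral * dihedral => gen e.2 - gen e.1 : {freeg dihedral})
    (dihedral_path g) = (gen g - gen 1%g) *+ 2.
Proof.
rewrite /dihedral_path -{2}(positionK g); elim/int_ind_step: (position g) => [|k].
  by rewrite /= big_ord0 raddf0 subrr mul0rn.
rewrite int_sumS raddfD /=.
have -> : zlift (fun e : dihedral * dihedral => gen e.2 - gen e.1 : {freeg dihedral}) (edge_cycle k) =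
    gen (vertex (k + 1)) - gen (vertex k) - (gen (vertex k) - gen (vertex (k + 1))).
  by rewrite /edge_cycle raddfB /= !zliftU.
set A := zlift _ _; move: (gen (vertex k)) (gen (vertex (k + 1))) (gen 1%g) => B C D.
have -> : (C - D) *+ 2 = (B - D) *+ 2 + (C - B - (B - C)).
  by apply/eqP/freeg_eqP => z; rewrite !(coeffMn, coeffD, coeffB, coeffN); ring.
by split=> [->|/addIr].
Qed.

(** A group element maps edges of the line to edges, and reversing the direction
    of the line only changes the order of summation. *)
Lemma dihedral_path_cocycle g h : dihedral_path (g * h)%g = dihedral_path g +
  zlift (fun e : dihedral * dihedral => gen ((g * e.1)%g, (g * e.2)%g)) (dihedral_path h).
Proof.
rewrite /dihedral_path -{1}(positionK h) mul_vertex vertexK.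
elim/int_ind_step: (position h) => [|k].
  rewrite /= big_ord0 raddf0 addr0 /position /line_act.
  by congr int_sum; case: g.2; lia.
rewrite int_sumS raddfD /= addrA.
have -> : int_sum edge_cycle (line_act g (k + 1)) = int_sum edge_cycle (line_act g k) +
    zlift (fun e : dihedral * dihedral => gen ((g * e.1)%g, (g * e.2)%g)) (edge_cycle k).
  rewrite /edge_cycle raddfB /= !zliftU /= !mul_vertex.
  case: g => m [|]; rewrite /line_act /=.
    rewrite (_ : 2 * m + (-1 - k) = 2 * m + (-1 - (k + 1)) + 1); last by lia.
    rewrite int_sumS -[LHS]addr0 -addrA; congr (_ + _).
    by rewrite /edge_cycle -[X in _ = _ + X]opprB subrr.
  by rewrite addrA int_sumS.
by split=> [->|/addIr].
Qed.

(** * The nerve of a transformation groupoid *)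

Section BarFaceMap.
Variables (Gam : groupType) (Y Z : choiceType) (a : Gam -> Y -> Y) (b : Gam -> Z -> Z).
Variable q : Y -> Z.
Hypothesis qP : forall g y, q (a g y) = b g (q y).

Lemma bar_face_map i l y :
  bar_face b i l (q y) = ((bar_face a i l y).1, q (bar_face a i l y).2).
Proof.
elim: l i => [|g [|h l] IH] [|[|i]] //; first by rewrite /bar_face /= qP.
  by rewrite /bar_face /= qP.
by rewrite !bar_faceS IH.
Qed.
End BarFaceMap.

Lemma bar_face_word (Gam : groupType) (Y Z : choiceType) (a : Gam -> Y -> Y) (b : Gam -> Z -> Z)
  i l y z : (bar_face a i l y).1 = (bar_face b i l z).1.
Proof. by elim: l i => [|g [|h l] IH] [|[|i]] //; rewrite !bar_faceS /= IH. Qed.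

Section BarFaceTheory.
Variables (Gam : groupType) (Y : choiceType) (a : Gam -> Y -> Y).

Lemma bar_face_size i l y : size (bar_face a i l y).1 = (size l).-1.
Proof.
elim: l i => [|g [|h l] IH] [|[|i]] //.
by rewrite bar_faceS /= IH.
Qed.

Lemma nth_bar_face i l y j : (j.+1 < size l)%N ->
  nth 1%g (bar_face a i l y).1 j =
    if (j.+1 < i)%N then nth 1%g l j
    else if j.+1 == i then (nth 1%g l j * nth 1%g l j.+1)%g else nth 1%g l j.+1.
Proof.
elim: l i j => [|g [|h l] IH] [|[|i]] [|j] //= jl; rewrite ?bar_faceS //=.
by rewrite IH.
Qed.

Lemma bar_face_src i l y : (0 < size l)%N -> (i <= size l)%N ->
  (bar_face a i l y).2 = if i == size l then a (last 1%g l) y else y.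
Proof.
elim: l i => [|g [|h l] IH] [|[|i]] //_ il; rewrite ?bar_faceS /= ?IH //.
Qed.

Lemma bar_face_inj i l x y : (forall z, a 1%g z = z) ->
  (forall g h z, a (g * h)%g z = a g (a h z)) -> (0 < size l)%N -> (i <= size l)%N ->
  (bar_face a i l x).2 = (bar_face a i l y).2 -> x = y.
Proof.
move=> a1 aM l0 il; rewrite !bar_face_src//; case: ifP => // _ e.
by have := congr1 (a (last 1%g l)^-1%g) e; rewrite -!aM mulVg !a1.
Qed.

Lemma bar_face_surj i l z : (forall z, a 1%g z = z) ->
  (forall g h z, a (g * h)%g z = a g (a h z)) -> (0 < size l)%N -> (i <= size l)%N ->
  exists x, (bar_face a i l x).2 = z.
Proof.
move=> a1 aM l0 il; exists (if i == size l then a (last 1%g l)^-1%g z else z).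
by rewrite bar_face_src//; case: (i == size l); rewrite // -aM mulgV a1.
Qed.

Lemma bar_boundary_size (w : seq Gam * Y) v : size v.1 != (size w.1).-1 ->
  coeff v (bar_boundary a w) = 0.
Proof.
move=> vw; rewrite /bar_boundary raddf_sum big1 // => i _; rewrite raddfMz /=.
rewrite /gen coeffU (_ : (bar_face a i w.1 w.2 == v) = false) ?mulr0 ?mul0rz //.
by apply: contraNF vw => /eqP <-; rewrite bar_face_size.
Qed.
End BarFaceTheory.

Section Nerve.
Variables (Gam : groupType) (X : topologicalType) (a : action Gam X).
Local Notation G := (transformation_etale_groupoid a).

Definition nerve_word n : nerve G n -> seq Gam :=
  match n return nerve G n -> seq Gam with
  | 0 => fun=> [::]
  | m.+1 => fun w => [seq (\val w j).1 | j <- enum 'I_m.+1]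
  end.

Definition nerve_src n : nerve G n -> X :=
  match n return nerve G n -> X with
  | 0 => fun x => x
  | m.+1 => fun w => (\val w ord_max).2
  end.

Lemma size_nerve_word n (w : nerve G n) : size (nerve_word w) = n.
Proof. by case: n w => // m w; rewrite size_map size_enum_ord. Qed.

Lemma nth_nerve_word m (w : nerve G m.+1) (j : 'I_m.+1) :
  nth 1%g (nerve_word w) j = (\val w j).1.
Proof. by rewrite (nth_map ord0) ?size_enum_ord// nth_ord_enum. Qed.

Lemma nerve_composable m (w : nerve G m.+1) (i j : 'I_m.+1) : j = i.+1 :> nat ->
  (\val w i).2 = a (\val w j).1 (\val w j).2.
Proof. by have /set_mem wC := valP w; exact: wC. Qed.

Lemma nerve_word_src_inj n (v w : nerve G n) :
  nerve_word v = nerve_word w -> nerve_src v = nerve_src w -> v = w.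
Proof.
case: n v w => [|m] v w //= vw vws; apply: val_inj; apply/funext => j.
have e1 (i : 'I_m.+1) : (\val v i).1 = (\val w i).1 by rewrite -!nth_nerve_word /= vw.
suff e2 k (i : 'I_m.+1) : (i + k = m)%N -> (\val v i).2 = (\val w i).2.
  have := e2 (m - j)%N j; rewrite subnKC -1?ltnS// => /(_ erefl).
  by move: (e1 j); case: (\val v j) (\val w j) => [? ?] [? ?] /= -> ->.
elim: k i => [|k IH] i ik.
  by have -> : i = ord_max by apply: val_inj => /=; lia.
have im : (i.+1 < m.+1)%N by lia.
rewrite !(@nerve_composable _ _ i (Ordinal im))// e1 IH//.
by rewrite /=; lia.
Qed.

Definition word_act (l : seq Gam) (x : X) : X := foldr a x l.

Lemma mk_nerve_subproof m (l : seq Gam) (x : X) :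
  (fun j : 'I_m.+1 => ((nth 1%g l j, word_act (drop j.+1 l) x) : arrow G))
    \in @composable G m.+1.
Proof.
apply/mem_set => i j ij; rewrite /= /tsrc /trng /= -ij.
case: (ltnP j (size l)) => jl; first by rewrite (drop_nth 1%g jl).
by rewrite nth_default// !drop_oversize ?act1// (leq_trans jl).
Qed.

(** The composable tuple with given group components and source; the unit spaces
    in between are forced. *)
Definition mk_nerve n (l : seq Gam) (x : X) : nerve G n :=
  match n return nerve G n with
  | 0 => x
  | m.+1 => SigSub (mk_nerve_subproof m l x)
  end.

Lemma nerve_word_mk n l x : size l = n -> nerve_word (mk_nerve n l x) = l.
Proof.
case: n => [/size0nil->//|m] lm; apply: (@eq_from_nth _ 1%g).
  by rewrite size_nerve_word.
rewrite size_nerve_word => i im.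
by rewrite (nth_nerve_word (mk_nerve m.+1 l x) (Ordinal im)).
Qed.

Lemma nerve_src_mk n l x : size l = n -> nerve_src (mk_nerve n l x) = x.
Proof. by case: n => // m lm; rewrite /= drop_oversize// lm. Qed.

Lemma nerve_mkK n (w : nerve G n) : mk_nerve n (nerve_word w) (nerve_src w) = w.
Proof.
have sw := size_nerve_word w.
by apply: nerve_word_src_inj; rewrite (nerve_word_mk, nerve_src_mk).
Qed.

(** Under [nerve_word] and [nerve_src] the faces of the nerve become those of
    the bar complex of the action on X. *)
Lemma nerve_face n (i : 'I_n.+2) (w : nerve G n.+1) :
  (nerve_word (face i w), nerve_src (face i w)) =
  bar_face a i (nerve_word w) (nerve_src w).
Proof.
have sw := size_nerve_word w.
rewrite [RHS]surjective_pairing; congr (_, _).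
  apply: (@eq_from_nth _ 1%g); first by rewrite bar_face_size !size_nerve_word.
  rewrite size_nerve_word => j jn; rewrite nth_bar_face ?sw ?ltnS//.
  case: n i w sw jn => [|n] i w sw jn; first by [].
  rewrite (nth_nerve_word (face i w) (Ordinal jn)) /= /face_fun /=.
  have jn2 : (j < n.+2)%N by rewrite ltnW.
  have -> : fintype.lift ord_max (Ordinal jn) = Ordinal jn2.
    by apply: val_inj; rewrite /= /bump; lia.
  have -> : fintype.lift ord0 (Ordinal jn) = Ordinal (jn : j.+1 < n.+2)%N.
    by apply: val_inj; rewrite /= /bump; lia.
  have e1 := nth_nerve_word w (Ordinal jn2).
  have e2 := nth_nerve_word w (Ordinal (jn : j.+1 < n.+2)%N).
  rewrite /= in e1 e2.
  by case: ifP => _; [rewrite -e1|case: ifP => _; rewrite /= -?e1 -e2].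
rewrite bar_face_src ?sw//; last by rewrite -ltnS.
have lw : last 1%g (nerve_word w) = (\val w ord_max).1.
  by rewrite (last_nth 1%g) sw -nth_nerve_word /=.
rewrite lw; case: n i w sw lw => [|n] i w sw lw.
  rewrite /=; have -> : ord_max = ord0 :> 'I_1 by apply: val_inj.
  by case: i => [[|[|]]].
rewrite /= /face_fun /=.
have -> : fintype.lift ord0 ord_max = ord_max :> 'I_n.+2.
  by apply: val_inj; rewrite /= /bump; lia.
have -> : (n.+1 < i)%N = (i == n.+2 :> nat) by have := ltn_ord i; lia.
case: ifP => [_|_]; last by case: ifP.
by rewrite -(@nerve_composable _ w (fintype.lift ord_max ord_max) ord_max)//= /bump; lia.
Qed.

Lemma near_nerve_word n (w : nerve G n) : \forall v \near w, nerve_word v = nerve_word w.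
Proof.
case: n w => [|m] w; first exact: nearW.
have h j : nbhs (\val w j) [set g : arrow G | g.1 = (\val w j).1].
  exact: (@near_fst Gam X (\val w j)).
apply: filterS (nerve_nbhs h) => v vw.
by apply: eq_map => j; exact: vw.
Qed.

Lemma nerve_src_continuous n : continuous (@nerve_src n).
Proof.
case: n => [|m] w; first exact: cvg_id.
apply: (@continuous_comp _ _ _ (fun w : nerve G m.+1 => \val w ord_max) (snd : arrow G -> X)).
  apply: (@continuous_comp _ _ _ (\val : nerve G m.+1 -> prod_topology (fun _ : 'I_m.+1 => arrow G))
    (fun f => f ord_max)).
    exact: initial_continuous.
  exact: (@proj_continuous _ (fun _ : 'I_m.+1 => arrow G)).
exact: cvg_snd.
Qed.

Lemma word_act_continuous l : continuous (word_act l).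
Proof.
elim: l => [|g l IH] x; first exact: cvg_id.
by apply: (@continuous_comp _ _ _ (word_act l) (a g)); [exact: IH|exact: act_continuous].
Qed.

Lemma mk_nerve_continuous n l : continuous (mk_nerve n l).
Proof.
case: n => [|m] x; first exact: cvg_id.
move: x; apply: continuous_comp_initial; apply: prod_continuous => j x.
apply: tarrow_cvg; first exact: nearW.
exact: word_act_continuous.
Qed.
End Nerve.

(** * Homology of the odometer groupoid *)

Lemma quot_pi_eq0 (V : zmodType) (I : zmodClosed V) (v : V) :
  (\pi_(Quotient.quot I)%qT v = 0) <-> v \in I.
Proof.
have <- : (\pi_(Quotient.quot I) 0 = 0)%qT by rewrite raddf0.
by rewrite -{2}(subr0 v) Quotient.idealrBE; split=> /eqP.
Qed.

Lemma quot_pi_ex (V : zmodType) (I : zmodClosed V) (u : Quotient.quot I) :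
  exists v : V, u = (\pi_(Quotient.quot I) v)%qT.
Proof. by exists (repr u); rewrite reprK. Qed.

Lemma freeg_rect_dom (K : choiceType) (P : {freeg K} -> Prop) :
  P 0 -> (forall c d, P c -> P d -> P (c - d)) ->
  forall c, (forall x, x \in dom c -> P (gen x)) -> P c.
Proof.
move=> P0 PB c Pc; have PN d : P d -> P (- d) by rewrite -sub0r; exact: PB.
have PD d e : P d -> P e -> P (d + e) by move=> Pd Pe; rewrite -(opprK e); exact/PB/PN.
rewrite (freeg_sumz c) big_seq; apply: big_ind => // x /Pc Px.
have PM m : P (gen x *+ m) by elim: m => // m IH; rewrite mulrS; exact: PD.
by case: (coeff x c) => m; rewrite ?NegzE ?mulrNz -pmulrn; [|apply: PN]; exact: PM.
Qed.

Lemma supp_discrete (Y : topologicalType) (f : Y -> int) :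
  continuous (f : Y -> discrete_topology int) -> supp f = [set y | f y != 0].
Proof.
move=> fc; apply/esym/closure_id; rewrite closedE => y ny.
have /continuous_discreteP fy := fc y; apply/eqP => f0; apply: ny.
by apply: filterS fy => z /= ->; rewrite f0.
Qed.

Lemma compact_discrete_finite (Y : topologicalType) (T : choiceType)
    (f : Y -> T) (A : set Y) : compact A ->
  (forall y, \forall z \near y, f z = f y) -> finite_set (f @` A).
Proof.
move=> /compact_near_coveringP cA fl.
have totF := @summability.totally_filter T.
have [] := cA _ summability.totally (fun (F : {fset T}) y => f y \in F).
  move=> y _; exists ([set z | f z = f y], [set F : {fset T} | f y \in F]) => /=.
    split; first exact: fl.
    by exists [fset f y]%fset => //= F /fsubsetP; apply; rewrite inE.
  by move=> [z F] [/= -> ].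
move=> F _ /(_ F (fsubset_refl F)) FA.
by apply: sub_finite_set (finite_fset F) => _ [y /FA yF <-].
Qed.

Lemma coset_act1 (Gam : groupType) (A : set Gam) (C : cosets A) : coset_act 1%g C = C.
Proof. by apply: val_inj; exact: lcoset1. Qed.

Lemma coset_actM (Gam : groupType) (A : set Gam) g h (C : cosets A) :
  coset_act (g * h)%g C = coset_act g (coset_act h C).
Proof. by apply: val_inj; exact: lcosetM. Qed.

Lemma sum_periodic (V : zmodType) (F : int -> V) N k : (0 < N)%N ->
  (forall k, F (k + N%:Z) = F k) -> \sum_(j < N) F (j%:Z + k) = \sum_(j < N) F j%:Z.
Proof.
case: N => // N _ FN; elim/int_ind_step: k => [|k].
  by apply: eq_bigr => j _; rewrite addr0.
suff -> : \sum_(j < N.+1) F (j%:Z + (k + 1)) = \sum_(j < N.+1) F (j%:Z + k) by [].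
rewrite big_ord_recr big_ord_recl /= addrC; congr (_ + _).
  by rewrite -[RHS]FN /=; congr F; lia.
by apply: eq_bigr => j _; rewrite /bump /= add1n; congr F; lia.
Qed.

Lemma funMn (T : Type) (V : zmodType) (f : T -> V) k x : (f *+ k) x = f x *+ k.
Proof. by elim: k => // k IH; rewrite !mulrS -IH. Qed.

Lemma funMz (T : Type) (V : zmodType) (f : T -> V) (b : int) x : (f *~ b) x = f x *~ b.
Proof.
case: b => k; first exact: funMn.
by rewrite !NegzE !mulrNz -[RHS]/(- (f x *+ k.+1)) -funMn.
Qed.

Section LevelChains.
Variable n : nat -> nat.
Hypothesis n_incr : forall i : nat, (n i < n i.+1)%N.
Hypothesis n_dvd : forall i : nat, (n i %| n i.+1)%N.

Local Notation H := (fun i => dihedral_sub (n i)).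
Local Notation X := (@odometer dihedral H).
Local Notation act := (@odometer_action dihedral H).
Local Notation G := (transformation_etale_groupoid act).
Local Notation level_le := (level_le n_dvd).

Local Notation Y i := (cosets (dihedral_sub (n i)) : choiceType).
Local Notation cact i := (fun g : dihedral => @coset_act dihedral g (dihedral_sub (n i))).
Local Notation spx i := (simplex dihedral (Y i)).

Definition level_simplex i m (w : nerve G m) : spx i :=
  (nerve_word w, \val (nerve_src w) i).

Lemma level_simplex_face i m (j : 'I_m.+2) (w : nerve G m.+1) :
  level_simplex i (face j w) =
  bar_face (cact i) j (level_simplex i w).1 (level_simplex i w).2.
Proof.
have := bar_face_map (b := cact i) (a := act) (q := fun x : X => \val x i)
  (fun g y => erefl) j (nerve_word w) (nerve_src w).
by rewrite -nerve_face => ->.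
Qed.

(** A chain of level [i] as the function on the nerve whose value at [w] is the
    coefficient of the image of [w]. *)
Definition chain_fun i m (c : {freeg (spx i)}) : nerve G m -> int :=
  fun w => coeff (level_simplex i w) c.

Lemma chain_funB i m c d : @chain_fun i m (c - d) = chain_fun c - chain_fun d.
Proof. by apply/funext => w; rewrite /chain_fun coeffB. Qed.

Lemma near_level_simplex i m (w : nerve G m) :
  \forall v \near w, level_simplex i v = level_simplex i w.
Proof.
have h : \forall v \near w, level i (nerve_src v) = level i (nerve_src w).
  exact: (@nerve_src_continuous _ _ act m w _ (level_cst i (nerve_src w))).
apply: filterS2 (near_nerve_word w) h => v vw vws.
by congr (_, _) => //; apply: val_inj.
Qed.

Lemma level_simplex_mk i m l k : size l = m ->
  level_simplex i (mk_nerve act m l (int_point n k)) = (l, int_coset n i k).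
Proof. by move=> lm; rewrite /level_simplex nerve_word_mk// nerve_src_mk. Qed.

Lemma coset_ex i (y : Y i) : exists k, y = int_coset n i k.
Proof.
have /set_mem[[k b] _ /= yk] := valP y; exists k; apply: val_inj.
by rewrite /= -yk lcoset_dihedral_sub.
Qed.

Lemma chain_fun_CcZ i m c : @chain_fun i m c \in @CcZ (nerve G m).
Proof.
have fc : continuous (@chain_fun i m c : _ -> discrete_topology int).
  move=> w; apply/continuous_discreteP; apply: filterS (near_level_simplex i w) => v.
  by rewrite /chain_fun => ->.
apply/asboolP; split => //.
pose K := \big[setU/set0]_(v <- dom c) (mk_nerve act m v.1 @` [set: X]).
apply: (@subclosed_compact _ _ K); first exact: closed_closure.
  apply: bigsetU_compact => v _; apply: continuous_compact.
    exact/continuous_subspaceT/mk_nerve_continuous.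
  exact: odometer_compact.
rewrite supp_discrete// => w /= cw; rewrite /K -bigcup_seq.
exists (level_simplex i w); first by rewrite /= mem_dom.
by exists (nerve_src w) => //; exact: nerve_mkK.
Qed.

(** The fibre of a face map over [z] meets the support of a generator in at most
    one point, since the words agree and the source is determined by that of
    [z]. *)
Lemma pushforward_chain_gen i m (j : 'I_m.+2) (v : spx i) (z : nerve G m) :
  size v.1 = m.+1 ->
  Defs.pushforward (face j) (@chain_fun i m.+1 (gen v)) z =
  (bar_face (cact i) j v.1 v.2 == level_simplex i z)%:R.
Proof.
move=> vm; rewrite /Defs.pushforward /chain_fun /gen.
have v0 : (0 < size v.1)%N by rewrite vm.
have jv : (j <= size v.1)%N by rewrite vm -ltnS.
have jD w : face j w = z -> v = level_simplex i w ->
    bar_face (cact i) j v.1 v.2 = level_simplex i z.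
  by move=> <- ->; rewrite level_simplex_face.
case: eqP => [e|ne]; last first.
  apply: fsbig1 => w /= wz; rewrite coeffU mul1r.
  by case: eqP => // vw; case: ne; exact: jD wz vw.
have [x xz] := bar_face_surj (nerve_src z) (act1 act) (actM act) v0 jv.
pose w0 := mk_nerve act m.+1 v.1 x.
have w0w : nerve_word w0 = v.1 by rewrite nerve_word_mk.
have w0s : nerve_src w0 = x by rewrite nerve_src_mk.
have fw0 : face j w0 = z.
  have [ew es] : (nerve_word (face j w0), nerve_src (face j w0)) =
      (nerve_word z, nerve_src z).
    rewrite nerve_face w0w w0s [LHS]surjective_pairing xz; congr (_, _).
    exact: etrans (bar_face_word _ (cact i) _ _ _ v.2) (congr1 fst e).
  exact: nerve_word_src_inj ew es.
have vw0 : level_simplex i w0 = v.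
  rewrite /level_simplex w0w w0s [RHS]surjective_pairing; congr (_, _).
  apply: (bar_face_inj (@coset_act1 _ _) (fun g h y => coset_actM g h y) v0 jv).
  have := bar_face_map (b := cact i) (a := act) (q := fun x : X => \val x i)
    (fun g y => erefl) j v.1 x.
  move=> /(congr1 snd) /= ex.
  exact: etrans ex (etrans (congr1 (fun u : X => \val u i) xz) (esym (congr1 snd e))).
rewrite -(@fsbig_widen _ _ _ _ [set w0])/=.
- by rewrite fsbig_set1 coeffU vw0 eqxx mulr1.
- by move=> _ ->.
- move=> w [/= wz w0n]; rewrite coeffU mul1r.
  case: eqP => // vw; exfalso; apply: w0n.
  have ww : @nerve_word _ _ act m.+1 w = v.1 by rewrite vw.
  apply: (@nerve_word_src_inj _ _ act m.+1); first by rewrite ww w0w.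
  rewrite [RHS]w0s; apply: (bar_face_inj (act1 act) (actM act) v0 jv).
  have := congr1 snd (@nerve_face _ _ act m j w); rewrite ww /= wz => <-.
  exact: esym.
Qed.

(** Chains of all degrees live in one free group, so the degree is a condition
    on the support. *)
Definition homogeneous i m (c : {freeg (spx i)}) : Prop :=
  forall v, size v.1 != m -> coeff v c = 0.

Lemma chain_fun0 i m : @chain_fun i m 0 = 0.
Proof. by apply/funext => w; rewrite /chain_fun coeff0. Qed.

Lemma delta_chain_fun i m c : homogeneous m.+1 c ->
  delta (@chain_fun i m.+1 c) = chain_fun (zlift (bar_boundary (cact i)) c).
Proof.
move=> hc; apply: (@freeg_rect_dom (spx i) (fun c => delta (@chain_fun i m.+1 c) =
  chain_fun (zlift (bar_boundary (cact i)) c))) => [|d e IHd IHe|v].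
- by rewrite raddf0 !chain_fun0 delta0.
- by rewrite chain_funB deltaB ?chain_fun_CcZ// IHd IHe raddfB /= chain_funB.
rewrite mem_dom => vc; have vm : size v.1 = m.+1.
  by apply/eqP; apply: contraNT vc => /(hc v) ->.
rewrite zliftU; apply/funext => z.
rewrite /chain_fun /bar_boundary vm raddf_sum; apply: eq_bigr => j _.
by rewrite pushforward_chain_gen// raddfMz /= /gen coeffU mul1r -mulrzr mulrC intz.
Qed.

Lemma homogeneous_zlift i m k (f : spx i -> {freeg (spx i)}) c :
  (forall v, size v.1 = m -> homogeneous k (f v)) ->
  homogeneous m c -> homogeneous k (zlift f c).
Proof.
move=> fk cm v vk; rewrite /zlift raddf_sum big_seq big1 // => u.
rewrite mem_dom raddfMz /= => uc; rewrite fk ?mul0rz//.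
by apply/eqP; apply: contraNT uc => /(cm u) ->.
Qed.

(** Every pair of a word and a coset is the image of a tuple with an integer as
    its source. *)
Lemma chain_fun_eq0 i m c : homogeneous m c -> @chain_fun i m c = 0 -> c = 0.
Proof.
move=> cm c0; apply/eqP/freeg_eqP => -[l y]; rewrite coeff0.
have [lm|lm] := eqVneq (size l) m; last exact: cm.
have [k ->] := coset_ex y.
by have := congr1 (fun f => f (mk_nerve act m l (int_point n k))) c0;
  rewrite /chain_fun level_simplex_mk.
Qed.

(** The support meets finitely many words by compactness, and for each of them
    some level determines the function. *)
Lemma CcZ_chain_fun m (f : nerve G m -> int) : f \in @CcZ (nerve G m) ->
  exists i (c : {freeg (spx i)}), homogeneous m c /\ f = chain_fun c.
Proof.
move=> /asboolP[fc fK].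
have fin := compact_discrete_finite fK (@near_nerve_word _ _ act m).
pose L := fset_set (@nerve_word _ _ act m @` supp f).
have hl l : exists i, forall x y, level i x = level i y ->
    f (mk_nerve act m l x) = f (mk_nerve act m l y).
  apply: (@locally_constant_level n n_incr n_dvd int (fun x => f (mk_nerve act m l x))) => x.
  apply: (@continuous_comp _ _ _ (mk_nerve act m l) (f : _ -> discrete_topology int)).
    exact: mk_nerve_continuous.
  exact: fc.
have [lv lvP] := boolp.choice hl.
pose i := (\max_(l <- L) lv l)%N.
have iP l x y : l \in L -> level i x = level i y ->
    f (mk_nerve act m l x) = f (mk_nerve act m l y).
  move=> lL xy; apply: lvP; apply: level_le xy.
  by rewrite /i (big_fsetD1 l lL) /= leq_maxl.
have [rep repP] := boolp.choice (@coset_ex i).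
pose val_at (v : spx i) := f (mk_nerve act m v.1 (int_point n (rep v.2))).
have Yfin := cosets_finite n_incr n_dvd i.
pose r := [seq (l, y) | l <- L, y <- fset_set [set: Y i]] : seq (spx i).
have ru : uniq r by apply: allpairs_uniq => // -[? ?] [? ?].
pose r' := [seq v <- r | size v.1 == m].
pose c := \sum_(v <- r') gen v *~ val_at v.
have coeffc v : coeff v c = if v \in r' then val_at v else 0.
  rewrite /c raddf_sum; case: ifPn => vr.
    rewrite (bigD1_seq v) ?filter_uniq//= big1 ?addr0.
      by rewrite raddfMz /= /gen coeffU eqxx mulr1 intz.
    by move=> u /negbTE uv; rewrite raddfMz /= /gen coeffU uv mulr0 mul0rz.
  rewrite big_seq big1 // => u ur; rewrite raddfMz /= /gen coeffU.
  by case: eqP => [uv|_]; [rewrite -uv ur in vr|rewrite mulr0 mul0rz].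
exists i, c; split.
  by move=> v vm; rewrite coeffc mem_filter (negbTE vm).
apply/funext => w; rewrite /chain_fun coeffc mem_filter /= size_nerve_word eqxx /=.
have inr : (level_simplex i w \in r) = (nerve_word w \in L).
  apply/allpairsP/idP => [[[l y] [/= lL _ [-> _]]]//|wL].
  exists (nerve_word w, \val (nerve_src w) i); split => //=.
  by rewrite in_fset_set// inE.
rewrite inr; case: ifPn => wL; last first.
  apply/eqP; apply: contraNT wL => fw; rewrite /L in_fset_set// inE.
  by exists w => //; apply: subset_closure.
rewrite /val_at /= -{1}(nerve_mkK w); apply: iP => //.
rewrite level_int_point; exact: (congr1 (fun y => \val y) (repP (\val (nerve_src w) i))).
Qed.

Local Notation bar_h i := (zlift (bar_homotopy dihedral_path) : {freeg (spx i)} -> {freeg (spx i)}).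

Lemma bar_homotopy_homogeneous i m v : size v.1 = m.+1 ->
  homogeneous m.+2 (bar_homotopy dihedral_path (v : spx i)).
Proof.
case: v => [[|g l] y] //= [lm] u um; rewrite /bar_homotopy coeffB coeffMn.
have nu (w : spx i) : size w.1 = m.+2 -> coeff u (gen w) = 0.
  by move=> wm; rewrite /gen coeffU; case: eqP => [wu|]; [rewrite -wu wm eqxx in um|rewrite mulr0].
rewrite nu /= ?lm// mul0rn sub0r /path_insert /zlift raddf_sum big1 ?oppr0// => e _.
by rewrite raddfMz /= nu /= ?lm// mul0rz.
Qed.

Lemma bar_homotopy_chain i m (c : {freeg (spx i)}) : homogeneous m.+2 c ->
  zlift (bar_boundary (cact i)) (bar_h i c) + bar_h i (zlift (bar_boundary (cact i)) c) = c *+ 2.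
Proof.
move=> hc.
apply: (@freeg_rect_dom (spx i) (fun c => zlift (bar_boundary (cact i)) (bar_h i c) +
    bar_h i (zlift (bar_boundary (cact i)) c) = c *+ 2)) => [|d e IHd IHe|v].
- by rewrite !raddf0 addr0 mul0rn.
- by rewrite !raddfB /= mulrnBl -IHd -IHe addrACA opprD.
rewrite mem_dom => vc; have vm : size v.1 = m.+2.
  by apply/eqP; apply: contraNT vc => /(hc v) ->.
rewrite !zliftU; apply: bar_homotopyP; last by rewrite vm.
- exact: dihedral_path_boundary.
- exact: dihedral_path_cocycle.
Qed.

(** A cycle comes from a cycle [c] of some level, and the homotopy exhibits [c
    *+ 2] as a boundary of the same level. *)
Lemma homology_double m (u : homology G m.+2) : u *+ 2 = 0.
Proof.
have [f ->] := quot_pi_ex u; have /andP[fC /asboolP df0] := valP f.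
have [i [c [cm fc]]] := CcZ_chain_fun fC.
rewrite -raddfMn; apply/quot_pi_eq0.
have dc0 : zlift (bar_boundary (cact i)) c = 0.
  apply: (@chain_fun_eq0 i m.+1).
    apply: homogeneous_zlift cm => v vm w wm.
    by rewrite bar_boundary_size// vm.
  by rewrite -delta_chain_fun// -fc.
apply/asboolP; exists (chain_fun (bar_h i c)); first exact: chain_fun_CcZ.
rewrite delta_chain_fun; last first.
  by apply: homogeneous_zlift cm => v vm; exact: bar_homotopy_homogeneous.
have := bar_homotopy_chain cm; rewrite dc0 raddf0 addr0 => ->.
apply/funext => w; rewrite /chain_fun mulr2n coeffD.
have -> : \val (f *+ 2) w = \val f w + \val f w by rewrite mulr2n.
by rewrite fc.
Qed.

Local Notation zdeg := (zlift (fun=> 1 : int)).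

Definition translations i (v : spx i) : {freeg (spx i)} :=
  \sum_(j < n i) gen ([:: (j%:Z, false) : dihedral], v.2).

(** The sum of all points of level [i], listed from [k] on. *)
Definition level_sum i (k : int) : {freeg (spx i)} :=
  \sum_(j < n i) gen ([::], int_coset n i (j%:Z + k)).

Lemma level_sumE i k : level_sum i k = level_sum i 0.
Proof.
rewrite /level_sum.
rewrite (@sum_periodic _ (fun k => gen ([::] : seq dihedral, int_coset n i k)))//.
- by apply: eq_bigr => j _; rewrite addr0.
- exact: n_gt0.
move=> m; congr (gen (_, _)); apply: val_inj; apply/residue_classP.
by rewrite (_ : _ - _ = (n i)%:Z) ?dvdzz//; lia.
Qed.

Lemma chain_fun_level_sum i : @chain_fun i 0 (level_sum i 0) = fun=> 1.
Proof.
apply/funext => x; rewrite /chain_fun /level_simplex /=.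
have [k ->] := @coset_ex i (\val x i); rewrite -(level_sumE i k) /level_sum raddf_sum /=.
have ni := n_gt0 n_incr n_dvd i; rewrite (bigD1 (Ordinal ni))//= add0r /gen coeffU eqxx mulr1.
rewrite big1 ?addr0// => j j0; rewrite coeffU mul1r.
case: eqP => // /(congr1 (fun v : spx i => \val v.2)) /= /residue_classP.
rewrite addrK dvdzE /= => /dvdn_leq.
have jn := ltn_ord j; have : (0 < j)%N by rewrite lt0n -(inj_eq val_inj) in j0 *.
by move=> j1 /(_ j1); lia.
Qed.

(** The translations by 0, ..., n_i - 1 move a point of level [i] once through
    the whole level. *)
Lemma bar_boundary_translations i (c : {freeg (spx i)}) : homogeneous 0 c ->
  zlift (bar_boundary (cact i)) (zlift (@translations i) c) =
  c *+ n i - level_sum i 0 *~ zdeg c.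
Proof.
move=> hc.
apply: (@freeg_rect_dom (spx i) (fun c => zlift (bar_boundary (cact i)) (zlift (@translations i) c) =
  c *+ n i - level_sum i 0 *~ zdeg c)) => [|d e IHd IHe|[l y]].
- by rewrite !raddf0 mul0rn addr0.
- by rewrite !raddfB /= IHd IHe mulrnBl [in LHS]opprD addrACA.
rewrite mem_dom => vc; have vm : size l = 0%N.
  by apply/eqP; apply: contraNT vc => /(hc (l, y)) ->.
rewrite (size0nil vm) !zliftU /translations raddf_sum /= mulr1z.
have [k ->] := coset_ex y; rewrite -(level_sumE i k) /level_sum.
have -> (x : {freeg (spx i)}) : x *+ n i = \sum_(j < n i) x by rewrite sumr_const card_ord.
rewrite -sumrB; apply: eq_bigr => j _.
rewrite zliftU /bar_boundary big_ord_recl big_ord1 expr0 expr1 mulr1z mulrN1z.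
congr (_ - gen (_, _)); apply: val_inj => /=.
rewrite -(lcoset_dihedral_sub _ (k, false)) -lcosetM lcoset_dihedral_sub.
by rewrite /= mul1r.
Qed.

(** A function of level [i], multiplied by [n i], is homologous to a
    constant. *)
Lemma homology0_rank : exists e : homology G 0, forall u : homology G 0,
  exists N c, (0 < N)%N /\ u *+ N = e *~ c.
Proof.
have oneC : (fun=> 1 : int) \in @Defs.cycle G 0.
  apply/andP; split; last exact/asboolP.
  by rewrite -(chain_fun_level_sum 0); exact: chain_fun_CcZ.
pose one : ker_delta G 0 := KerDelta oneC.
exists (\pi_(Quotient.quot (@im_delta _ _)) one)%qT => u; have [f ->] := quot_pi_ex u.
have /andP[fC _] := valP f; have [i [c [cm fc]]] := CcZ_chain_fun fC.
exists (n i), (zdeg c); split; first exact: n_gt0.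
rewrite -raddfMn -raddfMz; apply/eqP; rewrite -subr_eq0 -raddfB; apply/eqP/quot_pi_eq0.
apply/asboolP; exists (chain_fun (zlift (@translations i) c)); first exact: chain_fun_CcZ.
rewrite delta_chain_fun; last first.
  apply: homogeneous_zlift cm => v v0 w w1; rewrite /translations raddf_sum big1//= => j _.
  by rewrite /gen coeffU; case: eqP => [wv|]; [rewrite -wv in w1|rewrite mulr0].
rewrite bar_boundary_translations//.
apply/funext => w; rewrite /chain_fun coeffB.
have cMn m (d : {freeg (spx i)}) v : coeff v (d *+ m) = coeff v d *+ m by rewrite raddfMn.
have cMz m (d : {freeg (spx i)}) v : coeff v (d *~ m) = coeff v d *~ m by rewrite raddfMz.
rewrite cMn cMz.
have := congr1 (fun g => g w) (chain_fun_level_sum i); rewrite /chain_fun => ->.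
have := congr1 (fun g => g w) fc; rewrite /chain_fun => <-.
have -> : \val (f *+ n i - one *~ zdeg c) = \val f *+ n i - \val one *~ zdeg c.
  by rewrite raddfB raddfMn raddfMz.
rewrite [RHS](_ : _ = (\val f *+ n i) w - (\val one *~ zdeg c) w)//.
by rewrite funMn funMz.
Qed.
End LevelChains.

(** * Approximate idempotents and bounded traces *)

Lemma nz_poly_eval_ex (A : nzRingType) (x : A) :
  exists f : {rmorphism {poly int} -> A}, f 'X = x.
Proof.
have cx : commr_rmorph (intmul (1 : A)) x by move=> m; exact: commr_int.
by exists (horner_morph cx); rewrite /= horner_morphX.
Qed.

(** Polynomial identities in one element of a possibly trivial or noncommutative
    ring are identities of integer polynomials. *)
Lemma poly_eval_ex (A : pzRingType) (x : A) :
  exists f : {rmorphism {poly int} -> A}, f 'X = x.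
Proof.
have [A0|A1] := eqVneq (1 : A) 0.
  have all0 (y z : A) : y = z by rewrite -(mulr1 y) -(mulr1 z) A0 !mulr0.
  pose f (p : {poly int}) : A := 0.
  have fB : zmod_morphism f by move=> p q; exact: all0.
  have fM : monoid_morphism f by split=> [|p q]; exact: all0.
  pose F := HB.pack_for {rmorphism {poly int} -> A} f
    (GRing.isZmodMorphism.Build _ _ f fB) (GRing.isMonoidMorphism.Build _ _ f fM).
  by exists F; exact: all0.
pose A' := HB.pack_for nzRingType A (GRing.PzSemiRing_isNonZero.Build A A1).
exact: (@nz_poly_eval_ex A' x).
Qed.

Section SmoothStep.
Variable A : pzRingType.
Implicit Types x y : A.

Definition defect x : A := x * x - x.

(** The polynomial 3x^2 - 2x^3 fixes idempotents and makes the defect of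
    approximate ones quadratically smaller. *)
Definition smooth x : A := x * x *+ 3 - x * x * x *+ 2.

Lemma smooth_idem x : x * x = x -> smooth x = x.
Proof. by move=> xx; rewrite /smooth !xx mulrSr addrAC subrr add0r. Qed.

Lemma smoothE x : smooth x - x = defect x - defect x * x *+ 2.
Proof.
have [f <-] := poly_eval_ex x; rewrite /smooth /defect.
by rewrite -!(rmorphM, raddfB, raddfMn) /=; congr (f _); ring.
Qed.

(** The defect of [smooth x] is divisible by the square of that of [x]. *)
Lemma defect_smooth x : defect (smooth x) =
  defect x * defect x * defect x *+ 4 - defect x * defect x *+ 3.
Proof.
have [f <-] := poly_eval_ex x; rewrite /smooth /defect.
by rewrite -!(rmorphM, raddfB, raddfMn) /=; congr (f _); ring.
Qed.
End SmoothStep.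

(** Identities between integer combinations of up to seven elements of an
    abelian group can be checked in a free abelian group, coefficient by
    coefficient. *)
Lemma zmod_eval_ex (V : zmodType) (a b c d e g h : V) :
  exists f : {additive {freeg nat} -> V}, [/\ f (gen 0%N) = a, f (gen 1%N) = b,
    f (gen 2%N) = c, f (gen 3%N) = d & [/\ f (gen 4%N) = e, f (gen 5%N) = g & f (gen 6%N) = h]].
Proof. by exists (zlift (fun i => [:: a; b; c; d; e; g; h]`_i)); rewrite /= !zliftU. Qed.

Section NormedRing.
Variables (R : realType) (A : pzRingType) (N : A -> R).
Hypothesis N_0 : N 0 = 0.
Hypothesis N_ge0 : forall x, 0 <= N x.
Hypothesis N_D : forall x y, N (x + y) <= N x + N y.
Hypothesis N_N : forall x, N (- x) = N x.
Hypothesis N_M : forall x y, N (x * y) <= N x * N y.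
Implicit Types x y p b : A.

Lemma N_B x y : N (x - y) <= N x + N y.
Proof. by rewrite -(N_N y). Qed.

Lemma N_Mn x k : N (x *+ k.+1) <= N x *+ k.+1.
Proof.
elim: k => // k IH; rewrite mulrS [leRHS]mulrS.
by rewrite (le_trans (N_D _ _))// lerD2l.
Qed.

Lemma N_M_le x y (c d : R) : N x <= c -> N y <= d -> N (x * y) <= c * d.
Proof. by move=> xc yd; rewrite (le_trans (N_M _ _))// ler_pM. Qed.

Lemma N_defect_smooth x : N (defect x) <= 8^-1 ->
  N (defect (smooth x)) <= 2^-1 * N (defect x).
Proof.
move=> e8; rewrite defect_smooth (le_trans (N_B _ _))//.
set e := defect x in e8 *; have e0 := N_ge0 e.
have h2 : N (e * e) <= 8^-1 * N e by exact: N_M_le.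
have h3 : N (e * e * e) <= 8^-1 * N e * 8^-1 by exact: N_M_le.
have h4 : N (e * e * e *+ 4) <= N (e * e * e) *+ 4 by exact: (N_Mn _ 3).
have h5 : N (e * e *+ 3) <= N (e * e) *+ 3 by exact: (N_Mn _ 2).
move: (N (e * e * e *+ 4)) (N (e * e *+ 3)) (N (e * e * e)) (N (e * e)) (N e) e0 e8 h2 h3 h4 h5.
by move=> u v w z a *; lra.
Qed.

(** The defect is at least halved by each step, and the total displacement is
    controlled by the initial defect. *)
Lemma iter_smooth_bounds (K : R) b : 1 <= K -> N b <= K ->
    10 * (K * N (defect b)) <= 1 -> forall m,
  [/\ N (defect (iter m (@smooth A) b)) <= 2^-1 ^+ m * N (defect b),
      N (iter m (@smooth A) b - b) <= 10 * K * N (defect b) * (1 - 2^-1 ^+ m)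
    & N (iter m (@smooth A) b) <= 2 * K].
Proof.
move=> K1 bK; set e0 := N (defect b) => Ke0.
have e0_ge0 : 0 <= e0 by exact: N_ge0.
have K0 : 0 < K by lra.
have e08 : e0 <= 10^-1 by have : e0 <= K * e0 by [rewrite ler_peMl]; lra.
elim=> [|m [IH1 IH2 IH3]].
  by rewrite /= expr0 mul1r !subrr mulr0 N_0; split => //; lra.
rewrite iterS; set x := iter m (@smooth A) b in IH1 IH2 IH3 *.
have x_ge0 := N_ge0 x; have h1 : 0 <= 2^-1 ^+ m :> R by rewrite exprn_ge0.
have h2 : 2^-1 ^+ m <= 1 :> R by rewrite exprn_ile1//; lra.
have ex : N (defect x) <= e0 by rewrite (le_trans IH1)// ler_piMl.
have step : N (smooth x - x) <= 2^-1 ^+ m * e0 * (5 * K).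
  rewrite smoothE (le_trans (N_B _ _))//.
  have : N (defect x * x *+ 2) <= N (defect x * x) *+ 2 by exact: (N_Mn _ 1).
  have : N (defect x * x) <= 2^-1 ^+ m * e0 * (2 * K) by exact: N_M_le.
  have : 2^-1 ^+ m * e0 <= 2^-1 ^+ m * e0 * K by rewrite ler_peMr// mulr_ge0.
  move: (N (defect x * x *+ 2)) (N (defect x * x)) (N (defect x)) (2^-1 ^+ m * e0) IH1.
  by move=> u v w z; rewrite !mulrA; move=> *; lra.
have e1 : N (defect (smooth x)) <= 2^-1 ^+ m.+1 * e0.
  rewrite (le_trans (N_defect_smooth _))//; last by rewrite exprS -mulrA ler_wpM2l.
  by rewrite (le_trans ex)//; move: e08; lra.
have e2 : N (smooth x - b) <= 10 * K * e0 * (1 - 2^-1 ^+ m.+1).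
  rewrite -(subrK x (smooth x)) -addrA (le_trans (N_D _ _))//.
  rewrite (le_trans (lerD step IH2))// exprS.
  by move: (2^-1 ^+ m) => c; rewrite le_eqVlt; apply/orP; left; apply/eqP; field.
split => //; rewrite -(subrK b (smooth x)) (le_trans (N_D _ _))//.
have h3 : 0 <= 2^-1 ^+ m.+1 :> R by rewrite exprn_ge0.
have : N (smooth x - b) <= 10 * (K * e0).
  rewrite (le_trans e2)// mulrA ler_piMr//.
  by rewrite !mulr_ge0// ltW.
by move: (N (smooth x - b)) (N b) (K * e0) bK Ke0 K1 => u v w *; lra.
Qed.

Lemma geometric_expr r : N r <= 2^-1 -> forall m, N (r ^+ m.+1) <= 2^-1 ^+ m.+1.
Proof.
move=> r2; elim=> [|m IH]; first by rewrite !expr1.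
by rewrite exprS [leRHS]exprS N_M_le.
Qed.

Lemma geometric_sum r : N r <= 2^-1 -> forall m,
  N (\sum_(j < m) r ^+ j) <= N 1 + 1.
Proof.
move=> r2; have N1 := N_ge0 1; case=> [|m]; first by rewrite big_ord0 N_0; lra.
suff : N (\sum_(j < m.+1) r ^+ j) <= N 1 + (1 - 2^-1 ^+ m).
  by move=> /le_trans; apply; have : 0 <= 2^-1 ^+ m :> R by [rewrite exprn_ge0]; lra.
elim: m => [|m IH]; first by rewrite big_ord1 !expr0; lra.
rewrite big_ord_recr (le_trans (N_D _ _))// (le_trans (lerD IH (geometric_expr r2 m)))//.
by rewrite exprS; move: (2^-1 ^+ m) => c; lra.
Qed.

(** Two approximations [x], [y] of the same idempotent are almost conjugate
    under [1 - r = 1 - y - x + 2 y x], which is close to 1 because [r] is small,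
    and thus invertible by a geometric series. *)
Lemma conjugating x y : let r := y + x - y * x *+ 2 in
  [/\ r = (y - x) - (y - x) * x *+ 2 - defect x *+ 2
    & y * (1 - r) - (1 - r) * x =
      defect x - defect y + (defect y * x *+ 2 - y * defect x *+ 2)].
Proof.
move=> r; rewrite /r /defect; split.
  rewrite !mulrBl; have [f [<- <- <- <- _]] := zmod_eval_ex x y (y * x) (x * x) 0 0 0.
  rewrite -!(raddfB, raddfD, raddfMn) /=; congr (f _); apply/eqP/freeg_eqP => z.
  by rewrite !(coeffMn, coeffD, coeffB, coeffN); ring.
rewrite !(mulrBr, mulrBl, mulrDl, mulrDr, mulr1, mul1r, mulrnAr, mulrnAl, mulrA).
have [f [<- <- <- <- [<- <- <-]]] := zmod_eval_ex (y * y * x) (y * x * x) (y * x) (y * y) (x * x) x y.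
rewrite -!(raddfB, raddfD, raddfMn) /=; congr (f _); apply/eqP/freeg_eqP => z.
by rewrite !(coeffMn, coeffD, coeffB, coeffN); ring.
Qed.

Variables (V : zmodType) (absV : V -> R).
Hypothesis abs_ge0 : forall v, 0 <= absV v.
Hypothesis abs_D : forall u v, absV (u + v) <= absV u + absV v.
Hypothesis abs_N : forall v, absV (- v) = absV v.

Lemma abs_B u v : absV (u - v) <= absV u + absV v.
Proof. by rewrite -(abs_N v). Qed.

(** A subring [S] with a trace on it; the bound is by the ambient norm. *)
Record bounded_trace (S : A -> Prop) (t : A -> V) (D : R) : Prop := BoundedTrace {
  trace_dom1 : S 1;
  trace_domB : forall x y, S x -> S y -> S (x - y);
  trace_domM : forall x y, S x -> S y -> S (x * y);
  traceB : forall x y, S x -> S y -> t (x - y) = t x - t y;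
  traceC : forall x y, S x -> S y -> t (x * y) = t (y * x);
  trace_le : forall x, S x -> absV (t x) <= D * N x }.

Section BoundedTrace.
Variables (S : A -> Prop) (t : A -> V) (D : R).
Hypothesis tr : bounded_trace S t D.
Let SB := trace_domB tr.
Let SM := trace_domM tr.

Lemma trace_dom0 : S 0.
Proof. by rewrite -(subrr 1); apply: SB; exact: (trace_dom1 tr). Qed.

Lemma trace_domN x : S x -> S (- x).
Proof. by move=> Sx; rewrite -sub0r; apply: SB => //; exact: trace_dom0. Qed.

Lemma trace_domD x y : S x -> S y -> S (x + y).
Proof. by move=> Sx Sy; rewrite -(opprK y); apply/SB/trace_domN. Qed.

Lemma trace_domMn x k : S x -> S (x *+ k).
Proof.
by move=> Sx; elim: k => [|k IH]; [exact: trace_dom0|rewrite mulrS; exact: trace_domD].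
Qed.

Lemma trace_domX x k : S x -> S (x ^+ k).
Proof.
by move=> Sx; elim: k => [|k IH]; [exact: (trace_dom1 tr)|rewrite exprS; exact: SM].
Qed.

Lemma trace_dom_sum k (F : 'I_k -> A) : (forall j, S (F j)) -> S (\sum_j F j).
Proof. by move=> SF; apply: big_ind => //; [exact: trace_dom0|exact: trace_domD]. Qed.

Lemma trace_dom_smooth x : S x -> S (smooth x).
Proof. by move=> Sx; apply: SB; apply: trace_domMn; do ?apply: SM. Qed.

Lemma trace_dom_iter m x : S x -> S (iter m (@smooth A) x).
Proof. by move=> Sx; elim: m => // m IH; exact: trace_dom_smooth. Qed.

Lemma traceD x y : S x -> S y -> t (x + y) = t x + t y.
Proof.
move=> Sx Sy; have S0 := trace_dom0.
have t0 : t 0 = 0 by have := traceB tr S0 S0; rewrite !subrr.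
have tN : t (- y) = - t y by have := traceB tr S0 Sy; rewrite t0 !sub0r.
by have := traceB tr Sx (trace_domN Sy); rewrite tN !opprK.
Qed.

(** The trace of [y - y r^(m+1)] equals that of [y (1 - r) s] for the partial
    sum [s] of the geometric series of [r], and [y (1 - r)] is [(1 - r) x] up to
    the defects; cyclicity removes [1 - r] and [s] from the second product. *)
Lemma trace_close x y (K E d : R) m : 0 <= K -> 0 <= D -> S x -> S y ->
  N x <= 2 * K -> N y <= 2 * K -> N (defect x) <= E -> N (defect y) <= E ->
  N (y - x) <= d -> d + 4 * (K * d) + 2 * E <= 2^-1 ->
  absV (t y - t x) <=
    D * (4 * (K * 2^-1 ^+ m.+1) + (2 * E + 8 * (K * E)) * (N 1 + 1)).
Proof.
move=> K0 D0 Sx Sy xK yK eE fE yxd dE.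
have [rE gE] := conjugating x y; set r := y + x - _ in rE gE.
set g := RHS in gE.
have r2 : N r <= 2^-1.
  rewrite rE (le_trans _ dE)// (le_trans (N_B _ _))//.
  have h1 : N ((y - x) * x *+ 2) <= N ((y - x) * x) *+ 2 by exact: (N_Mn _ 1).
  have h2 : N ((y - x) * x) <= d * (2 * K) by exact: N_M_le.
  have h3 : N (defect x *+ 2) <= N (defect x) *+ 2 by exact: (N_Mn _ 1).
  have := N_B (y - x) ((y - x) * x *+ 2).
  move: (N (_ - _ - _)) (N (y - x)) (N (_ * _ *+ 2)) (N (_ * _)) (N (_ *+ 2)) (N (defect x)) yxd eE h1 h2 h3.
  by move=> u v w z a b; rewrite mulrCA (mulrC d); move: (K * d) => Kd *; lra.
have g_le : N g <= 2 * E + 8 * (K * E).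
  have h1 : N (defect y * x *+ 2) <= N (defect y * x) *+ 2 by exact: (N_Mn _ 1).
  have h2 : N (defect y * x) <= E * (2 * K) by exact: N_M_le.
  have h3 : N (y * defect x *+ 2) <= N (y * defect x) *+ 2 by exact: (N_Mn _ 1).
  have h4 : N (y * defect x) <= (2 * K) * E by exact: N_M_le.
  have h5 := N_B (defect x) (defect y).
  have h6 := N_B (defect y * x *+ 2) (y * defect x *+ 2).
  rewrite /g (le_trans (N_D _ _))//.
  move: (N (defect x - _)) (N (defect y * x *+ 2 - _)) (N (defect y * x *+ 2)) (N (y * defect x *+ 2))
     (N (defect y * x)) (N (y * defect x)) (N (defect x)) (N (defect y)) eE fE h1 h2 h3 h4 h5 h6.
  by move=> ? ? ? ? ? ? ? ?; rewrite mulrCA (mulrC E) -!mulrA; move: (K * E) => KE *; lra.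
have Sr : S r by apply: SB; [exact: trace_domD|apply: trace_domMn; exact: SM].
have S1r : S (1 - r) by apply: SB => //; exact: (trace_dom1 tr).
pose s := \sum_(j < m.+1) r ^+ j.
have Ss : S s by apply: trace_dom_sum => j; exact: trace_domX.
have zs : (1 - r) * s = 1 - r ^+ m.+1.
  by rewrite -[1 - r]opprB mulNr -subrX1 opprB.
have sz : s * (1 - r) = 1 - r ^+ m.+1.
  rewrite -zs; apply: commr_sym; apply: commr_sum => j _; apply: commrX.
  exact/commr_sym/commrB/commr_refl/commr1.
have Sg : S g by rewrite -gE; apply: SB; [exact: (SM Sy S1r)|exact: (SM S1r Sx)].
have SrX := trace_domX m.+1 Sr.
have ty : t y - t (y * r ^+ m.+1) = t (y * (1 - r) * s).
  by rewrite -mulrA zs mulrBr mulr1 (traceB tr)//; exact: SM.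
have tx : t x - t (x * r ^+ m.+1) = t ((1 - r) * x * s).
  rewrite -mulrA (traceC tr S1r (SM Sx Ss)) -mulrA sz mulrBr mulr1.
  by rewrite (traceB tr)//; exact: SM.
have yx : t y - t x = t (g * s) + (t (y * r ^+ m.+1) - t (x * r ^+ m.+1)).
  rewrite -gE mulrBl (traceB tr); last 2 first.
  - by do 2?[apply: SM => //].
  - by do 2?[apply: SM => //].
  rewrite -ty -tx.
  have [f [<- <- <- <- _]] := zmod_eval_ex (t (y * r ^+ m.+1)) (t (x * r ^+ m.+1)) (t y) (t x) 0 0 0.
  rewrite -!(raddfB, raddfD, raddfMn) /=; congr (f _); apply/eqP/freeg_eqP => z.
  by rewrite !(coeffMn, coeffD, coeffB, coeffN); ring.
have h1 : absV (t (g * s)) <= D * ((2 * E + 8 * (K * E)) * (N 1 + 1)).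
  rewrite (le_trans (trace_le tr _))//; first exact: SM.
  by rewrite ler_wpM2l// N_M_le// geometric_sum.
have h2 z : S z -> N z <= 2 * K -> absV (t (z * r ^+ m.+1)) <= D * (2 * K * 2^-1 ^+ m.+1).
  move=> Sz zK; rewrite (le_trans (trace_le tr _))//; first exact: SM.
  by rewrite ler_wpM2l// N_M_le// geometric_expr.
rewrite yx (le_trans (abs_D _ _))// addrC mulrDr lerD//.
rewrite (le_trans (abs_B _ _))// (le_trans (lerD (h2 _ Sy yK) (h2 _ Sx xK)))//.
by rewrite -mulrDr ler_wpM2l// -!mulrA; move: (K * _) => u; lra.
Qed.

Lemma approx_defect p b (d : R) : p * p = p -> N (b - p) <= d -> d <= 1 ->
  N b <= N p + 1 /\ N (defect b) <= 2 * ((N p + 1) * d).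
Proof.
move=> pp bp d1; have bK : N b <= N p + 1.
  by rewrite -(subrK p b) (le_trans (N_D _ _))// addrC lerD2l (le_trans bp).
split => //; have -> : defect b = (b - p) * b + p * (b - p) - (b - p).
  rewrite /defect !(mulrBr, mulrBl) pp.
  have [f [<- <- <- <- _]] := zmod_eval_ex (b * b) (p * b) b p 0 0 0.
  rewrite -!(raddfB, raddfD, raddfMn) /=; congr (f _); apply/eqP/freeg_eqP => z.
  by rewrite !(coeffMn, coeffD, coeffB, coeffN); ring.
rewrite (le_trans (N_B _ _))// (le_trans (lerD (N_D _ _) bp))//.
have h1 : N ((b - p) * b) <= d * (N p + 1) by exact: N_M_le.
have h2 : N (p * (b - p)) <= N p * d by exact: N_M_le.
move: (N ((b - p) * b)) (N (p * (b - p))) (N p) h1 h2 => u v w.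
by rewrite (mulrC d) mulrDl mul1r; move: (w * d) => *; lra.
Qed.

(** How close to an idempotent of norm [K - 1] an approximation has to be for
    the smoothing steps to converge and for [r] in [conjugating] to have norm at
    most 1/2; the cube compensates for two factors [K]. *)
Definition tolerance (K : R) : R := (8 * K)^-1 * ((8 * K)^-1 * (8 * K)^-1).

Lemma tolerance_gt0 (K : R) : 1 <= K -> 0 < tolerance K.
Proof. by move=> K1; rewrite !mulr_gt0// invr_gt0; lra. Qed.

(** Two approximations of an idempotent have asymptotically equal traces,
    because the defects of their iterates, and the remainder of the geometric
    series, are of order 2^-m. *)
Lemma trace_compare p b c m : p * p = p -> S b -> S c -> 0 <= D ->
  N (b - p) <= tolerance (N p + 1) -> N (c - p) <= tolerance (N p + 1) ->
  absV (t (iter m (@smooth A) c) - t (iter m (@smooth A) b)) <=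
    D * (2 * (N p + 1) + N 1 + 1) * 2^-1 ^+ m.
Proof.
move=> pp Sb Sc D0; have p0 := N_ge0 p; set K := N p + 1.
have K1 : 1 <= K by rewrite /K; lra.
have K0 : 0 <= K by lra.
rewrite /tolerance; set w := (8 * K)^-1.
have Kw : K * w = 8^-1 by rewrite /w invfM mulrCA divff ?mulr1// gt_eqF//; lra.
have w0 : 0 <= w by rewrite invr_ge0; lra.
have w8 : w <= 8^-1 by rewrite -Kw ler_peMl.
have ww0 : 0 <= w * w by rewrite mulr_ge0.
have ww8 : w * w <= 8^-1 * w by rewrite ler_wpM2r.
have d0 : 0 <= w * (w * w) by rewrite mulr_ge0.
have d8 : w * (w * w) <= 8^-1 * (w * w) by rewrite ler_wpM2r.
have Kd : K * (w * (w * w)) = 8^-1 * (w * w) by rewrite [LHS]mulrA Kw.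
have KKd : K * (K * (w * (w * w))) = 8^-1 * (8^-1 * w) by rewrite Kd -Kw; ring.
set d := w * (w * w) in d0 d8 Kd KKd *; move=> bp cp.
have d1 : d <= 1 by lra.
have [bK bE] := approx_defect pp bp d1; have [cK cE] := approx_defect pp cp d1.
rewrite -/K Kd in bK bE cK cE.
have KE x : N (defect x) <= 2 * (8^-1 * (w * w)) -> K * N (defect x) <= 2 * (8^-1 * (8^-1 * w)).
  by move=> xE; rewrite -KKd Kd mulrCA ler_wpM2l.
have bKE := KE _ bE; have cKE := KE _ cE.
have [|x1 x2 x3] := iter_smooth_bounds K1 bK _ m.
  by move: (K * _) bKE => u *; lra.
have [|y1 y2 y3] := iter_smooth_bounds K1 cK _ m.
  by move: (K * _) cKE => u *; lra.
set x := iter m _ b in x1 x2 x3 *; set y := iter m _ c in y1 y2 y3 *.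
set q := 2^-1 ^+ m in x1 x2 y1 y2 *.
have q0 : 0 <= q by rewrite exprn_ge0.
have q1 : q <= 1 by rewrite exprn_ile1//; lra.
pose E := q * (2 * (8^-1 * (w * w))).
have xE : N (defect x) <= E by rewrite (le_trans x1)// ler_wpM2l.
have yE : N (defect y) <= E by rewrite (le_trans y1)// ler_wpM2l.
pose h := 10 * (2 * (8^-1 * (8^-1 * w))) : R.
have dist z : K * N (defect z) <= 2 * (8^-1 * (8^-1 * w)) ->
    10 * K * N (defect z) * (1 - q) <= h.
  move=> zE; rewrite -mulrA -[10 * K * _]mulrA /h.
  have u0 : 0 <= K * N (defect z) by rewrite mulr_ge0.
  have : K * N (defect z) * (1 - q) <= K * N (defect z) by rewrite ler_piMr//; lra.
  by rewrite -mulrA; move: (K * (_ * _)) (K * _) zE u0 => u v *; lra.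
have xd := le_trans x2 (dist _ bKE); have yd := le_trans y2 (dist _ cKE).
have yx : N (y - x) <= h + h + (d + d).
  have -> : y - x = (y - c) - (x - b) + ((c - p) - (b - p)).
    have [f [<- <- <- <- [<- _ _]]] := zmod_eval_ex y c x b p 0 0.
    rewrite -!(raddfB, raddfD, raddfMn) /=; congr (f _); apply/eqP/freeg_eqP => z.
    by rewrite !(coeffMn, coeffD, coeffB, coeffN); ring.
  rewrite (le_trans (N_D _ _))// lerD//.
    by rewrite (le_trans (N_B _ _))// lerD.
  by rewrite (le_trans (N_B _ _))// lerD.
have Kh : K * (h + h + (d + d)) = 20 * (2 * (8^-1 * (8^-1 * 8^-1))) + 2 * (8^-1 * (w * w)).
  transitivity (20 * (2 * (8^-1 * (8^-1 * (K * w)))) + 2 * (K * d)); first by rewrite /h; ring.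
  by rewrite Kw Kd.
have KE2 : K * E = q * (2 * (8^-1 * (8^-1 * w))).
  by rewrite /E mulrCA; congr (_ * _); rewrite mulrCA -Kd KKd.
have Ele : E <= 2 * (8^-1 * (w * w)).
  by rewrite /E ler_piMl//; lra.
have := @trace_close x y K E _ m K0 D0 (trace_dom_iter _ Sb) (trace_dom_iter _ Sc) x3 y3 xE yE yx.
have -> : h + h + (d + d) + 4 * (K * (h + h + (d + d))) + 2 * E <= 2^-1.
  by rewrite Kh /h; lra.
move=> /(_ isT) /le_trans; apply.
rewrite -mulrA ler_wpM2l// exprS KE2 /E -/q.
have N1 := N_ge0 1.
have -> : 2 * (q * (2 * (8^-1 * (w * w)))) + 8 * (q * (2 * (8^-1 * (8^-1 * w)))) =
  q * (2^-1 * (w * w) + 4^-1 * w) by field.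
have h3 : q * (2^-1 * (w * w) + 4^-1 * w) <= q.
  by rewrite ler_piMr//; lra.
have h4 : q * (2^-1 * (w * w) + 4^-1 * w) * (N 1 + 1) <= q * (N 1 + 1).
  by rewrite ler_wpM2r//; lra.
rewrite (le_trans (lerD (lexx _) h4))//.
rewrite [leRHS]mulrC -addrA [leRHS]mulrDr lerD2r; lra.
Qed.
End BoundedTrace.
End NormedRing.

(** * Asymptotic traces of idempotent matrices *)

Section MatrixTrace.
Variables (R : realType) (B : pzRingType) (nrm : B -> R).
Hypothesis nrm_0 : nrm 0 = 0.
Hypothesis nrm_ge0 : forall x, 0 <= nrm x.
Hypothesis nrm_D : forall x y, nrm (x + y) <= nrm x + nrm y.
Hypothesis nrm_N : forall x, nrm (- x) = nrm x.
Hypothesis nrm_M : forall x y, nrm (x * y) <= nrm x * nrm y.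
Variables (V : zmodType) (absV : V -> R).
Hypothesis abs_0 : absV 0 = 0.
Hypothesis abs_ge0 : forall v, 0 <= absV v.
Hypothesis abs_D : forall u v, absV (u + v) <= absV u + absV v.
Hypothesis abs_N : forall v, absV (- v) = absV v.

(** The sum of the norms of all entries is submultiplicative also for
    rectangular matrices. *)
Definition mnrm m n (M : 'M[B]_(m, n)) : R := \sum_i \sum_j nrm (M i j).

Lemma mnrm0 m n : mnrm (0 : 'M[B]_(m, n)) = 0.
Proof. by rewrite /mnrm big1 // => i _; rewrite big1 // => j _; rewrite mxE nrm_0. Qed.

Lemma mnrm_ge0 m n (M : 'M[B]_(m, n)) : 0 <= mnrm M.
Proof. by apply: sumr_ge0 => i _; apply: sumr_ge0. Qed.

Lemma mnrmD m n (M N : 'M[B]_(m, n)) : mnrm (M + N) <= mnrm M + mnrm N.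
Proof.
rewrite /mnrm -big_split; apply: ler_sum => i _.
by rewrite -big_split; apply: ler_sum => j _; rewrite mxE.
Qed.

Lemma mnrmN m n (M : 'M[B]_(m, n)) : mnrm (- M) = mnrm M.
Proof. by apply: eq_bigr => i _; apply: eq_bigr => j _; rewrite mxE nrm_N. Qed.

Lemma nrm_sum I (r : seq I) (F : I -> B) :
  nrm (\sum_(i <- r) F i) <= \sum_(i <- r) nrm (F i).
Proof.
elim: r => [|i r IH]; first by rewrite !big_nil nrm_0.
by rewrite !big_cons (le_trans (nrm_D _ _))// lerD2l.
Qed.

Lemma mnrmM m n k (M : 'M[B]_(m, n)) (N : 'M[B]_(n, k)) : mnrm (M *m N) <= mnrm M * mnrm N.
Proof.
rewrite /mnrm mulr_suml; apply: ler_sum => i _.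
apply: (@le_trans _ _ (\sum_j \sum_l nrm (M i l) * nrm (N l j))).
  apply: ler_sum => j _; rewrite mxE (le_trans (nrm_sum _ _))//.
  by apply: ler_sum => l _.
rewrite exchange_big mulr_suml; apply: ler_sum => l _ /=.
rewrite -mulr_sumr ler_wpM2l// (bigD1 l)//= lerDl.
by apply: sumr_ge0 => u _; apply: sumr_ge0.
Qed.

Variables (Alg : nat -> B -> Prop) (T : nat -> B -> V) (D : nat -> R).
Hypothesis Alg_le : forall i j x, (i <= j)%N -> Alg i x -> Alg j x.
Hypothesis D_ge0 : forall i, 0 <= D i.
Hypothesis T_trace : forall i m, (i <= m)%N -> bounded_trace nrm absV (Alg i) (T m) (D i).

Definition mAlg i m n (M : 'M[B]_(m, n)) : Prop := forall a b, Alg i (M a b).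

Definition mtrace m n (M : 'M[B]_n) : V := \sum_j T m (M j j).

Let tr i := T_trace (leqnn i).

Lemma Alg0 i : Alg i 0. Proof. exact: trace_dom0 (tr i). Qed.

Lemma mAlg_le i j m n (M : 'M[B]_(m, n)) : (i <= j)%N -> mAlg i M -> mAlg j M.
Proof. by move=> ij Mi a b; exact: Alg_le (Mi a b). Qed.

Lemma mAlg1 i n : mAlg i (1%:M : 'M[B]_n).
Proof.
move=> a b; rewrite mxE; case: (a == b); first exact: (trace_dom1 (tr i)).
exact: Alg0.
Qed.

Lemma mAlgB i m n (M N : 'M[B]_(m, n)) : mAlg i M -> mAlg i N -> mAlg i (M - N).
Proof. by move=> Mi Ni a b; rewrite !mxE; exact: (trace_domB (tr i)). Qed.

Lemma mAlgM i m n k (M : 'M[B]_(m, n)) (N : 'M[B]_(n, k)) :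
  mAlg i M -> mAlg i N -> mAlg i (M *m N).
Proof.
move=> Mi Ni a b; rewrite mxE; apply: (trace_dom_sum (tr i)) => j.
exact: (trace_domM (tr i)).
Qed.

Lemma T_sum i m n (F : 'I_n -> B) : (i <= m)%N -> (forall j, Alg i (F j)) ->
  T m (\sum_j F j) = \sum_j T m (F j).
Proof.
move=> im; have t := T_trace im; elim: n F => [|n IH] F FA.
  by rewrite !big_ord0; have := traceB t (Alg0 i) (Alg0 i); rewrite !subrr.
rewrite !big_ord_recl (traceD t) ?IH//.
by apply: (trace_dom_sum t).
Qed.

Lemma mtraceC i m k l (M : 'M[B]_(k, l)) (N : 'M[B]_(l, k)) : (i <= m)%N -> mAlg i M -> mAlg i N ->
  mtrace m (M *m N) = mtrace m (N *m M).
Proof.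
move=> im Mi Ni; have t := T_trace im; rewrite /mtrace.
transitivity (\sum_a \sum_b T m (M a b * N b a)).
  apply: eq_bigr => a _; rewrite mxE (T_sum im)// => b.
  exact: (trace_domM t).
rewrite exchange_big; apply: eq_bigr => b _; rewrite mxE (T_sum im).
  by apply: eq_bigr => a _; rewrite (traceC t).
by move=> a; exact: (trace_domM t).
Qed.

Lemma mtrace_bounded i m n : (i <= m)%N ->
  bounded_trace (@mnrm n n) absV (@mAlg i n n) (@mtrace m n) (D i).
Proof.
move=> im; have t := T_trace im; split.
- exact: mAlg1.
- exact: mAlgB.
- exact: mAlgM.
- move=> x y xi yi; rewrite /mtrace -sumrB; apply: eq_bigr => j _.
  by rewrite !mxE (traceB t).
- by move=> x y xi yi; exact: mtraceC im xi yi.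
move=> x xi; apply: (@le_trans _ _ (\sum_j D i * nrm (x j j))).
  rewrite /mtrace; elim/big_ind2: _ => [|u a v b au bv|j _].
  - by rewrite abs_0.
  - by rewrite (le_trans (abs_D _ _))// lerD.
  - exact: (trace_le t).
rewrite -mulr_sumr ler_wpM2l// /mnrm; apply: ler_sum => j _.
by rewrite (bigD1 j)//= lerDl; apply: sumr_ge0.
Qed.

Definition in_closure (x : B) : Prop :=
  forall e, 0 < e -> exists i y, Alg i y /\ nrm (y - x) < e.

Definition mx_in_closure m n (M : 'M[B]_(m, n)) : Prop := forall a b, in_closure (M a b).

Lemma mx_closure_dense m n (M : 'M[B]_(m, n)) (e : R) : mx_in_closure M -> 0 < e ->
  exists i (Y : 'M[B]_(m, n)), mAlg i Y /\ mnrm (Y - M) <= e.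
Proof.
move=> MC e0; pose c : R := (m * n).+1%:R.
have c0 : 0 < c by rewrite ltr0n.
have h (ab : 'I_m * 'I_n) : exists iy : nat * B,
    Alg iy.1 iy.2 /\ nrm (iy.2 - M ab.1 ab.2) < e / c.
  by have [i [y yP]] := MC ab.1 ab.2 (e / c) (divr_gt0 e0 c0); exists (i, y).
have [f fP] := boolp.choice h.
exists (\max_ab (f ab).1)%N, (\matrix_(a, b) (f (a, b)).2); split.
  move=> a b; rewrite mxE; apply: Alg_le (fP (a, b)).1.
  exact: (leq_bigmax (F := fun ab => (f ab).1)).
apply: (@le_trans _ _ (\sum_(a < m) \sum_(b < n) e / c)).
  by apply: ler_sum => a _; apply: ler_sum => b _; rewrite !mxE ltW//; exact: (fP (a, b)).2.
rewrite !sumr_const !card_ord -mulrnA -[_ *+ _]mulr_natr mulrAC ler_pdivrMr//.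
rewrite ler_wpM2l//; first exact: ltW.
by rewrite /c ler_nat mulnC leqnSn.
Qed.

(** The relation modulo which the invariant of an idempotent is defined;
    explicit rates replace limits. *)
Definition decaying (u : nat -> V) : Prop :=
  exists (c : R) m0, forall m, (m0 <= m)%N -> absV (u m) <= c * 2^-1 ^+ m.

Lemma decayingD u v : decaying u -> decaying v -> decaying (fun m => u m + v m).
Proof.
move=> [c [m0 uc]] [d [m1 vd]]; exists (c + d), (maxn m0 m1) => m.
rewrite geq_max => /andP[h1 h2]; rewrite (le_trans (abs_D _ _))// mulrDl lerD//.
  exact: uc.
exact: vd.
Qed.

Lemma decayingN u : decaying u -> decaying (fun m => - u m).
Proof. by move=> [c [m0 uc]]; exists c, m0 => m h; rewrite abs_N; exact: uc. Qed.

Definition close_to k (p b : 'M[B]_k) : Prop := mnrm (b - p) <= tolerance (mnrm p + 1).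

Lemma close_compare k (p b c : 'M[B]_k) i j : p *m p = p ->
  mAlg i b -> mAlg j c -> close_to p b -> close_to p c ->
  decaying (fun m => mtrace m (iter m (@smooth 'M[B]_k) b)
                     - mtrace m (iter m (@smooth 'M[B]_k) c)).
Proof.
move=> pp bi cj bp cp; pose h := maxn i j.
exists (D h * (2 * (mnrm p + 1) + mnrm (1%:M : 'M[B]_k) + 1)), h => m hm.
have bh : mAlg h b by apply: mAlg_le bi; exact: leq_maxl.
have ch : mAlg h c by apply: mAlg_le cj; exact: leq_maxr.
exact: (@trace_compare R 'M[B]_k _ (mnrm0 k k) (@mnrm_ge0 k k) (@mnrmD k k)
  (@mnrmN k k) (@mnrmM k k k) V absV abs_D abs_N _ _ _ (mtrace_bounded k hm)).
Qed.

(** For an idempotent in the closure of the algebras an approximation exists,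
    and [close_compare] makes the choice immaterial. *)
Definition idem_trace k (p : 'M[B]_k) (m : nat) : V :=
  mtrace m (iter m (@smooth 'M[B]_k) (xget 0 [set b | (exists i, mAlg i b) /\ close_to p b])).

Lemma idem_trace_approx k (p b : 'M[B]_k) i : p *m p = p -> mAlg i b -> close_to p b ->
  decaying (fun m => idem_trace p m - mtrace m (iter m (@smooth 'M[B]_k) b)).
Proof.
move=> pp bi bp; rewrite /idem_trace; case: xgetP => [c _ [[j cj] cp]|/(_ b)].
  exact: close_compare pp cj bi cp bp.
by case; split => //; exists i.
Qed.

Lemma decaying_eq u v : u =1 v -> decaying u -> decaying v.
Proof. by move=> uv [c [m0 h]]; exists c, m0 => m hm; rewrite -uv; exact: h. Qed.

Lemma decaying_trans u v w : decaying (fun m => u m - v m) ->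
  decaying (fun m => v m - w m) -> decaying (fun m => u m - w m).
Proof.
by move=> h1 h2; apply: decaying_eq (decayingD h1 h2) => m; rewrite addrA subrK.
Qed.

Lemma idem_trace_alg k (p : 'M[B]_k) i : p *m p = p -> mAlg i p ->
  decaying (fun m => idem_trace p m - mtrace m p).
Proof.
move=> pp pi; apply: decaying_eq (idem_trace_approx pp pi _) => [m|].
  congr (_ - mtrace _ _); elim: m => //= m ->.
  by apply: smooth_idem.
rewrite /close_to subrr mnrm0 ltW// tolerance_gt0// lerDr; exact: mnrm_ge0.
Qed.

(** The polynomial 3x^2 - 2x^3 has no constant term, so that it can be applied
    to [W X] and [X W] by changing [X] only. *)
Lemma iter_smooth_swap k l (W : 'M[B]_(k, l)) (U : 'M[B]_(l, k)) i m :
  mAlg i W -> mAlg i U -> exists X : 'M[B]_(l, k), [/\ mAlg i X,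
    iter m (@smooth 'M[B]_k) (W *m U) = W *m X &
    iter m (@smooth 'M[B]_l) (U *m W) = X *m W].
Proof.
move=> Wi Ui; elim: m => [|m [X [Xi IH1 IH2]]]; first by exists U.
pose Y := X *m W *m X.
have Yi : mAlg i Y by apply: mAlgM => //; exact: mAlgM.
have mn a b (M : 'M[B]_(a, b)) c : mAlg i M -> mAlg i (M *+ c).
  by move=> Mi u v; rewrite mulmxnE; exact: (trace_domMn (tr i)).
exists (Y *+ 3 - Y *m W *m X *+ 2); split.
- by apply: mAlgB; apply: mn => //; do 2!apply: mAlgM => //.
- rewrite iterS IH1 /smooth mulmxBr !raddfMn /Y /=.
  by rewrite -!mulmxE !mulmxA.
rewrite iterS IH2 /smooth mulmxBl -![_ *+ _ *m W]/(mulmxr W (_ *+ _)) !raddfMn /Y /=.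
by rewrite -!mulmxE !mulmxA.
Qed.

(** Approximations of [w] and [v] give approximations of both products, whose
    iterates have exactly the same traces. *)
Lemma idem_trace_mvn k l (w : 'M[B]_(k, l)) (v : 'M[B]_(l, k)) :
  let p := w *m v in let q := v *m w in p *m p = p -> q *m q = q ->
  mx_in_closure w -> mx_in_closure v -> decaying (fun m => idem_trace p m - idem_trace q m).
Proof.
move=> p q pp qq wC vC.
pose e := Num.min (tolerance (mnrm p + 1)) (tolerance (mnrm q + 1)).
pose n := mnrm w + mnrm v + 1; have w0 := mnrm_ge0 w; have v0 := mnrm_ge0 v.
have n0 : 0 < n by rewrite /n; lra.
have e0 : 0 < e.
  by rewrite lt_min !tolerance_gt0// lerDr; exact: mnrm_ge0.
pose d := Num.min 1 (e / n).
have d0 : 0 < d by rewrite lt_min ltr01 divr_gt0.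
have [i [W [Wi Ww]]] := mx_closure_dense wC d0; have [j [U [Uj Uv]]] := mx_closure_dense vC d0.
have Wh := mAlg_le (leq_maxl i j) Wi; have Uh := mAlg_le (leq_maxr i j) Uj.
have d1 : d <= 1 by rewrite ge_min lexx.
have dn : d * n <= e by rewrite -ler_pdivlMr// ge_min lexx orbT.
have wB a b (M M' : 'M[B]_(a, b)) : mnrm (M' - M) <= d -> mnrm M' <= mnrm M + 1.
  by move=> h; rewrite -(subrK M M') (le_trans (mnrmD _ _))// addrC lerD2l (le_trans h).
have close a b (M M' : 'M[B]_(a, b)) (N N' : 'M[B]_(b, a)) :
    mnrm (M' - M) <= d -> mnrm (N' - N) <= d ->
    mnrm (M' *m N' - M *m N) <= d * (mnrm M + mnrm N + 1).
  move=> h1 h2; have -> : M' *m N' - M *m N = (M' - M) *m N' + M *m (N' - N).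
    by rewrite mulmxBl mulmxBr addrA subrK.
  rewrite (le_trans (mnrmD _ _))// (le_trans (lerD (mnrmM _ _) (mnrmM _ _)))//.
  have -> : d * (mnrm M + mnrm N + 1) = d * (mnrm N + 1) + mnrm M * d by ring.
  rewrite lerD//; first by rewrite ler_pM ?mnrm_ge0// wB.
  by rewrite ler_wpM2l// mnrm_ge0.
have pc : close_to p (W *m U).
  by rewrite /close_to (le_trans (close _ _ _ _ _ _ Ww Uv))// (le_trans dn)// ge_min lexx.
have qc : close_to q (U *m W).
  rewrite /close_to (le_trans (close _ _ _ _ _ _ Uv Ww))//.
  by rewrite [_ v + _]addrC (le_trans dn)// ge_min lexx orbT.
have h1 := idem_trace_approx pp (mAlgM Wh Uh) pc.
have h2 := idem_trace_approx qq (mAlgM Uh Wh) qc.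
apply: decaying_trans h1 _; apply: (@decaying_trans _ (fun m => mtrace m (iter m (@smooth 'M[B]_l) (U *m W)))); last first.
  by apply: decaying_eq (decayingN h2) => m; rewrite opprB.
exists 0, (maxn i j) => m hm; rewrite mul0r.
  have [X [Xi -> ->]] := iter_smooth_swap m Wh Uh.
  by rewrite (mtraceC hm Wh Xi) subrr abs_0.
Qed.

Local Notation diag p q := (block_mx p 0 0 q).

Lemma mnrm_oplus k l (p : 'M[B]_k) (q : 'M[B]_l) : mnrm (diag p q) = mnrm p + mnrm q.
Proof.
rewrite /mnrm big_split_ord /=; congr (_ + _); apply: eq_bigr => i _.
  rewrite big_split_ord /= [X in _ + X]big1 => [|j _]; last by rewrite block_mxEur mxE nrm_0.
  by rewrite addr0; apply: eq_bigr => j _; rewrite block_mxEul.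
rewrite big_split_ord /= [X in X + _]big1 => [|j _]; last by rewrite block_mxEdl mxE nrm_0.
by rewrite add0r; apply: eq_bigr => j _; rewrite block_mxEdr.
Qed.

(** The iterates act blockwise. *)
Lemma idem_trace_oplus k l (p : 'M[B]_k) (q : 'M[B]_l) : p *m p = p -> q *m q = q ->
  mx_in_closure p -> mx_in_closure q ->
  decaying (fun m => idem_trace (diag p q) m - (idem_trace p m + idem_trace q m)).
Proof.
move=> pp qq pC qC.
have oM (a c : 'M[B]_k) (b d : 'M[B]_l) : diag a b *m diag c d = diag (a *m c) (b *m d).
  by rewrite mulmx_block !mulmx0 !mul0mx !addr0 !add0r.
have oB (a c : 'M[B]_k) (b d : 'M[B]_l) : diag a b - diag c d = diag (a - c) (b - d).
  by rewrite opp_block_mx add_block_mx !subr0.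
have oMn (a : 'M[B]_k) (b : 'M[B]_l) c : diag a b *+ c = diag (a *+ c) (b *+ c).
  elim: c => [|c IH]; first by rewrite !mulr0n block_mx0.
  by rewrite !mulrS IH add_block_mx !addr0.
pose r := diag p q; have rr : r *m r = r by rewrite oM pp qq.
pose T3 := Num.min (tolerance (mnrm p + 1)) (tolerance (mnrm q + 1)).
pose e := Num.min T3 (tolerance (mnrm r + 1) / 2).
have t0 a b (M : 'M[B]_(a, b)) : 0 < tolerance (mnrm M + 1).
  by rewrite tolerance_gt0// lerDr; exact: mnrm_ge0.
have e0 : 0 < e by rewrite !lt_min !t0 divr_gt0.
have [i [b [bi bp]]] := mx_closure_dense pC e0; have [j [c [cj cq]]] := mx_closure_dense qC e0.
have bh := mAlg_le (leq_maxl i j) bi; have ch := mAlg_le (leq_maxr i j) cj.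
move: bp cq; rewrite /e /T3 !le_min => /andP[/andP[bp _] br] /andP[/andP[_ cq] cr].
have rh : mAlg (maxn i j) (diag b c).
  move=> u v; rewrite !mxE; case: splitP => u' _; rewrite mxE; case: splitP => v' _ //.
    by rewrite mxE; exact: Alg0.
  by rewrite mxE; exact: Alg0.
have rc : close_to r (diag b c).
  by rewrite /close_to oB mnrm_oplus; move: br cr => /lerD h/h; rewrite -splitr.
have h1 := idem_trace_approx rr rh rc.
have h2 := idem_trace_approx pp bh bp; have h3 := idem_trace_approx qq ch cq.
apply: decaying_trans h1 _; apply: decaying_eq (decayingN (decayingD h2 h3)) => m.
have -> : iter m (@smooth 'M[B]_(k + l)) (diag b c) =
    diag (iter m (@smooth 'M[B]_k) b) (iter m (@smooth 'M[B]_l) c).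
  elim: m => //= m ->; rewrite /smooth.
  by rewrite -!mulmxE !oM !oMn oB.
rewrite [mtrace m (diag _ _)](_ : _ = mtrace m (iter m (@smooth 'M[B]_k) b) +
  mtrace m (iter m (@smooth 'M[B]_l) c)); last first.
  rewrite /mtrace big_split_ord /=; congr (_ + _); apply: eq_bigr => u _.
    by rewrite block_mxEul.
  by rewrite block_mxEdr.
by rewrite opprD !opprB addrACA opprD.
Qed.

Lemma decaying_const (v : V) : (forall u, absV u = 0 -> u = 0) ->
  decaying (fun=> v) -> v = 0.
Proof.
move=> abs_eq0 [c [m0 h]]; apply: abs_eq0; apply/eqP; rewrite eq_le abs_ge0 andbT.
have hm m : absV v * m%:R <= `|c| + absV v * m0%:R.
  have [mm|mm] := leqP m0 m; last first.
    by rewrite (le_trans (ler_wpM2l (abs_ge0 v) (_ : _ <= m0%:R)))// ?lerDr// ler_nat ltnW.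
  have p2 : m%:R <= 2 ^+ m :> R by rewrite -natrX ler_nat ltnW// ltn_expl.
  rewrite (le_trans (ler_wpM2l (abs_ge0 v) p2))// (le_trans (ler_wpM2r _ (h m mm)))//.
  by rewrite exprVn divfK ?gt_eqF// ?exprn_gt0// (le_trans (ler_norm c))// lerDl mulr_ge0.
rewrite leNgt; apply/negP => v0.
have [m mP] : exists m : nat, (`|c| + absV v * m0%:R) / absV v < m%:R.
  by exists (Num.truncn ((`|c| + absV v * m0%:R) / absV v)).+1; exact: truncnS_gt.
by move: mP; rewrite ltr_pdivrMr// (mulrC m%:R) ltNge hm.
Qed.
End MatrixTrace.

(** * Bounded operators on square summable families *)

Section HilbertSpace.
Variables (R : realType) (I : choiceType).
Local Notation C := (Cx R).
Local Notation l2 := (l2 R I).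
Local Notation bop := (bop R I).
Local Notation normc := (@Normc.normc R).
#[local] Existing Instance summability.totally_filter.
Implicit Types (x y z : l2) (c : C).

(** The square of the norm, as a real number. *)
Definition sqn x : R := fine (normsq x).

Lemma normsqE x : normsq x = (sqn x)%:E.
Proof.
by rewrite /sqn fineK// ge0_fin_numE ?normsq_ge0//; case: x => x /= /asboolP.
Qed.

Lemma sqn_ge0 x : 0 <= sqn x. Proof. by rewrite fine_ge0 ?normsq_ge0. Qed.

Lemma normc_ge0 c : 0 <= normc c. Proof. by case: c => a b; exact: sqrtr_ge0. Qed.

Lemma normC_normc c : `|c| = (normc c)%:C%C. Proof. by []. Qed.

Lemma normc_real (r : R) : normc r%:C%C = `|r|.
Proof. by rewrite /normc /= expr0n addr0 sqrtr_sqr. Qed.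

Lemma l2N x i : (- x) i = - x i. Proof. by []. Qed.
Lemma l2Z c x i : (c *: x) i = c * x i. Proof. by []. Qed.

Lemma l2_ext x y : (forall i, x i = y i) -> x = y.
Proof. by move=> h; apply: val_inj; apply/funext. Qed.

(** The partial sums of the squared moduli converge in the complex plane; by
    polarization this gives the convergence of every inner product. *)
Lemma sqn_cvg x :
  summability.partial_sum (fun i => (normc (x i) ^+ 2)%:C%C : C^o) @
    summability.totally --> ((sqn x)%:C%C : C^o).
Proof.
have psE (A : {fset I}) : summability.partial_sum (fun i => (normc (x i) ^+ 2)%:C%C : C^o) A =
    (\sum_(i : A) normc (x (val i)) ^+ 2)%:C%C by rewrite /summability.partial_sum rmorph_sum.
have bound (A : {fset I}) : \sum_(i : A) normc (x (val i)) ^+ 2 <= sqn x.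
  rewrite -lee_fin -normsqE; apply: esum_ge; exists [set` A]; first by split=> //; exact: finite_fset.
  rewrite fsbig_finite//= set_fsetK big_seq_fsetE/= -sumEFin.
  by [].
apply/cvgrPdist_le => e e0.
have eR : e = (complex.Re e)%:C%C by case: e e0 => a b; rewrite ltcE /= => /andP[/eqP ->].
have {}e0 : 0 < complex.Re e by rewrite eR ltcR in e0.
have [_ [X [finX _] <-]] : exists2 v, [set \sum_(i \in X) (normc (x i) ^+ 2)%:E | X in fsets setT]%E v &
    (normsq x - (complex.Re e)%:E < v)%E.
  by apply: ub_ereal_sup_adherent => //; rewrite [ereal_sup _](normsqE x).
rewrite normsqE -EFinB fsbig_finite//= sumEFin lte_fin => Xe.
exists (fset_set X) => // A /= XA.
rewrite psE -rmorphB /= normC_normc [leRHS]eR lecR normc_real.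
rewrite ger0_norm ?subr_ge0 ?bound// lerBlDr -lerBlDl ltW// (lt_le_trans Xe)//.
rewrite -(big_seq_fsetE _ A predT (fun i => normc (x i) ^+ 2)) /= [leRHS](bigID (mem (fset_set X))) /=.
rewrite -[X in _ <= X + _]big_filter.
have -> : \sum_(i <- [seq i <- A | i \in fset_set X]) normc (x i) ^+ 2 =
    \sum_(i <- fset_set X) normc (x i) ^+ 2.
  apply: perm_big; apply: uniq_perm; rewrite ?filter_uniq ?fset_uniq// => i.
  by rewrite mem_filter; case: (boolP (i \in fset_set X)) => //= /(fsubsetP XA) ->.
by rewrite lerDl; apply: sumr_ge0 => i _; exact: sqr_ge0.
Qed.

Lemma normc_sqr c : (normc c ^+ 2)%:C%C = c * c^* :> C.
Proof. by rewrite rmorphXn /= -normC_normc normCK. Qed.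

Lemma polarization c d : c * d^* = 4^-1 *
  ((normc (c + d) ^+ 2)%:C%C - (normc (c - d) ^+ 2)%:C%C
   + 'i * (normc (c + 'i * d) ^+ 2)%:C%C - 'i * (normc (c - 'i * d) ^+ 2)%:C%C).
Proof.
rewrite !normc_sqr !(rmorphD, rmorphN, rmorphM) /= conjCi.
have : 'i * 'i = -1 :> C by rewrite -expr2 sqrCi.
move: ('i : C) (c^*) (d^*) => j c' d' jj.
transitivity (2^-1 * (c * d' + d * c' - j * j * (c * d' - d * c'))).
  by rewrite jj; field.
by field.
Qed.

Definition polar x y : C := 4^-1 * ((sqn (x + y))%:C%C - (sqn (x - y))%:C%C
  + 'i * (sqn (x + 'i *: y))%:C%C - 'i * (sqn (x - 'i *: y))%:C%C).

Lemma polar_cvg x y : summability.partial_sum (fun i => x i * (y i)^* : C^o) @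
  summability.totally --> (polar x y : C^o).
Proof.
pose ps z A := summability.partial_sum (fun i => (normc (z i) ^+ 2)%:C%C : C^o) A.
rewrite [X in X @ _](_ : _ = fun A => 4^-1 * (ps (x + y) A - ps (x - y) A
  + 'i * ps (x + 'i *: y) A - 'i * ps (x - 'i *: y) A)).
  have c := @sqn_cvg; apply: cvgM; first exact: cvg_cst.
  apply: cvgB; last by apply: cvgM; [exact: cvg_cst|exact: c].
  apply: cvgD; last by apply: cvgM; [exact: cvg_cst|exact: c].
  by apply: cvgB; exact: c.
apply/funext => A; rewrite /ps /summability.partial_sum !mulr_sumr -sumrB -big_split -sumrB.
by rewrite mulr_sumr; apply: eq_bigr => i _ /=; exact: polarization.
Qed.

Lemma innerE x y : inner x y = polar x y.
Proof. exact: (cvg_lim (@norm_hausdorff _ _) (@polar_cvg x y)). Qed.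

Lemma inner_cvg x y : summability.partial_sum (fun i => x i * (y i)^* : C^o) @
  summability.totally --> (inner x y : C^o).
Proof. by rewrite innerE; exact: polar_cvg. Qed.

Lemma inner_uniq x y l : summability.partial_sum (fun i => x i * (y i)^* : C^o) @
  summability.totally --> (l : C^o) -> inner x y = l.
Proof. exact: (cvg_lim (@norm_hausdorff _ _)). Qed.

Lemma eq_inner x y x' y' : (forall i, x i * (y i)^* = x' i * (y' i)^*) ->
  inner x y = inner x' y'.
Proof. by move=> h; rewrite /inner; congr (summability.sum _); apply/funext. Qed.

Lemma innerDl x x' y : inner (x + x') y = inner x y + inner x' y.
Proof.
apply: inner_uniq; rewrite [X in X @ _](_ : _ =
  summability.partial_sum (fun i => x i * (y i)^* : C^o) \+
  summability.partial_sum (fun i => x' i * (y i)^* : C^o)).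
  by apply: cvgD; exact: inner_cvg.
apply/funext => A; rewrite /summability.partial_sum /= -big_split.
by apply: eq_bigr => i _ /=; rewrite -mulrDl.
Qed.

Lemma innerDr x y y' : inner x (y + y') = inner x y + inner x y'.
Proof.
apply: inner_uniq; rewrite [X in X @ _](_ : _ =
  summability.partial_sum (fun i => x i * (y i)^* : C^o) \+
  summability.partial_sum (fun i => x i * (y' i)^* : C^o)).
  by apply: cvgD; exact: inner_cvg.
apply/funext => A; rewrite /summability.partial_sum /= -big_split.
by apply: eq_bigr => i _ /=; rewrite -mulrDr -rmorphD.
Qed.

Lemma innerNl x y : inner (- x) y = - inner x y.
Proof.
apply/eqP; rewrite -addr_eq0 -innerDl addNr; apply/eqP.
by rewrite (@eq_inner 0 y 0 0) => [|i]; [rewrite innerE /polar scaler0 !subr0 !addr0 subrr add0r subrr mulr0|rewrite !mul0r].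
Qed.

Lemma innerBl x x' y : inner (x - x') y = inner x y - inner x' y.
Proof. by rewrite innerDl innerNl. Qed.

Lemma innerBr x y y' : inner x (y - y') = inner x y - inner x y'.
Proof.
rewrite innerDr -innerNl; congr (_ + _); apply: eq_inner => i.
by rewrite l2N rmorphN mulrN l2N mulNr.
Qed.

Lemma inner_self x : inner x x = (sqn x)%:C%C.
Proof.
apply: inner_uniq; rewrite (_ : (fun i => _) = fun i => (normc (x i) ^+ 2)%:C%C : C^o).
  exact: sqn_cvg.
by apply/funext => i; rewrite normc_sqr.
Qed.

Lemma sqn_eq0 x : sqn x = 0 -> x = 0.
Proof.
move=> x0; apply: l2_ext => i; apply/Normc.eq0_normc/eqP.
rewrite -sqrf_eq0 eq_le sqr_ge0 andbT -lee_fin -x0 -normsqE.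
apply: esum_ge; exists [set i]; first by split=> //; exact: finite_set1.
by rewrite fsbig_set1.
Qed.

(** By polarization, the inner product is determined by the norm. *)
Lemma inner_isometry (U : l2 -> l2) x y : linear U -> (forall z, sqn (U z) = sqn z) ->
  inner (U x) (U y) = inner x y.
Proof.
move=> Ulin Uiso.
have UD z w : U (z + w) = U z + U w by have := Ulin 1 z w; rewrite !scale1r.
have U0 : U 0 = 0 by have := UD 0 0; rewrite addr0 => /eqP; rewrite eq_sym -subr_eq0 addrK => /eqP.
have UZ c z : U (c *: z) = c *: U z by have := Ulin c z 0; rewrite U0 !addr0.
have UN z : U (- z) = - U z by rewrite -scaleN1r UZ scaleN1r.
by rewrite !innerE /polar -!UZ -!UN -!UD !Uiso.
Qed.

(** Adjoints are unique since the inner product is definite. *)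
Lemma adj_eq (T S : bop) : (forall x y, inner (T x) y = inner x (S y)) -> adj T = S.
Proof.
move=> TS; rewrite /adj; case: xgetP => [S' _ TS'|/(_ S)//].
apply: val_inj; apply/funext => y; apply/eqP; rewrite -subr_eq0; apply/eqP.
apply: sqn_eq0; apply: complexI.
rewrite -inner_self innerBr -[inner _ (S' y)]TS' -[inner _ (bop_val S y)]TS subrr.
by [].
Qed.

Lemma normsq_scale (c : R) (z : I -> C) : 0 <= c -> (c%:E * normsq z =
  \esum_(i in [set: I]) (c * normc (z i) ^+ 2)%:E)%E.
Proof.
move=> c0; rewrite /normsq; apply/eqP; rewrite eq_le; apply/andP; split.
  have [->|c1] := eqVneq c 0.
    by rewrite mul0e; apply: esum_ge0 => i _; rewrite lee_fin mul0r.
  have {c1}c0 : 0 < c by rewrite lt_neqAle eq_sym c1.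
  rewrite -lee_pdivlMl//; apply: ge_ereal_sup => _ [X [finX _]] <-.
  rewrite lee_pdivlMl// ge0_mule_fsumr; last by move=> i; rewrite lee_fin sqr_ge0.
  by apply: ereal_sup_ubound; exists X.
apply: ge_ereal_sup => _ [X [finX _]] <-.
under eq_fsbigr do rewrite EFinM.
rewrite -ge0_mule_fsumr; last by move=> i; rewrite lee_fin sqr_ge0.
by rewrite lee_wpmul2l ?lee_fin//; apply: ereal_sup_ubound; exists X.
Qed.

(** The elementary inequality (a + b)^2 <= (1 + t) a^2 + (1 + 1/t) b^2,
    termwise. *)
Lemma sqnD_le (t : R) x y : 0 < t -> sqn (x + y) <= (1 + t) * sqn x + (1 + t^-1) * sqn y.
Proof.
move=> t0; have ti0 : 0 < t^-1 by rewrite invr_gt0.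
have Z (c : R) z : 0 <= c -> ((c * sqn z)%:E =
    \esum_(i in [set: I]) (c * normc (z i) ^+ 2)%:E)%E.
  by move=> c0; rewrite EFinM -normsqE normsq_scale.
have t1 : 0 <= 1 + t by lra.
have t2 : 0 <= 1 + t^-1 by lra.
rewrite -lee_fin EFinD !Z// -normsqE -esumD; last 2 first.
- by move=> i _; rewrite lee_fin mulr_ge0 ?sqr_ge0.
- by move=> i _; rewrite lee_fin mulr_ge0 ?sqr_ge0.
rewrite /normsq; apply: le_esum => i _; rewrite -EFinD lee_fin.
have h := le_normcD (x i) (y i); have h0 := normc_ge0 (x i + y i).
apply: (@le_trans _ _ ((normc (x i) + normc (y i)) ^+ 2)).
  by rewrite ler_pXn2r// nnegrE (le_trans h0).
move: (normc (x i)) (normc (y i)) => a b.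
rewrite -subr_ge0 [X in 0 <= X](_ : _ = t^-1 * (t * a - b) ^+ 2).
  by apply: mulr_ge0; [exact: ltW|exact: sqr_ge0].
by field; rewrite gt_eqF.
Qed.

Lemma sqnZ_le c x : sqn (c *: x) <= normc c ^+ 2 * sqn x.
Proof. by have := normsqZ c x; rewrite normsqE [normsq (c *: x)]normsqE -EFinM lee_fin. Qed.

Lemma sqr_l2norm x : l2norm x ^+ 2 = sqn x.
Proof. by rewrite sqr_sqrtr ?sqn_ge0. Qed.

Lemma l2norm_ge0 x : 0 <= l2norm x. Proof. exact: sqrtr_ge0. Qed.

Lemma l2norm0 : l2norm (0 : l2) = 0.
Proof.
have : sqn (0 : l2) <= 0.
  by have := sqnZ_le 0 0; rewrite scale0r Normc.normc0 expr0n mul0r.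
by move=> h; apply/eqP; rewrite sqrtr_eq0.
Qed.

Lemma l2norm_eq0 x : l2norm x = 0 -> x = 0.
Proof. by move=> x0; apply: sqn_eq0; rewrite -sqr_l2norm x0 expr0n. Qed.

Lemma l2norm_leP x (M : R) : 0 <= M -> sqn x <= M ^+ 2 -> l2norm x <= M.
Proof. by move=> M0; rewrite -sqr_l2norm ler_pXn2r// nnegrE l2norm_ge0. Qed.

Lemma l2normZ_le c x : l2norm (c *: x) <= normc c * l2norm x.
Proof.
apply: l2norm_leP; first by rewrite mulr_ge0 ?normc_ge0 ?l2norm_ge0.
by rewrite exprMn sqr_l2norm sqnZ_le.
Qed.

Lemma l2normN x : l2norm (- x) = l2norm x.
Proof.
suff h y : l2norm (- y) <= l2norm y by apply/eqP; rewrite eq_le h -{1}(opprK x) h.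
rewrite -scaleN1r (le_trans (l2normZ_le _ _))// -[-1](_ : (-1 : R)%:C%C = -1 :> C).
  by rewrite normc_real normrN normr1 mul1r.
by rewrite rmorphN1.
Qed.

Lemma l2normD x y : l2norm (x + y) <= l2norm x + l2norm y.
Proof.
have x0 := l2norm_ge0 x; have y0 := l2norm_ge0 y.
apply/ler_addgt0Pr => e e0; pose a := l2norm x + e / 2; pose b := l2norm y + e / 2.
have a0 : 0 < a by rewrite /a; lra.
have b0 : 0 < b by rewrite /b; lra.
have -> : l2norm x + l2norm y + e = a + b by rewrite /a /b; lra.
apply: l2norm_leP; first by rewrite addr_ge0 ?ltW.
have t0 : 0 < b / a by rewrite divr_gt0.
have xa : sqn x <= a ^+ 2 by rewrite -sqr_l2norm ler_pXn2r ?nnegrE// /a; lra.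
have yb : sqn y <= b ^+ 2 by rewrite -sqr_l2norm ler_pXn2r ?nnegrE// /b; lra.
rewrite (le_trans (sqnD_le x y t0))//.
have -> : (a + b) ^+ 2 = (1 + b / a) * a ^+ 2 + (1 + (b / a)^-1) * b ^+ 2.
  by field; rewrite !gt_eqF.
by rewrite lerD// ler_wpM2l// addr_ge0// ltW// invr_gt0.
Qed.

(** The polarization formula expresses the inner product by four squared
    norms. *)
Lemma inner_le_sqn x y : normc (inner x y) <= 2 * (sqn x + sqn y).
Proof.
have ni : normc 'i = 1 by apply: complexI; rewrite -normC_normc normCi.
have D z w : sqn (z + w) <= 2 * (sqn z + sqn w).
  by have := @sqnD_le 1 z w ltr01; rewrite invr1; lra.
have Z c z : normc c = 1 -> sqn (c *: z) <= sqn z.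
  by move=> c1; rewrite (le_trans (sqnZ_le _ _))// c1 expr1n mul1r.
have m1 : normc (-1) = 1 by rewrite -[-1](_ : (-1 : R)%:C%C = -1 :> C) ?normc_real ?normrN ?normr1 ?rmorphN1.
have b c : normc c = 1 -> sqn (x + c *: y) <= 2 * (sqn x + sqn y).
  by move=> c1; rewrite (le_trans (D _ _))// ler_pM2l// lerD2l Z.
have b1 := b _ (Normc.normc1 _); have b2 := b _ m1; have b3 := b _ ni.
have b4 : sqn (x + (- 'i) *: y) <= 2 * (sqn x + sqn y).
  by apply: b; rewrite -mulN1r Normc.normcM m1 mul1r.
rewrite scale1r in b1; rewrite scaleN1r in b2; rewrite scaleNr in b4.
rewrite innerE /polar Normc.normcM.
have n4 : normc 4^-1 = 4^-1.
  by rewrite Normc.normcV -[4](_ : (4 : R)%:C%C = 4 :> C) ?normc_real ?ger0_norm ?rmorph_nat.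
have tri (p q : C) (c d : R) : normc p <= c -> normc q <= d -> normc (p + q) <= c + d.
  by move=> pc qd; rewrite (le_trans (le_normcD p q))// lerD.
have triN (p : C) (c : R) : normc p <= c -> normc (- p) <= c.
  by move=> pc; rewrite -mulN1r Normc.normcM m1 mul1r.
pose M := 2 * (sqn x + sqn y).
have r z : sqn z <= M -> normc (sqn z)%:C%C <= M.
  by move=> zM; rewrite normc_real ger0_norm ?sqn_ge0.
have ri z : sqn z <= M -> normc ('i * (sqn z)%:C%C) <= M.
  by move=> zM; rewrite Normc.normcM ni mul1r r.
have := tri _ _ _ _ (tri _ _ _ _ (tri _ _ _ _ (r _ b1) (triN _ _ (r _ b2))) (ri _ b3)) (triN _ _ (ri _ b4)).
rewrite n4 -/M => h; have -> : M = 4^-1 * (M + M + M + M) by lra.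
by rewrite ler_wpM2l.
Qed.

Lemma inner_scale (t : R) x y : inner (t%:C%C *: x) y = inner x (t%:C%C *: y).
Proof.
apply: eq_inner => i; rewrite !l2Z rmorphM /=.
have /CrealP -> : (t%:C%C : C) \is Num.real by rewrite complex_real.
by rewrite mulrCA mulrA.
Qed.

(** A Cauchy-Schwarz inequality with a non-optimal constant, obtained by
    rescaling the two arguments to the same norm. *)
Lemma inner_bound x y : normc (inner x y) <= 4 * (l2norm x * l2norm y).
Proof.
have x0 := l2norm_ge0 x; have y0 := l2norm_ge0 y.
suff h a b : l2norm x < a -> l2norm y < b -> normc (inner x y) <= 4 * (a * b).
  apply/ler_addgt0Pr => e e0; pose c := l2norm x + l2norm y + 1.
  pose d := Num.min 1 (e / (4 * c)).
  have c0 : 0 < 4 * c by rewrite /c; lra.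
  have d0 : 0 < d by rewrite lt_min ltr01 divr_gt0.
  have d1 : d <= 1 by rewrite ge_min lexx.
  have de : d * (4 * c) <= e by rewrite -ler_pdivlMr// ge_min lexx orbT.
  apply: (le_trans (h (l2norm x + d) (l2norm y + d) _ _)); rewrite ?ltrDl//.
  have -> : 4 * ((l2norm x + d) * (l2norm y + d)) =
    4 * (l2norm x * l2norm y) + (d * (4 * c) - 4 * (d * (1 - d))) by rewrite /c; ring.
  have dd : 0 <= d * (1 - d) by rewrite mulr_ge0; lra.
  lra.
move=> xa yb; have a0 := le_lt_trans x0 xa; have b0 := le_lt_trans y0 yb.
pose t := Num.sqrt (b / a); have t0 : 0 < t by rewrite sqrtr_gt0 divr_gt0.
have tn r : 0 <= r -> normc r%:C%C = r by move=> r0; rewrite normc_real ger0_norm.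
have -> : inner x y = inner (t%:C%C *: x) ((t^-1)%:C%C *: y).
  rewrite inner_scale scalerA -rmorphM /= divff ?rmorph1 ?scale1r// gt_eqF//.
have ti0 : 0 < t^-1 by rewrite invr_gt0.
have ba : 0 <= b / a by rewrite divr_ge0// ltW.
have bai : 0 <= (b / a)^-1 by rewrite invr_ge0.
have xa2 : sqn x <= a ^+ 2 by rewrite -sqr_l2norm lerXn2r ?nnegrE// ltW.
have yb2 : sqn y <= b ^+ 2 by rewrite -sqr_l2norm lerXn2r ?nnegrE// ltW.
have h1 : sqn (t%:C%C *: x) <= a * b.
  rewrite (le_trans (sqnZ_le _ _))// tn; [|exact: ltW]; rewrite sqr_sqrtr//.
  have -> : a * b = b / a * a ^+ 2 by field; rewrite gt_eqF.
  exact: ler_wpM2l.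
have h2 : sqn ((t^-1)%:C%C *: y) <= a * b.
  rewrite (le_trans (sqnZ_le _ _))// tn; [|exact: ltW]; rewrite exprVn sqr_sqrtr//.
  have -> : a * b = (b / a)^-1 * b ^+ 2 by field; rewrite !gt_eqF.
  exact: ler_wpM2l.
by rewrite (le_trans (inner_le_sqn _ _))//; lra.
Qed.

Lemma bop_linear (T : bop) : linear T. Proof. by have /asboolP[] := valP T. Qed.

Lemma bopDr (T : bop) x y : T (x + y) = T x + T y.
Proof. by have := bop_linear T 1 x y; rewrite !scale1r. Qed.

Lemma bop_0 (T : bop) : T 0 = 0.
Proof.
by have /eqP := bopDr T 0 0; rewrite addr0 -subr_eq0 opprD addrA subrr sub0r oppr_eq0 => /eqP.
Qed.

Lemma bopZ (T : bop) c x : T (c *: x) = c *: T x.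
Proof. by have := bop_linear T c x 0; rewrite bop_0 !addr0. Qed.

Lemma bop_ext (T S : bop) : (forall x, T x = S x) -> T = S.
Proof. by move=> h; apply: val_inj; apply/funext. Qed.

Lemma bopD_app (T S : bop) x : (T + S) x = T x + S x. Proof. by []. Qed.
Lemma bopN_app (T : bop) x : (- T) x = - T x. Proof. by []. Qed.
Lemma bopM_app (T S : bop) x : (T * S) x = T (S x). Proof. by []. Qed.

Lemma opnorm_has_sup (T : bop) :
  has_sup [set l2norm (T x) | x in [set x | l2norm x <= 1]].
Proof.
split; first by exists (l2norm (T 0)); exists 0 => //=; rewrite l2norm0.
have /asboolP[_ [M TM]] := valP T; exists `|M| => _ [x /= x1 <-].
rewrite (le_trans (TM x))// (le_trans (ler_wpM2r (l2norm_ge0 x) (ler_norm M)))//.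
by rewrite ler_piMr.
Qed.

Lemma opnorm_app (T : bop) x : l2norm (T x) <= opnorm T * l2norm x.
Proof.
have x0 := l2norm_ge0 x; have [xe|xn0] := eqVneq (l2norm x) 0.
  by rewrite (l2norm_eq0 xe) bop_0 l2norm0 mulr0.
have {}x0 : 0 < l2norm x by rewrite lt_neqAle eq_sym xn0.
have ni r : 0 < r -> normc r%:C%C = r by move=> r0; rewrite normc_real gtr0_norm.
pose y := ((l2norm x)^-1)%:C%C *: x.
have xy : (l2norm x)%:C%C *: y = x.
  by rewrite scalerA -rmorphM /= divff// rmorph1 scale1r.
rewrite -{1}xy bopZ (le_trans (l2normZ_le _ _))// ni// mulrC.
rewrite ler_wpM2r//; first exact: ltW.
apply: (ub_le_sup (opnorm_has_sup T).2); exists y => //=.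
by rewrite (le_trans (l2normZ_le _ _))// ni ?invr_gt0// mulVf.
Qed.

Lemma opnorm_leP (T : bop) (M : R) : 0 <= M -> (forall x, l2norm (T x) <= M * l2norm x) ->
  opnorm T <= M.
Proof.
move=> M0 h; apply: (ge_sup (opnorm_has_sup T).1) => _ [x /= x1 <-].
by rewrite (le_trans (h x))// ler_piMr.
Qed.

Lemma opnorm_ge0 (T : bop) : 0 <= opnorm T.
Proof.
apply: (le_trans (l2norm_ge0 (T 0))); apply: (ub_le_sup (opnorm_has_sup T).2).
by exists 0 => //=; rewrite l2norm0.
Qed.

Lemma opnorm0 : opnorm (0 : bop) = 0.
Proof.
apply/eqP; rewrite eq_le opnorm_ge0 andbT opnorm_leP// => x.
by rewrite mul0r [X in l2norm X](_ : _ = 0)// l2norm0.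
Qed.

Lemma opnormD (T S : bop) : opnorm (T + S) <= opnorm T + opnorm S.
Proof.
apply: opnorm_leP => [|x]; first by rewrite addr_ge0 ?opnorm_ge0.
by rewrite bopD_app (le_trans (l2normD _ _))// mulrDl lerD ?opnorm_app.
Qed.

Lemma opnormN (T : bop) : opnorm (- T) = opnorm T.
Proof.
suff h (S : bop) : opnorm (- S) <= opnorm S by apply/eqP; rewrite eq_le h -{1}(opprK T) h.
apply: opnorm_leP => [|x]; first exact: opnorm_ge0.
by rewrite bopN_app l2normN opnorm_app.
Qed.

Lemma opnormM (T S : bop) : opnorm (T * S) <= opnorm T * opnorm S.
Proof.
apply: opnorm_leP => [|x]; first by rewrite mulr_ge0 ?opnorm_ge0.
by rewrite bopM_app (le_trans (opnorm_app _ _))// -mulrA ler_wpM2l ?opnorm_ge0 ?opnorm_app.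
Qed.

Lemma opnorm_close_trans (T S U : bop) (e : R) : opnorm (T - S) < e / 2 -> opnorm (S - U) <= e / 2 ->
  opnorm (U - T) < e.
Proof.
move=> h1 h2; have -> : U - T = - ((T - S) + (S - U)) by rewrite addrA subrK opprB.
by rewrite opnormN (le_lt_trans (opnormD _ _))// [e]splitr ltr_leD.
Qed.

(** Test the defining identity on [x = S y]. *)
Lemma opnorm_adjoint (T S : bop) : (forall x y, inner (T x) y = inner x (S y)) ->
  opnorm S <= 4 * opnorm T.
Proof.
move=> TS; apply: opnorm_leP => [|y]; first by rewrite mulr_ge0 ?opnorm_ge0.
have s0 := l2norm_ge0 (S y).
have : l2norm (S y) ^+ 2 <= 4 * opnorm T * l2norm y * l2norm (S y).
  have -> : l2norm (S y) ^+ 2 = normc (inner (T (S y)) y).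
    by rewrite TS inner_self normc_real ger0_norm ?sqn_ge0// sqr_l2norm.
  rewrite (le_trans (inner_bound _ _))// -!mulrA ler_pM2l// [l2norm y * _]mulrC mulrA.
  by rewrite ler_wpM2r ?l2norm_ge0 ?opnorm_app.
have [->|sn0] := eqVneq (l2norm (S y)) 0.
  by rewrite !mulr_ge0 ?opnorm_ge0 ?l2norm_ge0.
by rewrite expr2 ler_pM2r// lt_neqAle eq_sym sn0.
Qed.

Definition bop_closure (A : bop -> Prop) (T : bop) : Prop :=
  forall e : R, 0 < e -> exists L, A L /\ opnorm (L - T) < e.

(** If [L] is close to [T], the adjoint of [L] is close to that of [T]. The
    default value of [adj] is covered because 0 belongs to the family. *)
Lemma adj_closure (A : bop -> Prop) (T : bop) : A 0 ->
  (forall L, A L -> exists2 L', A L' & forall x y, inner (L x) y = inner x (L' y)) ->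
  bop_closure A T -> bop_closure A (adj T).
Proof.
move=> A0 Aadj TA e e0; rewrite /adj; case: xgetP => [S _ TS|_]; last first.
  by exists 0; rewrite subrr opnorm0.
have [|L [AL LT]] := TA (e / 4); first by rewrite divr_gt0.
have [L' AL' LL'] := Aadj L AL; exists L'; split => //.
apply: (@le_lt_trans _ _ (4 * opnorm (L - T))); last by rewrite mulrC -ltr_pdivlMr.
apply: opnorm_adjoint => x y; rewrite !bopD_app !bopN_app innerBl innerBr.
by rewrite LL' TS.
Qed.

Lemma delta_subproof (p : I) : (fun i => (i == p)%:R : C) \in @square_summable R I.
Proof.
apply/asboolP; rewrite /normsq (esumID [set p]); last by move=> i _; rewrite lee_fin sqr_ge0.
rewrite setTI esum_set1 ?lee_fin ?sqr_ge0// esum1 ?adde0 ?ltry// => i [_ /eqP/negPf ip].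
by rewrite ip Normc.normc0 expr0n.
Qed.

Definition delta (p : I) : l2 := L2 (delta_subproof p).

Lemma inner_delta x p : inner x (delta p) = x p.
Proof.
apply: inner_uniq; apply: cvg_near_cst; exists [fset p]%fset => // A /= pA.
have {}pA : p \in A by apply: (fsubsetP pA); rewrite inE.
rewrite /summability.partial_sum -(big_seq_fsetE _ A predT (fun i => x i * (delta p i)^*)) /=.
rewrite (bigD1_seq p) ?fset_uniq//= eqxx rmorph1 mulr1 big1 ?addr0// => i /negPf ip.
by rewrite ip rmorph0 mulr0.
Qed.

Lemma inner_sumr (J : Type) (r : seq J) x (F : J -> l2) :
  inner x (\sum_(j <- r) F j) = \sum_(j <- r) inner x (F j).
Proof.
elim: r => [|j r IH]; last by rewrite !big_cons innerDr IH.
by rewrite !big_nil; have := innerBr x 0 0; rewrite !subrr.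
Qed.

Lemma l2_sum (J : Type) (r : seq J) (F : J -> l2) i :
  (\sum_(j <- r) F j) i = \sum_(j <- r) F j i.
Proof. by elim: r => [|j r IH]; rewrite ?big_nil// !big_cons -IH. Qed.

Lemma bop_sum (J : Type) (r : seq J) (F : J -> l2) (T : bop) :
  T (\sum_(j <- r) F j) = \sum_(j <- r) T (F j).
Proof. by elim: r => [|j r IH]; rewrite ?big_nil ?bop_0// !big_cons bopDr IH. Qed.

Lemma sum_bop (J : Type) (r : seq J) (F : J -> bop) x :
  (\sum_(j <- r) F j) x = \sum_(j <- r) F j x.
Proof. by elim: r => [|j r IH]; rewrite ?big_nil// !big_cons -IH. Qed.

Lemma sqn_sum_delta (J : finType) (f : J -> I) : injective f ->
  sqn (\sum_j delta (f j)) = #|J|%:R.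
Proof.
move=> finj; apply: complexI; rewrite -inner_self inner_sumr.
rewrite (eq_bigr (fun=> 1)) ?sumr_const ?rmorph_nat// => j _.
rewrite inner_delta l2_sum (bigD1 j)//= eqxx big1 ?addr0// => k kj.
by rewrite (inj_eq finj) eq_sym (negPf kj).
Qed.

Lemma l2norm_delta p : l2norm (delta p) = 1.
Proof.
have := @sqn_sum_delta 'I_1 (fun=> p); rewrite big_ord1 card_ord /l2norm -/(sqn _) => ->.
  by rewrite sqrtr1.
by move=> i j _; rewrite !ord1.
Qed.

Lemma le_l2norm x p : normc (x p) <= l2norm x.
Proof.
rewrite -(@ler_pXn2r _ 2)// ?nnegrE ?l2norm_ge0 ?normc_ge0// sqr_l2norm.
rewrite -lee_fin -normsqE.
by apply: esum_ge; exists [set p]; rewrite ?fsbig_set1//; split=> //; exact: finite_set1.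
Qed.

(** A sum of matrix entries over a rectangle is a single inner product of two
    sums of basis vectors, whose norms are known. *)
Lemma rectangle_bound (T : bop) (J K : finType) (f : J -> I) (g : K -> I) :
  injective f -> injective g ->
  normc (\sum_j \sum_k T (delta (f j)) (g k)) <=
    4 * opnorm T * (Num.sqrt #|J|%:R * Num.sqrt #|K|%:R).
Proof.
move=> finj ginj; pose x := \sum_j delta (f j); pose y := \sum_k delta (g k).
have -> : \sum_j \sum_k T (delta (f j)) (g k) = inner (T x) y.
  rewrite inner_sumr exchange_big; apply: eq_bigr => k _ /=.
  by rewrite inner_delta bop_sum l2_sum.
rewrite (le_trans (inner_bound _ _))// -!mulrA ler_pM2l// mulrA.
rewrite -(sqn_sum_delta finj) -(sqn_sum_delta ginj) -/x -/y.
by rewrite ler_wpM2r ?l2norm_ge0 ?opnorm_app.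
Qed.
End HilbertSpace.

(** * The algebra of slices of a transformation groupoid *)

Section CrossedProduct.
Variables (R : realType) (Gam : groupType) (X : topologicalType) (a : action Gam X).
Local Notation C := (Cx R).
Local Notation G := (transformation_etale_groupoid a).
Local Notation I := (arrow G).
Local Notation l2 := (l2 R I).
Local Notation bop := (bop R I).
Local Notation normc := (@Normc.normc R).
Implicit Types (sg rho : Gam) (phi psi : X -> C) (xi : l2) (p : I).

Definition bounded_symbol phi := exists M : R, forall x, normc (phi x) <= M.

Definition slice_fun sg phi (xi : I -> C) : I -> C := fun p =>
  phi (a (sg^-1 * p.1)%g p.2) * xi ((sg^-1 * p.1)%g, p.2).

(** The operator of left convolution by the function equal to [phi] on the slice
    of [sg] and to zero on the other slices; it exists when [phi] is bounded. *)
Definition slice_op sg phi : bop :=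
  xget 0 [set T : bop | forall xi p, T xi p = slice_fun sg phi xi p].

Lemma slice_bound sg phi (M : R) (xi : I -> C) : 0 <= M -> (forall x, normc (phi x) <= M) ->
  (normsq (slice_fun sg phi xi) <= (M ^+ 2)%:E * normsq xi)%E.
Proof.
move=> M0 phiM; rewrite normsq_scale ?sqr_ge0//.
rewrite (reindex_esum setT setT (fun p : I => ((sg^-1 * p.1)%g, p.2) : I)).
  apply: le_esum => p _; rewrite lee_fin Normc.normcM exprMn ler_wpM2r ?sqr_ge0//.
  by rewrite lerXn2r ?nnegrE ?normc_ge0.
split=> //; first by move=> [g x] [h y] _ _ /= [/mulgI -> ->].
by move=> [g x] _; exists (((sg * g)%g, x) : I) => //=; rewrite mulKg.
Qed.

Lemma slice_ex sg phi (M : R) : 0 <= M -> (forall x, normc (phi x) <= M) ->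
  exists T : bop, (forall xi p, T xi p = slice_fun sg phi xi p) /\
    forall xi, l2norm (T xi) <= M * l2norm xi.
Proof.
move=> M0 phiM.
have sq xi : slice_fun sg phi xi \in @square_summable R I.
  apply/asboolP; rewrite (le_lt_trans (slice_bound sg xi M0 phiM))// normsqE.
  by rewrite -EFinM ltry.
pose T xi : l2 := L2 (sq xi).
have TM xi : l2norm (T xi) <= M * l2norm xi.
  apply: l2norm_leP; first by rewrite mulr_ge0 ?l2norm_ge0.
  rewrite exprMn sqr_l2norm -lee_fin EFinM -!normsqE.
  exact: slice_bound.
have Tb : T \in @bounded_linear R I.
  apply/asboolP; split; last by exists M.
  move=> c x y; apply: l2_ext => p.
  change (slice_fun sg phi (fun q => c * x q + y q) p =
          c * slice_fun sg phi x p + slice_fun sg phi y p).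
  by rewrite /slice_fun mulrDr mulrCA.
by exists (Bop Tb).
Qed.

Lemma bounded_symbol_ge0 phi : bounded_symbol phi ->
  exists2 M : R, 0 <= M & forall x, normc (phi x) <= M.
Proof.
move=> [M phiM]; exists `|M| => // x.
by rewrite (le_trans (phiM x))// ler_norm.
Qed.

Lemma slice_opE sg phi xi p : bounded_symbol phi ->
  slice_op sg phi xi p = slice_fun sg phi xi p.
Proof.
move=> /bounded_symbol_ge0[M M0 phiM]; rewrite /slice_op; case: xgetP => [T _ -> //|h].
by have [T [TE _]] := slice_ex sg M0 phiM; case: (h T).
Qed.

Lemma slice_op_eq sg phi (T : bop) : bounded_symbol phi ->
  (forall xi p, T xi p = slice_fun sg phi xi p) -> T = slice_op sg phi.
Proof.
by move=> phib TE; apply: bop_ext => xi; apply: l2_ext => p; rewrite TE slice_opE.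
Qed.

Lemma slice_op_norm sg phi (M : R) : 0 <= M -> (forall x, normc (phi x) <= M) ->
  opnorm (slice_op sg phi) <= M.
Proof.
move=> M0 phiM; have [T [TE TM]] := slice_ex sg M0 phiM.
by rewrite -(slice_op_eq _ TE); [exact: opnorm_leP|exists M].
Qed.

Lemma bounded_symbol_cst (c : C) : bounded_symbol (fun=> c).
Proof. by exists (normc c). Qed.

Lemma bounded_symbolB phi psi : bounded_symbol phi -> bounded_symbol psi ->
  bounded_symbol (fun x => phi x - psi x).
Proof.
move=> [M phiM] [N psiN]; exists (M + N) => x.
rewrite (le_trans (le_normcD (phi x) (- psi x)))// lerD//.
by rewrite [X in X <= _](normcN (psi x)).
Qed.

Lemma bounded_symbolM phi psi rho : bounded_symbol phi -> bounded_symbol psi ->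
  bounded_symbol (fun x => phi (a rho x) * psi x).
Proof.
move=> [M phiM] [N psiN]; exists (M * N) => x.
by rewrite Normc.normcM ler_pM ?normc_ge0.
Qed.

Lemma slice_opB sg phi psi : bounded_symbol phi -> bounded_symbol psi ->
  slice_op sg phi - slice_op sg psi = slice_op sg (fun x => phi x - psi x).
Proof.
move=> phib psib; apply: slice_op_eq => [|xi p]; first exact: bounded_symbolB.
have -> : (slice_op sg phi - slice_op sg psi) xi p =
  slice_op sg phi xi p - slice_op sg psi xi p by [].
rewrite !slice_opE// /slice_fun.
by rewrite mulrBl.
Qed.

Lemma slice_opD sg phi psi : bounded_symbol phi -> bounded_symbol psi ->
  slice_op sg phi + slice_op sg psi = slice_op sg (fun x => phi x + psi x).
Proof.
move=> phib psib; apply: slice_op_eq => [|xi p].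
  case: phib psib => [M phiM] [N psiN]; exists (M + N) => x.
  by rewrite (le_trans (le_normcD (phi x) (psi x)))// lerD.
have -> : (slice_op sg phi + slice_op sg psi) xi p =
  slice_op sg phi xi p + slice_op sg psi xi p by [].
by rewrite !slice_opE// /slice_fun mulrDl.
Qed.

Lemma slice_opM sg rho phi psi : bounded_symbol phi -> bounded_symbol psi ->
  slice_op sg phi * slice_op rho psi =
  slice_op (sg * rho)%g (fun x => phi (a rho x) * psi x).
Proof.
move=> phib psib; apply: slice_op_eq => [|xi p]; first exact: bounded_symbolM.
rewrite bopM_app slice_opE// /slice_fun slice_opE// /slice_fun /=.
rewrite invgM -!mulgA -(actM a rho) mulVKg mulrA.
by [].
Qed.

Lemma slice_op1 : slice_op 1%g (fun=> 1) = 1.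
Proof.
apply/esym/slice_op_eq => [|xi [g x]]; first exact: bounded_symbol_cst.
by rewrite /slice_fun /= mul1r invg1 mul1g.
Qed.

Lemma slice_op_iso sg xi : sqn (slice_op sg (fun=> 1) xi) = sqn xi.
Proof.
have le rho (z : l2) : sqn (slice_op rho (fun=> 1) z) <= sqn z.
  rewrite -!sqr_l2norm ler_pXn2r ?nnegrE ?l2norm_ge0//.
  rewrite (le_trans (opnorm_app _ _))// ler_piMl ?l2norm_ge0// slice_op_norm//.
  by move=> x; rewrite Normc.normc1.
apply/eqP; rewrite eq_le le /=.
have {1}-> : xi = slice_op sg^-1%g (fun=> 1) (slice_op sg (fun=> 1) xi); last exact: le.
rewrite -bopM_app slice_opM; try exact: bounded_symbol_cst.
rewrite mulVg (_ : (fun x => _) = fun=> 1) ?slice_op1//.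
by apply/funext => x; rewrite mul1r.
Qed.

(** A slice operator is the product of a unitary, given by the group element,
    and a multiplication operator. *)
Lemma slice_op_adj sg phi (x y : l2) : bounded_symbol phi ->
  inner (slice_op sg phi x) y = inner x (slice_op sg^-1%g (fun z => (phi (a sg^-1%g z))^*) y).
Proof.
move=> phib; have b1 := bounded_symbol_cst 1.
have phic : bounded_symbol (fun z => (phi z)^*).
  case: phib => M phiM; exists M => z; rewrite (le_trans _ (phiM z))//.
  by rewrite -lecR -!normC_normc norm_conjC.
have -> : slice_op sg phi = slice_op sg (fun=> 1) * slice_op 1%g phi.
  rewrite slice_opM// mulg1; congr slice_op; apply/funext => z.
  by rewrite mul1r.
have -> : slice_op sg^-1%g (fun z => (phi (a sg^-1%g z))^*) =
    slice_op 1%g (fun z => (phi z)^*) * slice_op sg^-1%g (fun=> 1).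
  rewrite slice_opM// mul1g; congr slice_op; apply/funext => z.
  by rewrite mulr1.
rewrite !bopM_app; set y' := slice_op sg^-1%g _ y.
have -> : y = slice_op sg (fun=> 1) y'.
  rewrite -bopM_app slice_opM// mulgV (_ : (fun x => _) = fun=> 1) ?slice_op1//.
  by apply/funext => z; rewrite mul1r.
rewrite inner_isometry; [|exact: bop_linear|exact: slice_op_iso].
move: (y') => w; apply: eq_inner => -[g z]; rewrite !slice_opE// /slice_fun /= invg1 !mul1g.
by rewrite rmorphM /= conjCK mulrCA mulrA.
Qed.

Lemma slice_op_delta sg phi g h x : bounded_symbol phi ->
  slice_op sg phi (delta R ((h, x) : I)) ((g, x) : I) = phi (a h x) * (g == sg * h)%g%:R.
Proof.
move=> phib; rewrite slice_opE// /slice_fun /=.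
have -> : (((sg^-1 * g)%g, x) == ((h, x) : I)) = (g == sg * h)%g.
  by apply/eqP/eqP => [[<-]|->]; rewrite ?mulVKg// mulKg.
by case: eqP => [->|]; rewrite ?mulr0// mulKg.
Qed.

(** The function on the groupoid by which [S] convolves, recovered from the
    basis vectors at the units. *)
Definition symbol (S : bop) sg (x : X) : C :=
  S (delta R ((1%g, x) : I)) ((sg, x) : I).

Lemma symbolB S T sg x : symbol (S - T) sg x = symbol S sg x - symbol T sg x.
Proof. by []. Qed.

Lemma symbol_slice rho phi sg x : bounded_symbol phi ->
  symbol (slice_op rho phi) sg x = phi x * (sg == rho)%:R.
Proof. by move=> phib; rewrite /symbol slice_op_delta// mulg1 act1. Qed.

Variables (L : Type) (lev : nat -> X -> L).
Hypothesis lev_le : forall i j x y, (i <= j)%N -> lev j x = lev j y -> lev i x = lev i y.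
Hypothesis lev_act : forall i g x y, lev i x = lev i y -> lev i (a g x) = lev i (a g y).
Hypothesis lev_fin : forall i, finite_set (range (lev i)).
Hypothesis lev_unif : forall U : X -> set X, (forall x, nbhs x (U x)) ->
  exists i, forall x, exists x', forall y, lev i y = lev i x -> U x' y.

Definition level_fun i phi := forall x y, lev i x = lev i y -> phi x = phi y.

(** A function of finite level takes finitely many values. *)
Lemma level_fun_bounded i phi : level_fun i phi -> bounded_symbol phi.
Proof.
move=> phii; pose h l : R := xget 0 [set r | exists2 x, lev i x = l & r = normc (phi x)].
have hE x : normc (phi x) = h (lev i x).
  rewrite /h; case: xgetP => [_ _ [y yx ->]|/(_ (normc (phi x)))]; last by case; exists x.
  by rewrite (phii y x yx).
have fin : finite_set (h @` range (lev i)) by exact: finite_image.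
exists (\sum_(r <- fset_set (h @` range (lev i))) `|r|) => x.
rewrite hE (bigD1_seq (h (lev i x))) ?fset_uniq//=.
  by rewrite (le_trans (ler_norm _))// lerDl sumr_ge0.
by rewrite in_fset_set// mem_set//; exists (lev i x) => //; exists x.
Qed.

Definition slice_gen i : set bop :=
  [set T | exists sg phi, level_fun i phi /\ T = slice_op sg phi].

Definition alg i (T : bop) : Prop := T \in zspan (slice_gen i).

Lemma alg_ind i (P : bop -> Prop) : P 0 -> (forall S T, P S -> P T -> P (S - T)) ->
  (forall sg phi, level_fun i phi -> P (slice_op sg phi)) -> forall T, alg i T -> P T.
Proof.
move=> P0 PB Pg T /asboolP/(_ [set T | P T]); apply.
  by move=> _ [sg [phi [phii ->]]]; exact: Pg.
by split=> [|S S' /set_mem PS /set_mem PS']; apply: mem_set => //; exact: PB.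
Qed.

Lemma alg_slice i sg phi : level_fun i phi -> alg i (slice_op sg phi).
Proof. by move=> phii; apply/asboolP => W SW _; apply: SW; exists sg, phi. Qed.

Lemma alg0 i : alg i 0. Proof. exact: rpred0. Qed.

Lemma algB i S T : alg i S -> alg i T -> alg i (S - T).
Proof. exact: rpredB. Qed.

Lemma algD i S T : alg i S -> alg i T -> alg i (S + T).
Proof. exact: rpredD. Qed.

Lemma alg1 i : alg i 1.
Proof. by rewrite -slice_op1; apply: alg_slice. Qed.

Lemma alg_le i j T : (i <= j)%N -> alg i T -> alg j T.
Proof.
move=> ij; move: T; apply: alg_ind => [|S S'|sg phi phii]; [exact: alg0|exact: algB|].
by apply: alg_slice => x y /(lev_le ij)/phii.
Qed.

Lemma level_funM i phi psi rho : level_fun i phi -> level_fun i psi ->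
  level_fun i (fun x => phi (a rho x) * psi x).
Proof. by move=> h1 h2 x y xy; rewrite (h2 x y)// (h1 _ _ (lev_act rho xy)). Qed.

Lemma algM i S T : alg i S -> alg i T -> alg i (S * T).
Proof.
move=> Si; move: T; apply: (@alg_ind i (fun T => alg i (S * T))) => [|U U' h h'|rho psi psii].
- by rewrite mulr0; exact: alg0.
- by rewrite mulrBr; exact: algB.
move: S Si; apply: (@alg_ind i (fun S => alg i (S * slice_op rho psi))) => [|U U' h h'|sg phi phii].
- by rewrite mul0r; exact: alg0.
- by rewrite mulrBl; exact: algB.
rewrite slice_opM; [|exact: level_fun_bounded phii|exact: level_fun_bounded psii].
exact/alg_slice/level_funM.
Qed.

Lemma alg_adj i S : alg i S ->
  exists2 S' : bop, alg i S' & forall x y, inner (S x) y = inner x (S' y).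
Proof.
move: S; apply: alg_ind => [|U V [U' Ui UU'] [V' Vi VV']|sg phi phii].
- exists 0 => [|x y]; first exact: alg0.
  have := innerBl 0 0 y; have := innerBr x 0 0; rewrite !subrr => h1 h2.
  exact: (etrans h2 (esym h1)).
- exists (U' - V'); first exact: algB.
  by move=> x y; rewrite !bopD_app !bopN_app innerBl innerBr UU' VV'.
exists (slice_op sg^-1%g (fun z => (phi (a sg^-1%g z))^*)).
  by apply: alg_slice => x y xy; rewrite (phii _ _ (lev_act _ xy)).
by move=> x y; apply: slice_op_adj; exact: level_fun_bounded phii.
Qed.

(** Convolution operators commute with right translations, so that the entries
    depend on the quotient of the two arrows only. *)
Lemma alg_entry i S g h x : alg i S ->
  S (delta R ((h, x) : I)) ((g, x) : I) = symbol S (g * h^-1)%g (a h x).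
Proof.
move: S; apply: alg_ind => [//|U V hU hV|sg phi phii].
  by rewrite symbolB -hU -hV.
have phib := level_fun_bounded phii.
rewrite slice_op_delta// symbol_slice//; congr (_ * _%:R).
by congr nat_of_bool; apply/eqP/eqP => [->|<-]; rewrite ?mulgK// -mulgA mulVg mulg1.
Qed.

Lemma symbol_level i S sg x y : alg i S -> lev i x = lev i y -> symbol S sg x = symbol S sg y.
Proof.
move=> Si xy; move: S Si; apply: alg_ind => [//|U V hU hV|rho phi phii].
  by rewrite !symbolB hU hV.
have phib := level_fun_bounded phii.
by rewrite !symbol_slice// (phii x y).
Qed.

Lemma symbol_supp i S : alg i S ->
  exists F : {fset Gam}, forall sg x, symbol S sg x != 0 -> sg \in F.
Proof.
move: S; apply: alg_ind => [|U V [F hF] [F' hF']|rho phi phii].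
- by exists fset0 => sg x; rewrite /symbol eqxx.
- exists (F `|` F')%fset => sg x; rewrite symbolB inE.
  case: (eqVneq (symbol U sg x) 0) => [->|/hF ->//].
  by rewrite sub0r oppr_eq0 => /hF' ->; rewrite orbT.
exists [fset rho]%fset => sg x; rewrite symbol_slice; last exact: level_fun_bounded phii.
by rewrite inE; apply: contraNT => /negPf ->; rewrite mulr0.
Qed.

Lemma symbol_norm S sg x : normc (symbol S sg x) <= opnorm S.
Proof.
rewrite (le_trans (le_l2norm _ _))// (le_trans (opnorm_app _ _))//.
by rewrite l2norm_delta mulr1.
Qed.

(** Uniform continuity on a compact totally disconnected space. *)
Lemma level_approx (f : X -> C) (e : R) : continuous f -> 0 < e ->
  exists i phi, level_fun i phi /\ forall x, normc (f x - phi x) <= e.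
Proof.
move=> fc e0; pose U x := [set y | normc (f x - f y) <= e].
have Un x : nbhs x (U x).
  have /cvgrPdist_le/(_ e%:C%C) : f y @[y --> x] --> f x by exact: fc.
  by rewrite ltcR => /(_ e0); apply: filterS => y; rewrite normC_normc lecR.
have [i iP] := lev_unif Un.
pose Z x : set C := [set v | exists2 x', v = f x' & forall y, lev i y = lev i x -> U x' y].
exists i, (fun x => xget 0 (Z x)); split.
  move=> x y xy; congr (xget 0 _); apply/seteqP.
  by split=> v [x' -> h]; exists x' => // z zx; apply: h; rewrite zx xy.
move=> x; case: xgetP => [_ _ [x' -> h]|/(_ _) h].
  by rewrite -[X in X <= _]normcN opprB; exact: h.
by have [x' x'P] := iP x; case: (h (f x')); exists x'.
Qed.

Lemma continuous_bounded (f : X -> C) : continuous f -> bounded_symbol f.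
Proof.
move=> fc; have [i [phi [phii h]]] := level_approx fc ltr01.
have [M phiM] := level_fun_bounded phii.
exists (1 + M) => x; rewrite -(subrK (phi x) (f x)).
by rewrite (le_trans (le_normcD (f x - phi x) (phi x)))// lerD.
Qed.

Lemma alg_approx (F : seq Gam) (f : Gam -> X -> C) (e : R) :
  (forall sg, continuous (f sg)) -> 0 < e ->
  exists i S, alg i S /\ opnorm (\sum_(sg <- F) slice_op sg (f sg) - S) <= e.
Proof.
move=> fc; elim: F e => [|sg F IH] e e0.
  by exists 0%N, 0; split; [exact: alg0|rewrite big_nil subrr opnorm0 ltW].
have e2 : 0 < e / 2 by rewrite divr_gt0.
have [i [S [Si SF]]] := IH _ e2; have [j [phi [phij fphi]]] := level_approx (fc sg) e2.
exists (maxn i j), (slice_op sg phi + S); split.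
  apply: algD; last by apply: alg_le Si; exact: leq_maxl.
  by apply: alg_le (alg_slice sg phij); exact: leq_maxr.
rewrite big_cons opprD addrACA (le_trans (opnormD _ _))// [e]splitr lerD//.
rewrite slice_opB; [|exact: continuous_bounded|exact: level_fun_bounded phij].
by apply: slice_op_norm => //; exact: ltW.
Qed.

(** Only the finitely many slices that meet the support of [f] contribute to the
    convolution sum. *)
Lemma convolution_sum (f : I -> C) (F : seq Gam) (xi : I -> C) (g : I) : uniq F ->
  (forall sg x, f ((sg, x) : I) != 0 -> sg \in F) ->
  \sum_(h \in [set h : I | src h = src g]) f (gmul g (ginv h)) * xi h =
  \sum_(sg <- F) slice_fun sg (fun x => f ((sg, x) : I)) xi g.
Proof.
case: g => g x uF fF.
pose r : seq I := [seq ((sg^-1 * g)%g, x) | sg <- F].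
have ur : uniq r by rewrite map_inj_uniq// => s t [/mulIg/invg_inj].
rewrite -(@fsbig_widen _ _ _ _ [set` r]); last 2 first.
- by move=> p /= /mapP[sg _ ->].
- move=> [h y] [/= yx nr]; rewrite [f _](_ : _ = 0) ?mul0r//.
  apply: contrapT => /eqP/(fF (g * h^-1)%g (a h y)) gF; apply: nr; apply/mapP.
  by exists (g * h^-1)%g => //; rewrite yx invgF -mulgA mulVg mulg1.
rewrite -fsbig_seq// big_map; apply: eq_bigr => sg _.
congr (f _ * _); rewrite /= /tmul /=; congr (_, _).
by rewrite invgM invgK mulgA mulgV mul1g.
Qed.

(** The projection of a compact set to the discrete group is finite. *)
Lemma regular_rep_slices (f : I -> C) (S : bop) : CcC f -> regular_rep f S ->
  exists F : {fset Gam}, S = \sum_(sg <- F) slice_op sg (fun x => f ((sg, x) : I)) /\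
    forall sg, continuous (fun x => f ((sg, x) : I)).
Proof.
move=> [fc fK] Sf.
have slc sg : continuous (fun x => f ((sg, x) : I)).
  move=> x; apply: (@continuous_comp _ _ _ (fun y => (sg, y) : I) f); last exact: fc.
  by apply: tarrow_cvg; [exact: nearW|exact: cvg_id].
have fin : finite_set ((fun p : I => p.1 : Gam) @` supp f).
  by apply: compact_discrete_finite fK _ => p; exact: near_fst.
pose F := fset_set ((fun p : I => p.1 : Gam) @` supp f).
have fF sg x : f ((sg, x) : I) != 0 -> sg \in F.
  move=> f0; rewrite in_fset_set// mem_set//; exists ((sg, x) : I) => //.
  exact: subset_closure.
exists F; split => //; apply: bop_ext => xi; apply: l2_ext => -[g x].
have sumE (r : seq Gam) : (\sum_(sg <- r) slice_op sg (fun x => f ((sg, x) : I))) xi (g, x) =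
    \sum_(sg <- r) f ((sg, a (sg^-1 * g)%g x) : I) * xi ((sg^-1 * g)%g, x).
  rewrite sum_bop l2_sum; apply: eq_bigr => sg _.
  by rewrite slice_opE//; exact: continuous_bounded.
by rewrite sumE Sf (convolution_sum _ _ (fset_uniq F) fF).
Qed.

(** A compactly supported function is a finite sum of slices, on each of which
    it is uniformly approximated by functions of finite level. *)
Lemma Cstar_red_closure (T : bop) : Cstar_red T ->
  bop_closure (fun S => exists i, alg i S) T.
Proof.
move=> TC e e0; have e2 : 0 < e / 2 by rewrite divr_gt0.
have [f [S [fC Sf TS]]] := TC _ e2.
have [F [SF slc]] := regular_rep_slices fC Sf.
have [i [U [Ui US]]] := alg_approx F slc e2.
exists U; split; first by exists i.
by apply: (opnorm_close_trans TS); rewrite SF.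
Qed.

Lemma slices_Cstar_red (F : seq Gam) (c : C) : compact [set: X] -> uniq F ->
  Cstar_red (\sum_(sg <- F) slice_op sg (fun=> c) : bop).
Proof.
move=> cX uF e e0; pose f : I -> C := fun p => if p.1 \in F then c else 0.
have near_f p : \forall q \near p, f q = f p.
  by apply: filterS (@near_fst Gam X p) => q qp; rewrite /f qp.
exists f, (\sum_(sg <- F) slice_op sg (fun=> c)); split; last by rewrite subrr opnorm0.
  split.
    by move=> p; exact: cvg_near_cst (near_f p).
  have cK : compact ([set` F] `*` [set: X] : set (discrete_topology Gam * X)%type).
    apply: compact_setX cX; apply: finite_compact; exact: finite_seq.
  apply: (@subclosed_compact I _ ([set` F] `*` [set: X])) => //; first exact: closed_closure.
  move=> [g x] clf; have [q [qf qp]] := clf _ (@near_fst Gam X (g, x)).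
  by split=> //; move: qf; rewrite /= /f qp /=; case: ifP => // _; rewrite eqxx.
move=> xi g; rewrite (@convolution_sum f F xi g uF) => [|sg x].
  rewrite sum_bop l2_sum; apply: eq_big_seq => sg sgF.
  by rewrite slice_opE ?/slice_fun /f /= ?sgF//; exact: bounded_symbol_cst.
by rewrite /f /=; case: ifP => //; rewrite eqxx.
Qed.
End CrossedProduct.

(** * Two traces on the slice algebra *)

Lemma fsum_enum (V : zmodType) (J : choiceType) (K : finType) (e : K -> J) (f : J -> V) :
  injective e -> (forall k, f k != 0 -> exists j, k = e j) ->
  \sum_(k \in [set: J]) f k = \sum_j f (e j).
Proof.
move=> einj cover; rewrite -(@fsbig_widen _ _ _ _ [set` [seq e j | j <- enum K]])//.
  rewrite -fsbig_seq ?big_map ?big_enum//.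
  by rewrite map_inj_uniq ?enum_uniq.
move=> k [_ nk]; apply: contrapT => /eqP/cover[j kj]; apply: nk => /=.
by rewrite kj map_f// mem_enum.
Qed.

Lemma fsum_window (V : zmodType) (f : int -> V) (c : nat) :
  (forall k, f k != 0 -> (`|k| <= c)%N) ->
  \sum_(k \in [set: int]) f k = \sum_(j < c.*2.+1) f (j%:Z - c%:Z).
Proof.
move=> fc; apply: (@fsum_enum V int _ (fun j : 'I_(c.*2.+1) => j%:Z - c%:Z)).
  by move=> i j /= ij; apply: val_inj => /=; lia.
move=> k /fc kc; have kl : (absz (k + c%:Z)%R < c.*2.+1)%N by lia.
by exists (Ordinal kl) => /=; lia.
Qed.

Section TwoTraces.
Variables (R : realType) (X : topologicalType) (a : action dihedral X).
Variables (L : Type) (lev : nat -> X -> L) (pt : int -> X) (n : nat -> nat).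
Hypothesis lev_le : forall i j x y, (i <= j)%N -> lev j x = lev j y -> lev i x = lev i y.
Hypothesis lev_act : forall i g x y, lev i x = lev i y -> lev i (a g x) = lev i (a g y).
Hypothesis lev_fin : forall i, finite_set (range (lev i)).
Hypothesis pt_act : forall g k, a g (pt k) = pt (int_act g k).
Hypothesis n_pos : forall i, (0 < n i)%N.
Hypothesis lev_pt : forall i k, lev i (pt (k + (n i)%:Z)) = lev i (pt k).
Local Notation C := (Cx R).
Local Notation G := (transformation_etale_groupoid a).
Local Notation I := (arrow G).
Local Notation bop := (bop R I).
Local Notation normc := (@Normc.normc R).
Local Notation alg := (@alg R dihedral X a L lev).
Local Notation slice_op := (@slice_op R dihedral X a).
Local Notation level_fun := (@level_fun R X L lev).

(** The reflection of the integers about [k]. *)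
Definition reflection (k : int) : dihedral := (2 * k, true).

(** The orbital sum over the conjugacy class of the reflections with an even
    translation part, each taken at its fixed point. *)
Definition reflection_trace (S : bop) : C :=
  \sum_(k \in [set: int]) symbol S (reflection k) (pt k).

(** The integral of the symbol over the units, for functions of level at most
    [m]. *)
Definition mean_trace (m : nat) (S : bop) : C :=
  (n m)%:R^-1 * \sum_(x < n m) symbol S 1%g (pt x%:Z).

Lemma lev_ptM i k l : lev i (pt (k + l * (n i)%:Z)) = lev i (pt k).
Proof.
elim/int_ind_step: l => [|l]; first by rewrite mul0r addr0.
by rewrite mulrDl mul1r addrA lev_pt.
Qed.

Lemma reflection_supp i S : alg i S ->
  exists c : nat, forall k x, symbol S (reflection k) x != 0 -> (`|k| <= c)%N.
Proof.
move=> /symbol_supp[//|F hF]; exists (\sum_(sg <- F) `|sg.1|)%N => k x /hF kF.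
rewrite (bigD1_seq _ kF) ?fset_uniq//= /reflection /=.
by set u := (\sum_(_ <- _ | _) _)%N; lia.
Qed.

Lemma reflection_traceB i S T : alg i S -> alg i T ->
  reflection_trace (S - T) = reflection_trace S - reflection_trace T.
Proof.
move=> /reflection_supp[c hc] /reflection_supp[d hd].
rewrite /reflection_trace !(@fsum_window _ _ (c + d)).
- by rewrite -sumrB; apply: eq_bigr => j _; rewrite symbolB.
- by move=> k /hd; lia.
- by move=> k /hc; lia.
move=> k; rewrite symbolB; case: (eqVneq (symbol S (reflection k) (pt k)) 0) => [->|/hc].
  by rewrite sub0r oppr_eq0 => /hd; lia.
by lia.
Qed.

Lemma mean_traceB m S T : mean_trace m (S - T) = mean_trace m S - mean_trace m T.
Proof. by rewrite /mean_trace -mulrBr -sumrB. Qed.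

(** By bilinearity, since the slices span; the right-hand sides are the products
    of two slices in both orders. *)
Lemma trace_of_slices i (t : bop -> C) :
  (forall S T, alg i S -> alg i T -> t (S - T) = t S - t T) ->
  (forall sg rho phi psi, level_fun i phi -> level_fun i psi ->
    t (slice_op (sg * rho)%g (fun x => phi (a rho x) * psi x)) =
    t (slice_op (rho * sg)%g (fun x => psi (a sg x) * phi x))) ->
  forall S T, alg i S -> alg i T -> t (S * T) = t (T * S).
Proof.
move=> tB tg S T Si Ti.
have algM := @algM R dihedral X a L lev lev_act lev_fin i.
have t0 : t 0 = 0 by rewrite -[in LHS](subrr 0) tB ?subrr//; exact: alg0.
suff [] : alg i S /\ t (S * T) = t (T * S) by [].
move: S Si; apply: (@alg_ind R dihedral X a L lev i
    (fun S => alg i S /\ t (S * T) = t (T * S))) => [|U V [Ui hU] [Vi hV]|sg phi phii].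
- by split; [exact: alg0|rewrite mul0r mulr0].
- split; first exact: algB.
  by rewrite mulrBl mulrBr !tB ?hU ?hV//; exact: algM.
have Pi : alg i (slice_op sg phi) by exact: alg_slice.
split => //; set P := slice_op sg phi in Pi *.
suff [] : alg i T /\ t (P * T) = t (T * P) by [].
move: T Ti; apply: (@alg_ind R dihedral X a L lev i
    (fun T => alg i T /\ t (P * T) = t (T * P))) => [|U V [Ui hU] [Vi hV]|rho psi psii].
- by split; [exact: alg0|rewrite mul0r mulr0].
- split; first exact: algB.
  by rewrite mulrBl mulrBr !tB ?hU ?hV//; exact: algM.
split; first exact: alg_slice.
have phib := level_fun_bounded lev_fin phii; have psib := level_fun_bounded lev_fin psii.
by rewrite !slice_opM// tg.
Qed.

Lemma reflection_conj rho k : (reflection (int_act rho k) * rho = rho * reflection k)%g.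
Proof.
case: rho => r b; rewrite /reflection /int_act.
change ((2 * (r + (-1) ^+ b * k) + (-1) ^+ true * r, true (+) b) =
  (r + (-1) ^+ b * (2 * k), b (+) true) :> (int * bool)%type).
by congr (_, _); [rewrite expr1; ring|rewrite addbC].
Qed.

Lemma reflection_fix k : int_act (reflection k) k = k.
Proof. by rewrite /int_act /= expr1; ring. Qed.

(** Conjugation by [rho] carries the reflection about [k] to the one about [rho
    k], so the two sums correspond to each other under [k |-> rho k]. *)
Lemma reflection_traceC i S T : alg i S -> alg i T ->
  reflection_trace (S * T) = reflection_trace (T * S).
Proof.
move: S T; apply: trace_of_slices; first exact: reflection_traceB.
move=> sg rho phi psi phii psii.
have phib := level_fun_bounded lev_fin phii; have psib := level_fun_bounded lev_fin psii.
rewrite /reflection_trace [RHS](@reindex_fsbigT _ _ _ _ _ (int_act rho)); last first.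
  by exists (int_act rho^-1%g) => k; rewrite -int_actM ?mulVg ?mulgV int_act1.
apply: eq_fsbigr => k _; rewrite !symbol_slice; try exact: bounded_symbolM.
have e : (reflection (int_act rho k) == rho * sg)%g = (reflection k == sg * rho)%g.
  rewrite -(inj_eq (@mulIg _ rho)) reflection_conj -mulgA.
  by apply/eqP/eqP => [/mulgI|->].
rewrite e; case: eqP => [ek|_]; last by rewrite !mulr0.
by rewrite !mulr1 !pt_act -int_actM -ek reflection_fix mulrC.
Qed.

Lemma sum_int_act (V : zmodType) (F : int -> V) N rho : (0 < N)%N ->
  (forall k, F (k + N%:Z) = F k) ->
  \sum_(x < N) F (int_act rho x%:Z) = \sum_(x < N) F x%:Z.
Proof.
move=> N0 FN; case: rho => r [] /=; last first.
  rewrite -[RHS](sum_periodic r N0 FN).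
  by apply: eq_bigr => x _; rewrite /int_act /= mul1r addrC.
rewrite -[RHS](sum_periodic (r - N%:Z + 1) N0 FN) [RHS](reindex_inj rev_ord_inj) /=.
apply: eq_bigr => x _; rewrite /int_act /= expr1; congr F.
by have := ltn_ord x; lia.
Qed.

(** The action of the group preserves the counting measure on Z/n_m. *)
Lemma mean_traceC i m S T : (i <= m)%N -> alg i S -> alg i T ->
  mean_trace m (S * T) = mean_trace m (T * S).
Proof.
move=> im; move: S T; apply: trace_of_slices; first by move=> *; exact: mean_traceB.
move=> sg rho phi psi phii psii.
have phib := level_fun_bounded lev_fin phii; have psib := level_fun_bounded lev_fin psii.
rewrite /mean_trace; congr (_ * _).
have b1 := bounded_symbolM a rho phib psib; have b2 := bounded_symbolM a sg psib phib.
under eq_bigr do rewrite (symbol_slice _ _ _ _ b1).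
under [RHS]eq_bigr do rewrite (symbol_slice _ _ _ _ b2).
have e : (1 == rho * sg)%g = (1 == sg * rho)%g.
  by rewrite eq_sym [RHS]eq_sym !mulg_eq1; apply/eqP/eqP => ->; rewrite invgK.
rewrite e; case: eqP => [rs|_]; last by rewrite !big1// => x _; rewrite mulr0.
pose F k := psi (a sg (pt k)) * phi (pt k).
transitivity (\sum_(x < n m) F (int_act rho x%:Z)).
  apply: eq_bigr => x _.
  by rewrite mulr1 /F -pt_act -actM -rs act1 mulrC.
rewrite sum_int_act//; first by apply: eq_bigr => x _; rewrite mulr1.
move=> k; rewrite /F; have h := lev_le im (lev_pt m k).
by rewrite (phii _ _ h) (psii _ _ (lev_act sg h)).
Qed.

Lemma mean_trace_le m S : normc (mean_trace m S) <= 1 * opnorm S.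
Proof.
have N0 : 0 < (n m)%:R :> R by rewrite ltr0n.
rewrite /mean_trace Normc.normcM Normc.normcV mul1r.
have -> : normc (n m)%:R = (n m)%:R.
  by rewrite -[(n m)%:R](_ : ((n m)%:R : R)%:C%C = _ :> C) ?normc_real ?ger0_norm ?rmorph_nat.
rewrite mulrC ler_pdivrMr//.
have h (r : seq 'I_(n m)) : normc (\sum_(x <- r) symbol S 1%g (pt x%:Z)) <=
    opnorm S * (size r)%:R.
  elim: r => [|x r IH]; first by rewrite big_nil mulr0 Normc.normc0.
  rewrite big_cons (le_trans (le_normcD (symbol S 1%g (pt x%:Z)) _))//.
  by rewrite /= -[X in X%:R]add1n natrD mulrDr mulr1 lerD// symbol_norm.
by have := h (enum 'I_(n m)); rewrite big_enum size_enum_ord.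
Qed.

Section FixedLevel.
Variables (i : nat) (S : bop) (Si : alg i S).
Local Notation N := (n i).

Let beta (x l : int) : C := symbol S (reflection (x + l * N%:Z)) (pt x).

Let betaE x l : beta x l = symbol S (reflection (x + l * N%:Z)) (pt (x + l * N%:Z)).
Proof. by apply: (symbol_level lev_fin _ Si); rewrite lev_ptM. Qed.

(** The bound [c] is made strict on the right so that the window has exactly [2
    c] elements. *)
Lemma beta_supp : exists c : nat, (0 < c)%N /\ forall (x : 'I_N) l,
  beta x%:Z l != 0 -> - c%:Z <= l < c%:Z.
Proof.
have [c hc] := reflection_supp Si; exists c.+1; split => // x l /hc.
have xN := ltn_ord x; have N0 := n_pos i.
move=> h; have {h} : - c%:Z <= x%:Z + l * N%:Z <= c%:Z by lia.
move=> /andP[h1 h2]; apply/andP; split.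
  rewrite leNgt; apply/negP => h3; have : l * N%:Z <= - (c.+1%:Z + 1) * N%:Z.
    by rewrite ler_wpM2r//; lia.
  by nia.
by rewrite ltNge; apply/negP => h3; have : c.+1%:Z * 1 <= l * N%:Z by [nia]; lia.
Qed.

Lemma reflection_trace_residues : reflection_trace S =
  \sum_(x < N) \sum_(l \in [set: int]) beta x%:Z l.
Proof.
have [c [c0 hc]] := beta_supp.
have N0 := n_pos i.
rewrite /reflection_trace (@fsum_enum _ int ('I_N * 'I_(c.*2))%type
    (fun xl => xl.1%:Z + (xl.2%:Z - c%:Z) * N%:Z)).
- rewrite -(pair_big xpredT xpredT (fun (x : 'I_N) (l : 'I_(c.*2)) =>
    symbol S (reflection (x%:Z + (l%:Z - c%:Z) * N%:Z)) (pt (x%:Z + (l%:Z - c%:Z) * N%:Z)))) /=.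
  apply: eq_bigr => x _.
  rewrite (@fsum_enum _ int 'I_(c.*2) (fun l => l%:Z - c%:Z)).
  + by apply: eq_bigr => l _; rewrite betaE.
  + by move=> l l' /= e; apply: val_inj => /=; lia.
  move=> l /hc lc; have ll : (absz (l + c%:Z)%R < c.*2)%N by lia.
  by exists (Ordinal ll) => /=; lia.
- move=> [x l] [x' l'] /= e; have xN := ltn_ord x; have xN' := ltn_ord x'.
  have : (l = l' :> nat) by nia.
  move=> ll; congr (_, _); apply: val_inj => //=.
  by move: e; rewrite ll; lia.
move=> k; have kE := divz_eq k N%:Z.
have kN : (absz (k %% N%:Z)%Z < N)%N by lia.
pose x := Ordinal kN; have {}kE : k = x%:Z + (k %/ N%:Z)%Z * N%:Z by rewrite {1}kE /=; lia.
rewrite {1 2}kE -betaE => /hc lc.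
have ll : (absz ((k %/ N%:Z)%Z + c%:Z)%R < c.*2)%N by lia.
exists (x, Ordinal ll); rewrite {1}kE; congr (_ + _ * _).
by rewrite /=; lia.
Qed.

(** The entries from the translation by [x + 2 v N] to the reflection with
    translation part [x + 2 (c - u) N] depend on [v - u] only. In the rectangle
    of size [c] by [3 c] each of the [c] columns contains all nonzero values
    exactly once, so that the sum of the entries is [c] times the sum to be
    bounded, while the norms of the two vectors of the rectangle grow like the
    square root of [c]. *)
Lemma residue_le (x : 'I_N) :
  normc (\sum_(l \in [set: int]) beta x%:Z l) <= 8 * opnorm S.
Proof.
have [c [c0 hc]] := beta_supp; have N0 := n_pos i.
set A := \sum_(l \in _) _.
pose f (v : 'I_c) : I := (((x%:Z + 2 * v%:Z * N%:Z, false) : dihedral), pt 0).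
pose g (u : 'I_(3 * c)) : I := (((x%:Z + 2 * (c%:Z - u%:Z) * N%:Z, true) : dihedral), pt 0).
have finj : injective f by move=> v w [e]; apply: val_inj => /=; nia.
have ginj : injective g by move=> v w [e]; apply: val_inj => /=; nia.
have := rectangle_bound S finj ginj; rewrite !card_ord.
have -> : \sum_j \sum_k S (delta R (f j)) (g k) = c%:R * A.
  rewrite -[X in _ = X%:R * _](card_ord c) mulr_natl -sumr_const; apply: eq_bigr => v _.
  rewrite /A (@fsum_enum _ int 'I_(3 * c) (fun u => v%:Z - u%:Z + c%:Z)).
  - apply: eq_bigr => u _; rewrite (alg_entry lev_fin _ _ _ Si) pt_act.
    have -> : int_act (x%:Z + 2 * v%:Z * N%:Z, false) 0 = x%:Z + 2 * v%:Z * N%:Z.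
      by rewrite /int_act /= mulr0 addr0.
    rewrite (symbol_level lev_fin _ Si (lev_ptM i x (2 * v%:Z))); congr (symbol S _ _).
    change ((x%:Z + 2 * (c%:Z - u%:Z) * N%:Z + (-1) ^+ true * - ((-1) ^+ false *
      (x%:Z + 2 * v%:Z * N%:Z)), true) = reflection (x%:Z + (v%:Z - u%:Z + c%:Z) * N%:Z)).
    by rewrite /reflection; congr (_, _); rewrite expr0 expr1; ring.
  - by move=> u w /= e; apply: val_inj => /=; lia.
  move=> l /hc lc; have ul : (absz (v%:Z + c%:Z - l)%R < 3 * c)%N by have := ltn_ord v; lia.
  by exists (Ordinal ul) => /=; have := ltn_ord v; lia.
rewrite Normc.normcM.
have cR : 0 < c%:R :> R by rewrite ltr0n.
have -> : normc c%:R = c%:R.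
  by rewrite -[c%:R](_ : (c%:R : R)%:C%C = _ :> C) ?normc_real ?ger0_norm ?rmorph_nat.
have sq : Num.sqrt c%:R * Num.sqrt (3 * c)%:R <= 2 * c%:R :> R.
  rewrite -sqrtrM// natrM -(@ler_pXn2r _ 2)// ?nnegrE ?sqrtr_ge0 ?mulr_ge0//.
  rewrite sqr_sqrtr ?mulr_ge0// exprMn.
  have := sqr_ge0 (c%:R : R); rewrite expr2; lra.
move=> h; rewrite -(ler_pM2l cR) (le_trans h)//.
have s0 := opnorm_ge0 S.
have -> : c%:R * (8 * opnorm S) = 4 * opnorm S * (2 * c%:R) by ring.
by rewrite ler_wpM2l// mulr_ge0.
Qed.

Lemma reflection_trace_le : normc (reflection_trace S) <= (8 * N%:R) * opnorm S.
Proof.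
rewrite reflection_trace_residues.
have h (r : seq 'I_N) : normc (\sum_(x <- r) \sum_(l \in [set: int]) beta x%:Z l) <=
    8 * opnorm S * (size r)%:R.
  elim: r => [|x r IH]; first by rewrite big_nil mulr0 Normc.normc0.
  rewrite big_cons (le_trans (le_normcD (\sum_(l \in [set: int]) beta x%:Z l) _))//.
  by rewrite /= -[(size r).+1%:R]natr1 mulrDr mulr1 addrC lerD// residue_le.
by have := h (enum 'I_N); rewrite big_enum size_enum_ord mulrAC.
Qed.
End FixedLevel.

Lemma reflection_bounded_trace i :
  bounded_trace (@opnorm R I) normc (alg i) reflection_trace (8 * (n i)%:R).
Proof.
split; [exact: alg1|by move=> *; exact: algB|by move=> *; exact: algM|..].
- by move=> x y; exact: reflection_traceB.
- by move=> x y; exact: reflection_traceC.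
- by move=> *; exact: reflection_trace_le.
Qed.

Lemma mean_bounded_trace i m : (i <= m)%N ->
  bounded_trace (@opnorm R I) normc (alg i) (mean_trace m) 1.
Proof.
move=> im; split; [exact: alg1|by move=> *; exact: algB|by move=> *; exact: algM|..].
- by move=> x y _ _; exact: mean_traceB.
- by move=> x y; exact: (mean_traceC im).
- by move=> *; exact: mean_trace_le.
Qed.
End TwoTraces.

(** * Two independent classes in K0 *)

Lemma decayingMz (R : realType) (V : zmodType) (absV : V -> R) (u : nat -> V) (b : int) :
  absV 0 = 0 -> (forall x y, absV (x + y) <= absV x + absV y) ->
  (forall x, absV (- x) = absV x) ->
  decaying absV u -> decaying absV (fun m => u m *~ b).
Proof.
move=> a0 aD aN un; have nat_case k : decaying absV (fun m => u m *+ k).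
  elim: k => [|k IH]; first by exists 0, 0%N => m _; rewrite a0 mul0r.
  by apply: decaying_eq (decayingD aD un IH) => m; rewrite mulrS.
case: b => k; first exact: nat_case.
by apply: decaying_eq (decayingN aN (nat_case k.+1)) => m; rewrite NegzE mulrNz.
Qed.

(** The second part is stated for an arbitrary subgroup [W], so that an
    invariant need only be checked on the two families of relations. *)
Lemma grothendieck_class (S : choiceType) (eqv : S -> S -> Prop) (plus : S -> S -> S -> Prop) :
  exists cl : {additive {freeg S} -> grothendieck eqv plus},
  forall x, cl x = 0 -> forall W : set {freeg S}, zmod_closed (mem W) ->
    (forall p q, eqv p q -> W (gen p - gen q)) ->
    (forall p q r, plus p q r -> W (gen r - (gen p + gen q))) -> W x.
Proof.
rewrite /grothendieck; set Z := zspan _.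
exists (\pi_(Quotient.quot Z))%qT => x /quot_pi_eq0 /asboolP h W Wcl We Wp.
apply: h => // y [[p [q [pq ->]]]|[p [q [r [pqr ->]]]]]; [exact: We|exact: Wp].
Qed.

Section KTheoryRank.
Variables (R : realType) (X : topologicalType) (a : action dihedral X).
Variables (L : Type) (lev : nat -> X -> L) (pt : int -> X) (n : nat -> nat).
Hypothesis X_compact : compact [set: X].
Hypothesis lev_le : forall i j x y, (i <= j)%N -> lev j x = lev j y -> lev i x = lev i y.
Hypothesis lev_act : forall i g x y, lev i x = lev i y -> lev i (a g x) = lev i (a g y).
Hypothesis lev_fin : forall i, finite_set (range (lev i)).
Hypothesis lev_unif : forall U : X -> set X, (forall x, nbhs x (U x)) ->
  exists i, forall x, exists x', forall y, lev i y = lev i x -> U x' y.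
Hypothesis pt_act : forall g k, a g (pt k) = pt (int_act g k).
Hypothesis n_pos : forall i, (0 < n i)%N.
Hypothesis lev_pt : forall i k, lev i (pt (k + (n i)%:Z)) = lev i (pt k).
Local Notation C := (Cx R).
Local Notation G := (transformation_etale_groupoid a).
Local Notation I := (arrow G).
Local Notation B := (bop R I).
Local Notation normc := (@Normc.normc R).
Local Notation alg := (@alg R dihedral X a L lev).
Local Notation slice_op := (@slice_op R dihedral X a).
Local Notation A := (@Cstar_red R G).
Local Notation closed := (bop_closure (fun S : B => exists i, alg i S)).

Lemma bop_closure_in_closure (x : B) : closed x -> in_closure (@opnorm R I) alg x.
Proof. by move=> xc e /xc[y [[i yi] yx]]; exists i, y. Qed.

Lemma Cstar_in_closure (x : B) : A x -> in_closure (@opnorm R I) alg x.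
Proof. by move=> xA; apply: bop_closure_in_closure; exact: (Cstar_red_closure lev_le lev_fin lev_unif). Qed.

Lemma Cstar_adj_in_closure (x : B) : A x -> in_closure (@opnorm R I) alg (adj x).
Proof.
move=> xA; apply: bop_closure_in_closure; apply: adj_closure.
- by exists 0%N; exact: alg0.
- move=> S [i Si]; have [S' S'i SS'] := alg_adj lev_act lev_fin Si.
  by exists S' => //; exists i.
exact: (Cstar_red_closure lev_le lev_fin lev_unif).
Qed.

Section OneTrace.
Variables (T : nat -> B -> C) (D : nat -> R).
Hypothesis D_ge0 : forall i, 0 <= D i.
Hypothesis T_trace : forall i m, (i <= m)%N ->
  bounded_trace (@opnorm R I) normc (alg i) (T m) (D i).

Definition proj_trace (p : {k : nat & 'M[B]_k}) : nat -> C :=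
  idem_trace (@opnorm R I) alg T (projT2 p).

Let alg_mono i j x : (i <= j)%N -> alg i x -> alg j x := @alg_le _ _ _ _ _ lev lev_le i j x.

(** The elements on which the invariant decays form a subgroup that contains the
    defining relations of [K0]. *)
Lemma proj_trace_K0 (x : {freeg (projections A)}) :
  (forall W : set {freeg (projections A)}, zmod_closed (mem W) ->
    (forall p q, murray_von_neumann p q -> W (gen p - gen q)) ->
    (forall p q r, direct_sum p q r -> W (gen r - (gen p + gen q))) -> W x) ->
  decaying normc (zlift (fun p : projections A => proj_trace (\val p)) x).
Proof.
move=> /(_ [set x | decaying normc (zlift (fun p : projections A => proj_trace (\val p)) x)]).
apply=> [|p q [v [vA pv qv]]|p q r rE] /=.
- split=> [|u v /set_mem un /set_mem vn]; apply: mem_set; rewrite /= ?raddf0 ?raddfB.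
    by exists 0, 0%N => m _; rewrite Normc.normc0 mul0r.
  exact: (decaying_eq _ (decayingD (@le_normcD R) un (decayingN (@normcN R) vn))).
- have [_ _ pp] := set_mem (valP p); have [_ _ qq] := set_mem (valP q).
  rewrite raddfB /= !zliftU /proj_trace -pv -qv.
  apply: (idem_trace_mvn (@opnorm0 R I) (@opnorm_ge0 R I) (@opnormD R I) (@opnormN R I)
    (@opnormM R I) (Normc.normc0 R) (@le_normcD R) (@normcN R) alg_mono D_ge0 T_trace).
  + by rewrite pv.
  + by rewrite qv.
  + by move=> i j; rewrite !mxE; apply: Cstar_adj_in_closure.
  + by move=> i j; apply: Cstar_in_closure.
have [pA _ pp] := set_mem (valP p); have [qA _ qq] := set_mem (valP q).
rewrite raddfB raddfD /= !zliftU /proj_trace rE /=.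
apply: (idem_trace_oplus (@opnorm0 R I) (@opnorm_ge0 R I) (@opnormD R I) (@opnormN R I)
    (@opnormM R I) (Normc.normc0 R) (@le_normcD R) (@normcN R) alg_mono D_ge0 T_trace) => //.
- by move=> i j; apply: Cstar_in_closure.
- by move=> i j; apply: Cstar_in_closure.
Qed.

(** For projections that already belong to a finite level the invariant is a
    constant sequence. *)
Lemma proj_trace_relation (x y : B) (p q : projections A) (b c : int) (t u : C) :
  \val p = existT _ 1%N x%:M -> \val q = existT _ 1%N y%:M ->
  x * x = x -> y * y = y -> alg 0 x -> alg 0 y ->
  (forall m, T m x = t) -> (forall m, T m y = u) ->
  decaying normc (zlift (fun p : projections A => proj_trace (\val p)) (gen p *~ b + gen q *~ c)) ->
  t *~ b + u *~ c = 0.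
Proof.
move=> px qy xx yy xi yi Tx Ty dec.
have combine (P Q : C) : P *~ b + Q *~ c - ((P - t) *~ b + (Q - u) *~ c) = t *~ b + u *~ c.
  by rewrite !mulrzBl; move: (P *~ b) (Q *~ c) (t *~ b) (u *~ c) => *; ring.
have approx z w : z * z = z -> alg 0 z -> (forall m, T m z = w) ->
    decaying normc (fun m => proj_trace (existT _ 1%N (z%:M : 'M[B]_1)) m - w).
  move=> zz zi Tz.
  have zM : (z%:M : 'M[B]_1) *m z%:M = z%:M by rewrite -scalar_mxM zz.
  have zA : mAlg alg 0 (z%:M : 'M[B]_1).
    by move=> i j; rewrite !ord1 mxE eqxx mulr1n.
  apply: decaying_eq (idem_trace_alg (@opnorm0 R I) (@opnorm_ge0 R I) (@opnormD R I)
    (@opnormN R I) (@opnormM R I) (Normc.normc0 R) (@le_normcD R) (@normcN R) alg_mono D_ge0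
    T_trace zM zA) => m.
  by rewrite /mtrace big_ord1 mxE eqxx mulr1n Tz.
have Mz := decayingMz _ (Normc.normc0 R) (@le_normcD R) (@normcN R).
have h1 := Mz _ b (approx _ _ xx xi Tx); have h2 := Mz _ c (approx _ _ yy yi Ty).
apply: (decaying_const (@normc_ge0 R) (@Normc.eq0_normc R)).
apply: (decaying_eq _ (decayingD (@le_normcD R) dec (decayingN (@normcN R)
  (decayingD (@le_normcD R) h1 h2)))) => m.
rewrite raddfD !raddfMz /= !zliftU px qy.
rewrite [X in X + _](_ : _ = proj_trace (existT _ 1%N (x%:M : 'M[B]_1)) m *~ b +
  proj_trace (existT _ 1%N (y%:M : 'M[B]_1)) m *~ c); last first.
  exact: (congr2 +%R (funMz _ _ _) (funMz _ _ _)).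
exact: combine.
Qed.
End OneTrace.

(** The projection [(1 + s) / 2] for the reflection [s] about 0. *)
Definition half_sum : B :=
  slice_op 1%g (fun=> 2^-1) + slice_op (reflection 0) (fun=> 2^-1).

Let b2 : @bounded_symbol R X (fun=> 2^-1) := bounded_symbol_cst _ _.

Lemma reflection0_invol : (reflection 0 * reflection 0 = 1)%g.
Proof. by []. Qed.

Lemma half_sum_idem : half_sum * half_sum = half_sum.
Proof.
have q (x y : dihedral) : slice_op x (fun=> 2^-1) * slice_op y (fun=> 2^-1) =
    slice_op (x * y)%g (fun=> 2^-1 * 2^-1) by rewrite slice_opM.
have b4 : @bounded_symbol R X (fun=> 2^-1 * 2^-1) := bounded_symbol_cst _ _.
have d (x : dihedral) : slice_op x (fun=> 2^-1) =
    slice_op x (fun=> 2^-1 * 2^-1) + slice_op x (fun=> 2^-1 * 2^-1).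
  by rewrite slice_opD//; congr slice_op; apply/funext => y; field.
rewrite /half_sum mulrDl !mulrDr !q mulg1 !mul1g reflection0_invol.
by rewrite [in RHS]d [in RHS](d (reflection 0)) [X in _ + X]addrC addrACA.
Qed.

Lemma half_sum_adj : adj half_sum = half_sum.
Proof.
apply: adj_eq => x y; rewrite /half_sum bopD_app innerDl.
rewrite (bopD_app (slice_op 1%g _) _ y) innerDr; congr (_ + _).
  rewrite (slice_op_adj _ _ _ b2) invg1.
  by congr (inner x (slice_op _ _ y)); apply/funext => z; rewrite fmorphV rmorph_nat.
rewrite (slice_op_adj _ _ _ b2).
by congr (inner x (slice_op _ _ y)); apply/funext => z; rewrite fmorphV rmorph_nat.
Qed.

Lemma half_sum_Cstar : A half_sum.
Proof.
have := @slices_Cstar_red R dihedral X a [:: 1%g; reflection 0] 2^-1 X_compact isT.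
by rewrite !big_cons big_nil addr0.
Qed.

Lemma one_Cstar : A (1 : B).
Proof.
have := @slices_Cstar_red R dihedral X a [:: 1%g] 1 X_compact isT.
by rewrite !big_cons big_nil addr0 slice_op1.
Qed.

Lemma adj1 : adj (1 : B) = 1.
Proof. exact: adj_eq. Qed.

Lemma half_sum_alg : alg 0 half_sum.
Proof. by apply: algD; apply: alg_slice. Qed.

Lemma reflection_eq0 k : (reflection k == reflection 0) = (k == 0).
Proof. by apply/eqP/eqP => [[]|->]//; lia. Qed.

Lemma reflection_neq1 k : (reflection k == 1%g) = false.
Proof. by apply/eqP. Qed.

Lemma reflection_trace1 : reflection_trace pt (1 : B) = 0.
Proof.
rewrite /reflection_trace -slice_op1; apply: fsbig1 => k _.
by rewrite symbol_slice ?reflection_neq1 ?mulr0//; exact: bounded_symbol_cst.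
Qed.

Lemma reflection_trace_half : reflection_trace pt half_sum = 2^-1.
Proof.
have sE k : symbol half_sum (reflection k) (pt k) = 2^-1 * (k == 0)%:R.
  rewrite [LHS](_ : _ = symbol (slice_op 1%g (fun=> 2^-1)) (reflection k) (pt k) +
    symbol (slice_op (reflection 0) (fun=> 2^-1)) (reflection k) (pt k))//.
  by rewrite !symbol_slice// reflection_neq1 reflection_eq0 mulr0 add0r.
rewrite /reflection_trace (@fsum_enum _ int 'I_1 (fun=> 0)).
- by rewrite big_ord1 sE eqxx mulr1.
- by move=> i j _; rewrite !ord1.
move=> k; rewrite sE; case: (eqVneq k 0) => [->|_]; first by exists ord0.
by rewrite mulr0 eqxx.
Qed.

Lemma mean_trace1 m : mean_trace pt n m (1 : B) = 1.
Proof.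
rewrite /mean_trace -slice_op1.
under eq_bigr do rewrite (symbol_slice _ _ _ _ (bounded_symbol_cst _ (1 : C))) eqxx mulr1.
rewrite sumr_const card_ord mulVf// pnatr_eq0 -lt0n; exact: n_pos.
Qed.

Lemma mean_trace_half m : mean_trace pt n m half_sum = 2^-1.
Proof.
have sE x : symbol half_sum 1%g x = 2^-1.
  rewrite [LHS](_ : _ = symbol (slice_op 1%g (fun=> 2^-1)) 1%g x +
    symbol (slice_op (reflection 0) (fun=> 2^-1)) 1%g x)//.
  by rewrite !symbol_slice// eqxx [1%g == _]eq_sym reflection_neq1 mulr0 addr0 mulr1.
rewrite /mean_trace; under eq_bigr do rewrite sE.
rewrite sumr_const card_ord mulrnAr -mulrnAl -[_^-1 *+ _]mulr_natl divff ?mul1r//.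
by rewrite pnatr_eq0 -lt0n; exact: n_pos.
Qed.

Lemma one_projection (x : B) : A x -> adj x = x -> x * x = x ->
  exists p : projections A, \val p = existT _ 1%N (x%:M : 'M[B]_1).
Proof.
move=> xA xadj xx.
have h : existT _ 1%N (x%:M : 'M[B]_1) \in projections A.
  apply: mem_set; split=> /=.
  - by move=> i j; rewrite !ord1 mxE eqxx mulr1n.
  - by apply/matrixP => i j; rewrite !ord1 !mxE eqxx mulr1n.
  - by rewrite -scalar_mxM xx.
by exists (SigSub h).
Qed.

(** The reflection trace takes the values 0 and 1/2 on the two projections [1]
    and [half_sum], the mean trace takes the values 1 and 1/2. *)
Lemma K0_rank_two : exists u v : K0 A, forall b c : int,
  u *~ b + v *~ c = 0 -> b = 0 /\ c = 0.
Proof.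
have [p pE] := one_projection one_Cstar adj1 (mulr1 1).
have [q qE] := one_projection half_sum_Cstar half_sum_adj half_sum_idem.
have [cl clP] := grothendieck_class (@murray_von_neumann R I A) (@direct_sum R I (projections A)).
exists (cl (gen p)), (cl (gen q)) => b c bc.
have rel : cl (gen p *~ b + gen q *~ c) = 0 by rewrite raddfD !raddfMz.
have {}rel := clP _ rel.
have r1 i m : (i <= m)%N -> bounded_trace (@opnorm R I) normc (alg i) (reflection_trace pt)
    (8 * (n i)%:R) by move=> _; exact: reflection_bounded_trace.
have d1 i : 0 <= 8 * (n i)%:R :> R by rewrite mulr_ge0.
have r2 i m : (i <= m)%N ->
    bounded_trace (@opnorm R I) normc (alg i) (mean_trace pt n m) 1.
  by move=> im; exact: mean_bounded_trace.
have a1 : alg 0 1 by exact: alg1.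
have e1 := proj_trace_relation d1 r1 pE qE (mulr1 1) half_sum_idem a1 half_sum_alg
  (fun=> reflection_trace1) (fun=> reflection_trace_half) (proj_trace_K0 d1 r1 rel).
have e2 := proj_trace_relation (fun=> ler01) r2 pE qE (mulr1 1) half_sum_idem a1 half_sum_alg
  mean_trace1 mean_trace_half (proj_trace_K0 (fun=> ler01) r2 rel).
have c0 : c = 0.
  apply/eqP; move/eqP: e1; rewrite mul0rz add0r -mulrzr mulf_eq0 invr_eq0 pnatr_eq0 /=.
  by rewrite intr_eq0.
by split => //; apply/eqP; move/eqP: e2; rewrite c0 mulr0z addr0 intr_eq0.
Qed.
End KTheoryRank.

(** * The rank of the even homology *)

Section DirectSumRank.
Variable n : nat -> nat.
Hypothesis n_incr : forall i : nat, (n i < n i.+1)%N.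
Hypothesis n_dvd : forall i : nat, (n i %| n i.+1)%N.

Local Notation H := (fun i => dihedral_sub (n i)).
Local Notation X := (@odometer dihedral H).
Local Notation act := (@odometer_action dihedral H).
Local Notation G := (transformation_etale_groupoid act).
Local Notation even_homology := (dsum (fun k => homology G (2 * k))).

Lemma dsumD (V : nat -> zmodType) (u v : dsum V) k :
  dsum_val (u + v) k = dsum_val u k + dsum_val v k.
Proof. by []. Qed.

Lemma dsumMz (V : nat -> zmodType) (u : dsum V) (b : int) k : dsum_val (u *~ b) k = dsum_val u k *~ b.
Proof.
have nat_case m : dsum_val (u *+ m) k = dsum_val u k *+ m by elim: m => // m IH; rewrite !mulrS -IH.
case: b => m; first exact: nat_case.
by rewrite !NegzE !mulrNz -[RHS]/(- (dsum_val u k *+ m.+1)) -nat_case.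
Qed.

Lemma homology_double_ge m (u : homology G m) : (1 < m)%N -> u *+ 2 = 0.
Proof. by case: m u => [|[|m]] // u _; exact: homology_double. Qed.

(** All summands but the first one are killed by 2, and the first one has rank
    at most one. *)
Lemma even_homology_rank_one (u v : even_homology) : exists b c : int,
  (b != 0) || (c != 0) /\ u *~ b + v *~ c = 0.
Proof.
have [e eP] := homology0_rank n_incr n_dvd.
have [N [x [N0 ue]]] := eP (dsum_val u 0%N); have [M [y [M0 ve]]] := eP (dsum_val v 0%N).
have rel b c : (dsum_val u 0%N) *~ b + (dsum_val v 0%N) *~ c = 0 -> u *~ (b * 2) + v *~ (c * 2) = 0.
  move=> h0; apply: val_inj; apply: functional_extensionality_dep => k.
  rewrite -[LHS]/(dsum_val (u *~ (b * 2) + v *~ (c * 2)) k) dsumD !dsumMz !mulrzA -mulrzDl.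
  case: k => [|k]; first by rewrite h0 mul0rz.
  by apply: homology_double_ge; rewrite mulnS.
have [xy|xy] := boolP ((x == 0) && (y == 0)).
  move: xy ue => /andP[/eqP -> _] ue; exists (N%:Z * 2), (0 * 2); split.
    by apply/orP; left; lia.
  by apply: rel; rewrite mulr0z addr0 -pmulrn ue mulr0z.
exists (N%:Z * y * 2), (- (M%:Z * x) * 2); split.
  move: xy; rewrite negb_and => /orP[x0|y0]; apply/orP; [right|left].
    by rewrite mulf_eq0 oppr_eq0 mulf_eq0 !negb_or x0 !andbT; lia.
  by rewrite !mulf_eq0 !negb_or y0 !andbT; lia.
apply: rel; rewrite mulrNz !mulrzA -!pmulrn ue ve.
by rewrite -!mulrzA (mulrC x) subrr.
Qed.
End DirectSumRank.

Theorem mainTheorem3 (R : realType) (n : nat -> nat)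
    (n_incr : forall i : nat, (n i < n i.+1)%N)
    (n_dvd : forall i : nat, (n i %| n i.+1)%N) :
  let G := transformation_etale_groupoid
             (odometer_action (fun i => dihedral_sub (n i))) in
  [/\ @second_countable (arrow G), etale G, minimal G, essentially_principal G
    & homeomorphic (unit_space G) cantor_space]
  /\ ~ HK_property R G.
Proof.
move=> G; split.
  split.
  - exact: dihedral_second_countable.
  - exact: etaleP.
  - exact: dihedral_minimal.
  - exact: dihedral_essentially_principal.
  - exact: (unit_space_cantor n_incr n_dvd R).
move=> [[f [g fK gK]] _].
have [u [v uv]] : exists u v : K0 (@Cstar_red R G), forall b c : int,
    u *~ b + v *~ c = 0 -> b = 0 /\ c = 0.
  apply: (@K0_rank_two R _ _ _ (@level n) (int_point n) n).
  - exact: odometer_compact.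
  - exact: level_le.
  - exact: level_act_eq.
  - move=> i; apply: (@sub_finite_set _ _ [set \val C | C in [set: cosets (dihedral_sub (n i))]]).
      by move=> _ [x _ <-]; exists (\val x i).
    by apply: finite_image; exact: cosets_finite.
  - exact: uniform_level.
  - exact: act_int_point.
  - exact: n_gt0.
  move=> i k; rewrite !level_int_point; apply/residue_classP.
  by rewrite addrAC subrr add0r dvdzz.
have [b [c [bc0 bc]]] := even_homology_rank_one n_incr n_dvd (f u) (f v).
have [b0 c0] := uv b c (can_inj fK (etrans (raddfD f _ _)
  (etrans (congr2 +%R (raddfMz f _ _) (raddfMz f _ _)) (etrans bc (esym (raddf0 f)))))).
by move: bc0; rewrite b0 c0 eqxx.
Qed.
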